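(* Let $(\mathcal A,\tau)$ be an algebraic traffic space, with trace $\Phi(a)=\tau[\circlearrowleft_a]$ (the value of $\tau$ on a single loop labeled $a$) and anti-trace $\Psi(a)=\tau[\cdot\overset{a}{\rightarrow}\cdot]$ (the value of $\tau$ on a single non-loop edge labeled $a$). Let $\mathbf a_1,\dots,\mathbf a_L$ be (traffic) independent families of elements of $\mathcal A$. (1) Say that $\mathbf a=(a_j)_{j\in J}$ is unitarily invariant if it has the same traffic distribution as $u\mathbf a u^*=(ua_ju^* )_{j\in J}$, where $(u,u^* )$ is independent from $\mathbf a$, satisfies $uu^*=u^*u=\mathbb I$, and is the limit in traffic distribution of $(U_N,U_N^* )$ for $U_N$ a unitary Haar matrix of size $N\to\infty$. If $\mathbf a_\ell$ is unitarily invariant for each $\ell=1,\dots,L$, except possibly one, then $\mathbf a_1,\dots,\mathbf a_L$ are free independent in the non commutative probability space $(\mathcal A,\Phi)$. (2) Say that $\mathbf a$ is of Boolean type if its combinatorial distribution $T\mapsto\tau[T(\mathbf a)]$ is supported on trees (i.e. $\tau[T(\mathbf a)]=0$ whenever the test graph $T$ is not a tree). If $\mathbf a_\ell$ is of Boolean type for each $\ell=1,\dots,L$, then $\mathbf a_1,\dots,\mathbf a_L$ are Boolean independent with respect to $\Psi$. (3) Say that $a\in\mathcal A$ is diagonal if $a=\Delta(a)$. If the elements of $\mathbf a_\ell$ are diagonal for each $\ell=1,\dots,L$, then $\mathbf a_1,\dots,\mathbf a_L$ are tensor independent, both in $(\mathcal A,\Phi)$ and in $(\mathcal A,\Psi)$.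 Reciprocally, for families of diagonal elements of an algebraic traffic space, tensor independence in $(\mathcal A,\Phi)$ (resp. in $(\mathcal A,\Psi)$) characterizes traffic independence: if such families are tensor independent with respect to $\Phi$ (resp. $\Psi$) then they are traffic independent.
   Context: Graphs are finite, connected, directed, with nonempty vertex set; loops, multiple edges and empty edge set are allowed. A tree is a connected graph without cycles (in particular no loops or multiple edges) when orientation is forgotten. $\mathcal G$-algebras. A graph operation with $K$ edges is a graph $g$ with $K$ edges numbered $1,\dots,K$ and two vertices $in,out$ (possibly equal). A $\mathcal G$-algebra is a complex vector space $\mathcal A$ with, for each graph operation $g$ with $K$ edges, a linear map $Z_g:\mathcal A^{\otimes K}\to\mathcal A$ (an element of $\mathcal A$ if $K=0$) such that: $Z_{(\cdot\leftarrow\cdot)}=\mathrm{id}$ for the graph with two vertices $in\neq out$ and one edge from $in$ to $out$; $Z_g(a_1\otimes\dots\otimes a_K)$ depends only on which element is placed on which edge, not on the numbering of edges; and $Z_g(Z_{g_1}\otimes\dots\otimes Z_{g_K})=Z_{g(g_1,\dots,g_K)}$, where $g(g_1,\dots,g_K)$ is obtained by replacing the $k$-th edge of $g$ by $g_k$, the input (resp. output) of $g_k$ being identified with the source (resp. target) of the edge. The element $\mathbb I=Z_{(\cdot)}$ comes from the one-vertex graph without edges. The product $ab$ is $Z$ of $(\underset{out}\cdot\overset{a}\leftarrow\cdot\overset{b}\leftarrow\underset{in}\cdot)$, making $\mathcal A$ a unital algebra with unit $\mathbb I$. $\Delta(a)$ is $Z$ of the graph with one vertex $in=out$ and one loop labeled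 $a$. A $\mathcal G$-subalgebra is a subspace stable under all $Z_g$. Traffic spaces. A test graph in variables $\mathbf x=(x_j)_{j\in J}$ is a graph with edges labeled by the $x_j$; $T(\mathbf a)$ is the graph with label $x_j$ replaced by $a_j$. $\mathbb C\mathcal T\langle\mathcal A\rangle$ is the vector space spanned by graphs with edges labeled in $\mathcal A$. An algebraic traffic space is a $\mathcal G$-algebra $\mathcal A$ with a linear form $\tau:\mathbb C\mathcal T\langle\mathcal A\rangle\to\mathbb C$ such that: $\tau$ of the graph with no edges is $1$; $\tau[T]$ is unchanged when an edge labeled $Z_h(a_1\otimes\dots\otimes a_K)$ is replaced by the graph $h$ with labels $a_1,\dots,a_K$ (input at the source, output at the target); $\tau$ is linear in the label of each edge. The traffic (or combinatorial) distribution of $\mathbf a$ is $T\mapsto\tau[T(\mathbf a)]$. The injective version $\tau^0$ is the linear form defined by $\tau[T]=\sum_{\pi\in\mathcal P(V)}\tau^0[T^\pi]$ for all $T$, where $V$ is the vertex set of $T$, $\mathcal P(V)$ its set of partitions and $T^\pi$ is obtained by identifying vertices in the same block. ''$(u,u^* )$ is the limit of $(U_N,U_N^* )$'' means $\tau[T(u,u^* )]=\lim_N\mathbb E\big[\frac1N\sum_{\phi:V\to\{1,\dots,N\}}\prod_{e=(v,w)}U_N^{\varepsilon(e)}(\phi(w),\phi(v))\big]$ for test graphs $T$ with edges labeled $u^{\varepsilon(e)}$, $\varepsilon(e)\in\{1,*\}$, $e=(v,w)$ going from $v$ to $w$. As in the paper, the existence of $u$ independent from $\mathbf a$ (possibly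 after enlarging the traffic space) is taken for granted. Traffic independence. For a test graph $T$ in variables $\mathbf x_1,\dots,\mathbf x_L$ (pairwise disjoint families), a colored component is a maximal connected subgraph with at least one edge and with all labels in one family; $\mathcal{CC}(T)$ is their set. $\mathcal{GCC}(T)$ is the undirected bipartite graph whose vertices are the colored components and the vertices of $T$ belonging to at least two of them, with an edge between a component and such a vertex it contains. $\mathcal G$-subalgebras $\mathcal A_1,\dots,\mathcal A_L$ are (traffic) independent if for all families $\mathbf a_\ell$ in $\mathcal A_\ell$ and all $T$, $\tau^0[T(\mathbf a_1,\dots,\mathbf a_L)]=\mathbf 1(\mathcal{GCC}(T)\text{ is a tree})\prod_{S\in\mathcal{CC}(T)}\tau^0[S(\mathbf a_1,\dots,\mathbf a_L)]$. Families are independent if the $\mathcal G$-subalgebras they span are; equivalently, the formula holds for these families and all $T$. Classical notions. Families are free (resp. tensor) independent with respect to a unital linear form if the unital subalgebras $\mathcal A_\ell$ they generate are: free means $\Phi(b_1\cdots b_n)=0$ whenever $b_j\in\mathcal A_{\ell_j}$, $\Phi(b_j)=0$, $\ell_j\ne\ell_{j+1}$; tensor means the $\mathcal A_\ell$ commute with each other and $\Phi(b_1\cdots b_L)=\prod_\ell\Phi(b_\ell)$ for $b_\ell\in\mathcal A_\ell$ (and similarly with $\Psi$). They are Boolean independent with respect to $\Psi$ if, for the non-unital subalgebras $\mathcal A_\ell$ they generate, $\Psi(b_1\cdots b_n)=\prod_j\Psi(b_j)$ whenever $b_j\in\mathcal A_{\ell_j}$, $\ell_j\neq\ell_{j+1}$.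 *)

(* Defs.v *)
From HB Require Import structures.
From mathcomp Require Import all_boot all_order all_algebra.
From mathcomp Require Import complex.
From mathcomp Require Import all_classical all_reals all_analysis.

Set Implicit Arguments.
Unset Strict Implicit.
Unset Printing Implicit Defensive.

Import Order.TTheory GRing.Theory Num.Theory numFieldNormedType.Exports.

Local Open Scope classical_set_scope.
Local Open Scope ring_scope.

(* R[i] packed so that the generic topology of a numFieldType is inferred. *)
Definition Cplx (R : realType) : numClosedFieldType := R[i].

Record mgraph (X : Type) := MGraph {
  vtx : finType;
  edg : finType;
  src : edg -> vtx;
  tgt : edg -> vtx;
  lab : edg -> X }.
Arguments src {X m} _.
Arguments tgt {X m} _.
Arguments lab {X m} _.

Section MGraph.
Variable X : Type.
Implicit Types G : mgraph X.

Definition adj G : rel (vtx G) := [rel x y | [exists e : edg G,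
  ((x, y) == (src e, tgt e)) || ((y, x) == (src e, tgt e))]].

(* Nonemptiness of the vertex set is not part of [mconn]. *)
Definition mconn G : bool := [forall x, forall y, connect (@adj G) x y].

(* A pair (e, b) is the edge e travelled in its direction if b, and backwards
   otherwise. *)
Definition dsrc G (d : edg G * bool) := if d.2 then src d.1 else tgt d.1.
Definition dtgt G (d : edg G * bool) := if d.2 then tgt d.1 else src d.1.

Definition mcycle G (s : seq (edg G * bool)) : bool :=
  [&& s != [::], path.cycle (fun d d' => dtgt d == dsrc d') s,
      uniq (map fst s) & uniq (map (@dsrc G) s)].

(* The graph with no vertex counts as a tree: this is only relevant to [gcc],
   which has no vertex when the test graph has no edge, and there the
   factorization formula of [indep_subalgs] has to read 1 = 1. *)
Definition is_tree G : Prop :=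
  mconn G /\ forall s : seq (edg G * bool), ~~ mcycle s.

Lemma adj_sym G : symmetric (@adj G).
Proof. by move=> x y; apply: eq_existsb => e; rewrite orbC. Qed.

Lemma adj_edge G (e : edg G) : adj (src e) (tgt e).
Proof. by apply/existsP; exists e; rewrite eqxx. Qed.

Lemma conn_sym G : connect_sym (@adj G).
Proof. exact/sym_connect_sym/adj_sym. Qed.

Lemma mconnP G : reflect (forall x y, connect (@adj G) x y) (mconn G).
Proof. by apply: (iffP forallP) => h x; [apply/forallP|apply/forallP]. Qed.

Lemma mconn_from G (x0 : vtx G) :
  (forall x, connect (@adj G) x0 x) -> (0 < #|vtx G|)%N && mconn G.
Proof.
move=> h; apply/andP; split; first by apply/card_gt0P; exists x0.
apply/mconnP => x y; apply: (connect_trans (y := x0)); last exact: h.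
by rewrite conn_sym; exact: h.
Qed.

End MGraph.

Lemma connect_img X Y (G : mgraph X) (H : mgraph Y) (f : vtx G -> vtx H) :
  (forall e : edg G, connect (@adj _ H) (f (src e)) (f (tgt e))) ->
  forall x y, connect (@adj _ G) x y -> connect (@adj _ H) (f x) (f y).
Proof.
move=> hf x y /connectP[p + ->]; elim: p x => //= z p IH x /andP[xz zp].
apply: connect_trans (IH _ zp); case/existsP: xz => e /orP[]/eqP[-> ->] //.
by rewrite sym_connect_sym //; move=> a b; apply: eq_existsb => e'; rewrite orbC.
Qed.


Definition mrelab X Y (G : mgraph X) (l : edg G -> Y) : mgraph Y :=
  MGraph (@src X G) (@tgt X G) l.

Definition vpart (V : finType) :=
  {P : {set {set V}} | finset.partition P [set: V]%SET}.

Section Blocks.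
Variable (V : finType) (P : vpart V).

Definition part_block := {B : {set V} | B \in val P}.

Lemma pblock_vpart (x : V) : finset.pblock (val P) x \in val P.
Proof.
have /and3P[/eqP cP _ _] := valP P.
by apply: finset.pblock_mem; rewrite cP inE.
Qed.

Definition vblock (x : V) : part_block :=
  exist (fun B => B \in val P) (finset.pblock (val P) x) (pblock_vpart x).

Lemma vblock_surj (B : part_block) : exists x, vblock x = B.
Proof.
have /and3P[/eqP cP tP nP] := valP P.
case: (set_0Vmem (val B)) => [B0|[x xB]].
  by move: nP; rewrite -B0 (valP B).
by exists x; apply/val_inj => /=; apply: finset.def_pblock => //; exact: valP.
Qed.

Lemma vblock_eq x y : y \in finset.pblock (val P) x -> vblock x = vblock y.
Proof.
have /and3P[_ tP _] := valP P.
by move=> yx; apply/val_inj => /=; apply/esym/finset.same_pblock.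
Qed.

End Blocks.

Definition mquot X (G : mgraph X) (P : vpart (vtx G)) : mgraph X :=
  @MGraph X (part_block P) (edg G)
    (fun e => vblock P (src e)) (fun e => vblock P (tgt e)) lab.

Record tgraph (X : Type) := TGraph {
  tg :> mgraph X;
  tg_conn : (0 < #|vtx tg|)%N && mconn tg }.

Record gop (X : Type) := GOp {
  gop_graph :> tgraph X;
  gin : vtx gop_graph;
  gout : vtx gop_graph }.
Arguments gin {X} _.
Arguments gout {X} _.

Definition trelab X Y (T : tgraph X) (l : edg T -> Y) : tgraph Y :=
  @TGraph Y (mrelab l) (tg_conn T).
Definition grelab X Y (g : gop X) (l : edg g -> Y) : gop Y :=
  @GOp Y (trelab l) (gin g) (gout g).

Definition tmap X Y (f : X -> Y) (T : tgraph X) : tgraph Y :=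
  @trelab X Y T (fun e => f (lab e)).
Definition gmap X Y (f : X -> Y) (g : gop X) : gop Y :=
  @grelab X Y g (fun e => f (lab e)).

Definition miso X (G H : mgraph X) (f : vtx G -> vtx H) (k : edg G -> edg H) : Prop :=
  [/\ bijective f, bijective k, forall e, src (k e) = f (src e),
      forall e, tgt (k e) = f (tgt e) & forall e, lab (k e) = lab e].

Definition tiso X (T T' : tgraph X) : Prop := exists f k, @miso X T T' f k.
Definition giso X (g g' : gop X) : Prop :=
  exists f k, [/\ @miso X g g' f k, f (gin g) = gin g' & f (gout g) = gout g'].

Lemma tquot_conn X (T : tgraph X) (P : vpart (vtx T)) :
  (0 < #|vtx (mquot P)|)%N && mconn (mquot P).
Proof.
case/andP: (tg_conn T) => /card_gt0P[x0 _] /mconnP cT.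
apply: (@mconn_from _ (mquot P) (vblock P x0)) => B.
have [x <-] := vblock_surj B.
apply: (@connect_img X X T (mquot P) (vblock P)); last exact: cT.
by move=> e; apply: connect1; exact: (@adj_edge _ (mquot P) e).
Qed.

Definition tquot X (T : tgraph X) (P : vpart (vtx T)) : tgraph X :=
  TGraph (tquot_conn P).

Section Flatten.
Variables (X : Type) (T : tgraph (gop X)).

Definition fl_vtx : finType := (vtx T + {e : edg T & vtx (lab e)})%type.
Definition fl_outer (v : vtx T) : fl_vtx := inl v.
Definition fl_inner (e : edg T) (v : vtx (lab e)) : fl_vtx :=
  inr (existT (fun e : edg T => vtx (lab e)) e v).

Definition fl_union : mgraph X :=
  @MGraph X fl_vtx {e : edg T & edg (lab e)}
    (fun d => @fl_inner (tag d) (src (tagged d)))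
    (fun d => @fl_inner (tag d) (tgt (tagged d)))
    (fun d => lab (tagged d : edg (lab (tag d)))).

(* The source of e is glued to the input of its label, the target of e to the
   output. *)
Definition fl_glue : rel (vtx fl_union) := [rel x y | [exists e : edg T,
  ((x, y) == (fl_outer (src e), fl_inner (gin (lab e)))) ||
  ((x, y) == (fl_outer (tgt e), fl_inner (gout (lab e))))]].

Definition fl_rel : rel (vtx fl_union) :=
  connect [rel x y | fl_glue x y || fl_glue y x].

Lemma fl_rel_equiv :
  {in [set: vtx fl_union]%SET & &, equivalence_rel fl_rel}.
Proof.
move=> x y z _ _ _; split; first exact: connect0.
move=> xy; rewrite /fl_rel (same_connect _ xy) //.
by apply: sym_connect_sym => a b /=; rewrite orbC.
Qed.

Definition fl_part : vpart (vtx fl_union) :=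
  exist _ (equivalence_partition fl_rel [set: vtx fl_union]%SET)
    (equivalence_partitionP fl_rel_equiv).

Lemma fl_part_eq x y : fl_rel x y -> vblock fl_part x = vblock fl_part y.
Proof.
move=> xy; apply: vblock_eq.
by rewrite (pblock_equivalence_partition fl_rel_equiv) ?inE.
Qed.

Lemma tflatten_conn :
  (0 < #|vtx (mquot fl_part)|)%N && mconn (mquot fl_part).
Proof.
case/andP: (tg_conn T) => /card_gt0P[x0 _] /mconnP cT.
have glue x y : fl_glue x y -> vblock fl_part x = vblock fl_part y.
  by move=> h; apply/fl_part_eq/connect1; rewrite /= h.
have gs e : vblock fl_part (fl_outer (src e)) =
    vblock fl_part (fl_inner (gin (lab e))).
  by apply: glue; apply/existsP; exists e; rewrite eqxx.
have gt e : vblock fl_part (fl_outer (tgt e)) =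
    vblock fl_part (fl_inner (gout (lab e))).
  by apply: glue; apply/existsP; exists e; rewrite eqxx orbT.
have inner (e : edg T) (x y : vtx (lab e)) : connect (@adj _ (mquot fl_part))
    (vblock fl_part (fl_inner x))
    (vblock fl_part (fl_inner y)).
  pose f (z : vtx (lab e)) := vblock fl_part (fl_inner z).
  apply: (@connect_img X X (lab e) (mquot fl_part) f).
    move=> d; apply: connect1.
    exact: (@adj_edge _ (mquot fl_part) (existT (fun e : edg T => edg (lab e)) e d)).
  by case/andP: (tg_conn (lab e)) => _ /mconnP.
have outer x y : connect (@adj _ (mquot fl_part))
    (vblock fl_part (fl_outer x)) (vblock fl_part (fl_outer y)).
  apply: (@connect_img _ X T (mquot fl_part) (fun z => vblock fl_part (fl_outer z))).
    by move=> e; rewrite gs gt; exact: inner.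
  exact: cT.
apply: (@mconn_from _ (mquot fl_part) (vblock fl_part (fl_outer x0))) => B.
have [[x <-|[e x] <-]] := vblock_surj B; first exact: outer.
apply: (connect_trans (y := vblock fl_part (fl_outer (src e)))); first exact: outer.
by rewrite gs; exact: inner.
Qed.

Definition tflatten : tgraph X := TGraph tflatten_conn.

End Flatten.

Definition gflatten X (g : gop (gop X)) : gop X :=
  @GOp X (tflatten g) (vblock (fl_part g) (fl_outer (gin g)))
    (vblock (fl_part g) (fl_outer (gout g))).

Section Elementary.
Variable X : Type.
Implicit Types a b : X.

Definition mpoint : mgraph X :=
  @MGraph X unit void (fun=> tt) (fun=> tt) (fun e : void => match e with end).
Definition mloop a : mgraph X := @MGraph X unit unit id id (fun=> a).
(* The edge goes from [false] to [true]. *)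
Definition medge a : mgraph X :=
  @MGraph X bool unit (fun=> false) (fun=> true) (fun=> a).
(* Some true <-a- None <-b- Some false *)
Definition mpath2 a b : mgraph X :=
  @MGraph X (option bool) bool
    (fun e => if e then None else Some false)
    (fun e => if e then Some true else None) (fun e => if e then a else b).

Lemma point_conn : (0 < #|vtx mpoint|)%N && mconn mpoint.
Proof. by apply: (@mconn_from _ mpoint tt) => -[]; exact: connect0. Qed.
Lemma loop_conn a : (0 < #|vtx (mloop a)|)%N && mconn (mloop a).
Proof. by apply: (@mconn_from _ (mloop a) tt) => -[]; exact: connect0. Qed.
Lemma edge_conn a : (0 < #|vtx (medge a)|)%N && mconn (medge a).
Proof.
apply: (@mconn_from _ (medge a) false) => -[]; last exact: connect0.
by apply: connect1; exact: (@adj_edge _ (medge a) tt).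
Qed.
Lemma path2_conn a b : (0 < #|vtx (mpath2 a b)|)%N && mconn (mpath2 a b).
Proof.
have [e1 e2] := (@adj_edge _ (mpath2 a b) true, @adj_edge _ (mpath2 a b) false).
apply: (@mconn_from _ (mpath2 a b) (Some false)) => -[[]|].
- by apply: (connect_trans (y := None : vtx (mpath2 a b))); exact: connect1.
- exact: connect0.
- exact: connect1.
Qed.

Definition point_graph : tgraph X := TGraph point_conn.
Definition loop_graph a : tgraph X := TGraph (loop_conn a).
Definition edge_graph a : tgraph X := TGraph (edge_conn a).
Definition path2_graph a b : tgraph X := TGraph (path2_conn a b).

Definition point_op : gop X := @GOp X point_graph tt tt.
Definition loop_op a : gop X := @GOp X (loop_graph a) tt tt.
Definition edge_op a : gop X := @GOp X (edge_graph a) false true.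
Definition path2_op a b : gop X := @GOp X (path2_graph a b) (Some false) (Some true).

End Elementary.
Arguments point_graph {X}.
Arguments point_op {X}.

(* The linear map Z_g on the K-th tensor power is given as the corresponding
   multilinear map, and its arguments are placed on the edges of the graph:
   [gact g] for g : gop A stands for Z_g(a_1 (x) ... (x) a_K) where a_k labels
   the k-th edge.  Independence of the numbering of the edges is then part of
   the invariance under isomorphism.  A graph h : gop (gop A) is an operation
   g with an operation g_k with labels in A on each edge. *)
Record galgebra (R : realType) := GAlgebra {
  galg_sort :> lmodType (Cplx R);
  gact : gop galg_sort -> galg_sort;
  gact_iso : forall g g', giso g g' -> gact g = gact g';
  gact_linear : forall (g : gop galg_sort) (e : edg g) (c : Cplx R) x y,
    gact (grelab (g := g) [eta lab with e |-> c *: x + y]) =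
    c *: gact (grelab (g := g) [eta lab with e |-> x])
    + gact (grelab (g := g) [eta lab with e |-> y]);
  gact_id : forall a, gact (edge_op a) = a;
  gact_comp : forall h : gop (gop galg_sort),
    gact (gmap gact h) = gact (gflatten h) }.
Arguments gact {R g} _ : rename.

Section GAlgebra.
Variables (R : realType) (A : galgebra R).

Definition gone : A := gact point_op.
Definition gmul (a b : A) : A := gact (path2_op a b).
Definition gdelta (a : A) : A := gact (loop_op a).

Definition is_diagonal (a : A) : Prop := a = gdelta a.

Definition is_subspace (B : set A) : Prop :=
  B 0 /\ forall (c : Cplx R) x y, B x -> B y -> B (c *: x + y).

Definition is_gsubalgebra (B : set A) : Prop :=
  is_subspace B /\ forall g : gop A, (forall e : edg g, B (lab e)) -> B (gact g).

Definition is_nusubalgebra (B : set A) : Prop :=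
  is_subspace B /\ forall x y, B x -> B y -> B (gmul x y).

Definition is_subalgebra (B : set A) : Prop := is_nusubalgebra B /\ B gone.

End GAlgebra.

(* A linear form on the vector space spanned by the graphs labeled in A is a
   function on these graphs, up to isomorphism.  In [tau_subst] an operation
   is substituted for every edge at once; a single edge is replaced when the
   other edges carry operations of the form [edge_op a]. *)
Record traffic_space (R : realType) := TrafficSpace {
  ts_alg :> galgebra R;
  tau : tgraph ts_alg -> Cplx R;
  tau_iso : forall T T', tiso T T' -> tau T = tau T';
  tau_point : tau point_graph = 1;
  tau_subst : forall T : tgraph (gop ts_alg), tau (tmap gact T) = tau (tflatten T);
  tau_linear : forall (T : tgraph ts_alg) (e : edg T) (c : Cplx R) x y,
    tau (trelab (T := T) [eta lab with e |-> c *: x + y]) =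
    c * tau (trelab (T := T) [eta lab with e |-> x])
    + tau (trelab (T := T) [eta lab with e |-> y]) }.
Arguments tau {R t} _.

Section TrafficSpace.
Variables (R : realType) (A : traffic_space R).

Definition traffic_trace (a : A) : Cplx R := tau (loop_graph a).
Definition traffic_antitrace (a : A) : Cplx R := tau (edge_graph a).

(* T is not syntactically among its own quotients, whose vertices are blocks:
   without invariance under isomorphism, tau0 would not be determined. *)
Definition injective_version (tau0 : tgraph A -> Cplx R) : Prop :=
  (forall T T', tiso T T' -> tau0 T = tau0 T') /\
  forall T : tgraph A, tau T = \sum_(P : vpart (vtx T)) tau0 (tquot P).

End TrafficSpace.

Section Components.
Variables (X : Type) (I : eqType) (col : X -> I) (T : tgraph X).
Implicit Types S : {set edg T}.

(* A connected subgraph with at least one edge is determined by its edges. *)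
Definition sub_vtx S : {set vtx T} :=
  [set v | [exists e in S, (v == src e) || (v == tgt e)]]%SET.

Lemma src_sub_vtx S (d : {e : edg T | e \in S}) : src (val d) \in sub_vtx S.
Proof. by rewrite inE; apply/existsP; exists (val d); rewrite (valP d) eqxx. Qed.

Lemma tgt_sub_vtx S (d : {e : edg T | e \in S}) : tgt (val d) \in sub_vtx S.
Proof. by rewrite inE; apply/existsP; exists (val d); rewrite (valP d) eqxx orbT. Qed.

Definition msub S : mgraph X :=
  @MGraph X {v : vtx T | v \in sub_vtx S} {e : edg T | e \in S}
    (fun d => exist (fun v => v \in sub_vtx S) (src (val d)) (src_sub_vtx d))
    (fun d => exist (fun v => v \in sub_vtx S) (tgt (val d)) (tgt_sub_vtx d))
    (fun d => lab (val d)).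

Definition colored S : bool :=
  [&& S != finset.set0, mconn (msub S) &
      [forall d in S, forall e in S, col (lab d) == col (lab e)]].

Definition components : {set {set edg T}} := [set S | maxset colored S]%SET.

Definition component := {S : {set edg T} | S \in components}.

Lemma component_conn (S : component) :
  (0 < #|vtx (msub (val S))|)%N && mconn (msub (val S)).
Proof.
have := valP S; rewrite inE => /maxsetp/and3P[/finset.set0Pn[e eS] -> _].
rewrite andbT; apply/card_gt0P.
by exists (src (exist (fun e => e \in val S) e eS : edg (msub (val S)))).
Qed.

Definition component_graph (S : component) : tgraph X := TGraph (component_conn S).

Definition shared_vtx : {set vtx T} :=
  [set v | (1 < #|[set S in components | v \in sub_vtx S]|)%N]%SET.

(* The orientation of the edges plays no role in [is_tree]. *)
Definition gcc : mgraph unit :=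
  @MGraph unit (component + {v : vtx T | v \in shared_vtx})%type
    {p : component * {v : vtx T | v \in shared_vtx} | val p.2 \in sub_vtx (val p.1)}
    (fun p => inl (val p).1) (fun p => inr (val p).2) (fun _ => tt).

End Components.

Section Independence.
Variables (R : realType) (A : traffic_space R) (I : finType).

(* Labels in {i : I & J i} are the variables of pairwise disjoint families. *)
Definition eval_families (J : I -> Type) (a : forall i, J i -> A)
  (x : {i : I & J i}) : A := a (tag x) (tagged x).

Definition indep_subalgs (B : I -> set A) : Prop :=
  exists2 tau0 : tgraph A -> Cplx R, injective_version tau0 &
  forall (J : I -> Type) (a : forall i, J i -> A), (forall i j, B i (a i j)) ->
  forall T : tgraph {i : I & J i},
    tau0 (tmap (eval_families a) T) =
    if `[< is_tree (gcc (@tag I J) T) >] then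
      \prod_(S : component (@tag I J) T)
        tau0 (tmap (eval_families a) (component_graph S))
    else 0.

Definition indep_sets (B : I -> set A) : Prop :=
  indep_subalgs (fun i => smallest (@is_gsubalgebra R A) (B i)).

Definition indep_families (J : I -> Type) (a : forall i, J i -> A) : Prop :=
  indep_sets (fun i => range (a i)).

End Independence.

Section Haar.
Variables (R : realType) (N : nat).

Definition mxBorel := g_sigma_algebraType (@open 'M[Cplx R]_N).

Definition is_haar (mu : probability mxBorel R) : Prop :=
  mu [set U : mxBorel | (U : 'M[Cplx R]_N) \is unitarymx] = 1%E /\
  forall (V : 'M[Cplx R]_N), V \is unitarymx ->
  forall B : set mxBorel, measurable B ->
    mu ((fun U : mxBorel => V *m U : mxBorel) @^-1` B) = mu B.

Definition Cexpect (mu : probability mxBorel R) (f : 'M[Cplx R]_N -> Cplx R) :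
  Cplx R :=
  Complex (\int[mu]_(U in setT) complex.Re (f U))
          (\int[mu]_(U in setT) complex.Im (f U)).

(* The label [true] is the adjoint. *)
Definition mx_trace (T : tgraph bool) (U : 'M[Cplx R]_N) : Cplx R :=
  N%:R^-1 * \sum_(phi : {ffun vtx T -> 'I_N})
    \prod_(e : edg T)
      (if lab e then (U ^t*)%sesqui else U) (phi (tgt e)) (phi (src e)).

End Haar.

Definition haar_limit (R : realType) (A : traffic_space R) (u us : A) : Prop :=
  exists2 mu : forall N, probability (mxBorel R N.+1) R, forall N, is_haar (mu N) &
  forall T : tgraph bool,
    (fun N => Cexpect (mu N) (mx_trace T)) @ \oo -->
      tau (tmap (fun b => if b then us else u) T).

Definition enlargement (R : realType) (A A' : traffic_space R) (f : A -> A') : Prop :=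
  [/\ injective f, forall (c : Cplx R) x y, f (c *: x + y) = c *: f x + f y,
      forall g : gop A, f (gact g) = gact (gmap f g) &
      forall T : tgraph A, tau (tmap f T) = tau T].

(* The unitary u lives in a traffic space that may be larger than A.  The
   distribution of u a us is determined by those of a and (u, us), so that
   quantifying existentially over u loses nothing. *)
Definition unitarily_invariant (R : realType) (A : traffic_space R) (J : Type)
  (a : J -> A) : Prop :=
  exists (A' : traffic_space R) (f : A -> A') (u us : A'),
    [/\ enlargement f,
        gmul u us = gone A' /\ gmul us u = gone A',
        haar_limit u us,
        indep_sets (fun b : bool => if b then [set u; us] else range (f \o a)) &
        forall T : tgraph J, tau (tmap (f \o a) T) =
          tau (tmap (fun j => gmul (gmul u (f (a j))) us) T)].

Definition boolean_type (R : realType) (A : traffic_space R) (J : Type)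
  (a : J -> A) : Prop :=
  forall T : tgraph J, ~ is_tree T -> tau (tmap a T) = 0.

Section ClassicalIndependence.
Variables (R : realType) (A : galgebra R) (phi : A -> Cplx R).
Variables (L : nat) (J : 'I_L -> Type) (a : forall l, J l -> A).

Definition gprod n (b : 'I_n -> A) : A := \big[@gmul R A/gone A]_(j < n) b j.

Definition gen_subalgebra l : set A := smallest (@is_subalgebra R A) (range (@a l)).
Definition gen_nusubalgebra l : set A :=
  smallest (@is_nusubalgebra R A) (range (@a l)).

Definition alternating_idx n (l : 'I_n -> 'I_L) : Prop :=
  forall j k : 'I_n, k = j.+1 :> nat -> l j != l k.

Definition free_indep : Prop :=
  forall n (l : 'I_n -> 'I_L) (b : 'I_n -> A), (0 < n)%N -> alternating_idx l ->
    (forall j, gen_subalgebra (l j) (b j)) -> (forall j, phi (b j) = 0) ->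
    phi (gprod b) = 0.

Definition tensor_indep : Prop :=
  (forall l l' x y, l != l' -> gen_subalgebra l x -> gen_subalgebra l' y ->
    gmul x y = gmul y x) /\
  forall b : 'I_L -> A, (forall l, gen_subalgebra l (b l)) ->
    phi (gprod b) = \prod_(l < L) phi (b l).

Definition boolean_indep : Prop :=
  forall n (l : 'I_n -> 'I_L) (b : 'I_n -> A), (0 < n)%N -> alternating_idx l ->
    (forall j, gen_nusubalgebra (l j) (b j)) ->
    phi (gprod b) = \prod_(j < n) phi (b j).

End ClassicalIndependence.

(* Main.v *)
Require Import Defs.
From HB Require Import structures.
From mathcomp Require Import all_boot all_order all_algebra.
From mathcomp Require Import complex.
From mathcomp Require Import all_classical all_reals all_analysis.
From mathcomp Require Import measurable_realfun.
From mathcomp Require Import zify ring lra.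

Set Implicit Arguments.
Unset Strict Implicit.
Unset Printing Implicit Defensive.

Import Order.TTheory GRing.Theory Num.Theory numFieldNormedType.Exports.

(** The value of tau0 is computed by counting.  A connected graph is a tree when it
    has one vertex more than it has edges; hence the graph of colored components of
    a test graph T with edges is a tree if and only if the numbers |V(S)| - 1 of all
    components S sum to |V(T)| - 1 ([gcc_tree_count]).  In each of the first two
    parts, tau of a cycle or a path is expanded as the sum of tau0 over its
    quotients, and this criterion, together with restrictions on the components S
    for which tau0 does not vanish, leaves no quotient, or only one.

    Free independence.  The trace of b_1 ... b_n is tau of a cycle.  For a unitarily
    invariant family, a graph S labeled by elements of trace zero of the algebra it
    generates satisfies tau0 S = 0 unless every vertex has as many incoming as
    outgoing edges and |E| + 2 <= 2 |V| ([invariant_support]).  Suppose that a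
    quotient T of the cycle contributes, and let m edges have the exceptional color
    l0 and k edges another color.  All colors but l0 are balanced at the vertices of
    T, hence l0 is balanced too, and a component of color l0 has at least two edges,
    since a single one would be a loop and contribute its trace, which is zero.  The
    tree criterion then gives k + 2 <= m + 2 |W|, where W is the set of the vertices
    not incident to the color l0 ([gcc_tree_many_vtx]).  But by alternation and
    balance the vertices in W are blocks of at least two indices, but for that of the
    first index, and these indices avoid the edges of color l0 and their successors,
    so that 2 |W| + 2 m <= k + m + 1 ([cycle_count]), a contradiction.

    Support of unitarily invariant families.  Replacing each edge labeled x by a path
    labeled u, x, u^* does not change tau, and tau0 S becomes the sum of tau0 over
    the quotients of the subdivided graph in which the vertices of S stay distinct
    ([tau0_conj]).  As u is independent from the family, the components of a
    contributing quotient are arranged in a tree.  Those labeled by u and u^* are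
    balanced and satisfy |E| + 2 <= 2 |V| ([haar_tau0_support]), and the same count
    as above, with the family in the role of the exceptional color, gives the claim.

    Haar matrices.  Expanding the expected trace over maps sorted by their kernels,
    tau0 is a limit of sums over injective maps.  Multiplying a row by a complex
    number of modulus 1 shows that the monomials which are not balanced in each row
    have zero expectation ([cexpect_mono_row]); passing to the inverse matrix gives
    the same for columns ([cexpect_mono_adj]).  Unitary matrices acting on two
    coordinates show that the moment of order k of the squared modulus of an entry is
    O(N^-k) ([moment_le]), so that the sum over injective maps is O(1 / N) if
    |V| <= |E| / 2.

    Boolean independence.  The anti-trace of a product is tau of a path.  In the
    algebra generated by a family of Boolean type, tau0 vanishes on the graphs with
    |V| <= |E|, that is on the connected graphs that are not trees.  By the criterion,
    a quotient of a path with n edges that contributes has n + 1 vertices: it is the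
    path itself, of which the components are the edges.

    Diagonal elements.  An edge with a diagonal label can be contracted, so that tau0
    vanishes on graphs with several vertices and equals tau on graphs with one vertex,
    where the components are the color classes.  Traffic independence then says that
    the trace of a product of elements of the different algebras factorizes.  Trace
    and anti-trace agree on diagonal elements, an edge being contracted to a loop. *)

(** * Trees and the number of their edges *)

Section Trees.
Variables (X : Type) (G : mgraph X).
Implicit Types (x y z : vtx G) (e : edg G).

Definition joins e x y :=
  ((x, y) == (src e, tgt e)) || ((y, x) == (src e, tgt e)).

Lemma joins_sym e x y : joins e x y = joins e y x.
Proof. by rewrite /joins orbC. Qed.

Lemma joins_eq e x y x' y' :
  joins e x y -> joins e x' y' -> (x = x' /\ y = y') \/ (x = y' /\ y = x').
Proof.
by case/orP=> /eqP[-> ->] /orP[]/eqP[-> ->]; [left|right|right|left].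
Qed.

(** The parent of a vertex is its predecessor on a shortest path from the
    root, so that d is the distance to the root. Two vertices cannot share the
    edge to their parents: each one would be the parent of the other, hence
    strictly closer to the root. *)
Lemma spanning_tree x0 : mconn G ->
  exists (d : vtx G -> nat) (par : vtx G -> vtx G * option (edg G)),
    (forall x, x != x0 -> (d (par x).1 < d x)%N /\
      exists2 e, (par x).2 = Some e & joins e x (par x).1) /\
    {in [set~ x0]%SET &, injective (fun x => (par x).2)}.
Proof.
move=> /mconnP cG.
have ex x : exists n, [exists p : n.-tuple (vtx G),
    path (@adj _ G) x0 p && (x == last x0 p)].
  have /connectP[p pp ->] := cG x0 x.
  by exists (size p); apply/existsP; exists (in_tuple p); rewrite pp eqxx.
pose d x := ex_minn (ex x).
have dle x p : path (@adj _ G) x0 p -> x = last x0 p -> (d x <= size p)%N.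
  move=> pp xl; rewrite /d; case: ex_minnP => m _; apply.
  by apply/existsP; exists (in_tuple p); rewrite pp xl eqxx.
have st x : exists q : vtx G * option (edg G), x != x0 -> (d q.1 < d x)%N /\
    exists2 e, q.2 = Some e & joins e x q.1.
  have [->|xx0] := eqVneq x x0; first by exists (x0, None).
  have : exists2 p, path (@adj _ G) x0 p & x = last x0 p /\ d x = size p.
    rewrite /d; case: ex_minnP => m /existsP[p /andP[pp /eqP xl]] _.
    by exists p; rewrite // size_tuple.
  case; case/lastP => [_ [/= xx]|p z]; first by rewrite xx eqxx in xx0.
  rewrite rcons_path last_rcons size_rcons => /andP[pp /existsP[e je]] [-> dx].
  exists (last x0 p, Some e) => _ /=; split; first by rewrite dx ltnS; exact: dle.
  by exists e => //; rewrite joins_sym.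
have [par hpar] := choice st; exists d, par; split=> // x y; rewrite !inE.
move=> /hpar[dx [e pex jx]] /hpar[dy [e' pey jy]] exy.
have ee : e = e' by apply: Some_inj; rewrite -pex -pey exy.
case: (joins_eq jx (_ : joins e y (par y).1)) => [|[]//|[xy yx]].
  by rewrite ee.
by rewrite -xy in dy; rewrite yx in dx; move: (ltn_trans dx dy); rewrite ltnn.
Qed.

Definition dlink (d d' : edg G * bool) := dtgt d == dsrc d'.

(** Consecutive vertices of a simple path are joined by distinct edges, as
    every edge of the rest of the path misses its first vertex. *)
Lemma darts_of_path (Q : pred (edg G)) x p :
  path [rel y z | [exists e, Q e && joins e y z]] x p -> uniq (x :: p) ->
  exists s : seq (edg G * bool),
    [/\ map (@dsrc _ G) s = belast x p, map (@dtgt _ G) s = p,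
        sorted dlink s, uniq (map fst s) &
        all (fun d => [&& Q d.1, src d.1 \in x :: p & tgt d.1 \in x :: p]) s].
Proof.
elim: p x => [|y p IH] x /=; first by exists [::].
case/andP=> /existsP[e /andP[Qe je]] pp /andP[xyp uyp].
have [s [s1 s2 s3 s4 s5]] := IH y pp uyp.
pose b := (x, y) == (src e, tgt e).
have de : dsrc (e, b) = x /\ dtgt (e, b) = y.
  rewrite /dsrc /dtgt /= /b; move: je; rewrite /joins.
  by case: eqP => [[-> ->]|_ /= /eqP[-> ->]].
have exy : src e \in [:: x, y & p] /\ tgt e \in [:: x, y & p].
  by case/orP: je => /eqP[<- <-]; rewrite !inE !eqxx ?orbT.
exists ((e, b) :: s); split => /=.
- by rewrite s1 de.1.
- by rewrite s2 de.2.
- case: s s1 s2 s3 {s4 s5} => //= d s s1 s2 ->; rewrite andbT /dlink de.2.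
  by case: p s1 {IH pp xyp uyp exy s2} => //= z p [<-].
- rewrite s4 andbT; apply/negP => /mapP[d ds ed].
  move/allP: s5 => /(_ _ ds)/and3P[_]; rewrite -ed => es et.
  have : x \in y :: p.
    by move: es et; case/orP: je => /eqP[<- <-].
  by rewrite (negbTE xyp).
- rewrite Qe exy.1 exy.2 /=; apply: sub_all s5 => d /and3P[-> h1 h2] /=.
  by rewrite in_cons h1 in_cons h2 !orbT.
Qed.

(** If some edge f does not belong to a spanning tree, f closes a cycle with a
    simple path of the tree. *)
Lemma cycle_of_extra_edge (f : edg G) :
  (forall x y, connect [rel y z | [exists e, (e != f) && joins e y z]] x y) ->
  exists s, @mcycle _ G s.
Proof.
move=> cf; have [fl|nfl] := eqVneq (src f) (tgt f).
  by exists [:: (f, true)]; rewrite /mcycle /= /dtgt /dsrc /= fl eqxx.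
have /connectP[p pp lp] := cf (tgt f) (src f).
move: lp; case/shortenP: pp => q pq uq _ lq.
have [s [s1 s2 s3 s4 s5]] := darts_of_path pq uq.
have sf : f \notin map fst s.
  by apply/mapP => -[d ds fd]; move/allP: s5 => /(_ _ ds); rewrite fd eqxx.
exists (rcons s (f, true)); rewrite /mcycle !map_rcons !rcons_uniq s4 sf s1 /=.
have -> : rcons s (f, true) != [::] by case: (s).
rewrite /dsrc /= -/(@dsrc _ G); apply/and3P; split.
- case: s s1 s2 s3 {s4 s5 sf} => [|d s] s1 s2 s3.
    by case: q s2 lq {pq uq s1} => //= _ ee; rewrite ee eqxx in nfl.
  rewrite /= rcons_path rcons_path -/dlink.
  case: q s1 s2 lq {pq uq} => // y q [sd ss] [td ts] lq.
  move: s3 => /= ->; rewrite /= last_rcons; apply/andP; split.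
    by rewrite -last_map td ts lq.
  by rewrite -/(dsrc d) sd.
- by rewrite lq; move: uq; rewrite lastI rcons_uniq => /andP[].
- by move: uq; rewrite lastI rcons_uniq => /andP[].
Qed.

(** Sending a vertex other than the root to the edge to its parent is
    injective; it is also surjective, as an edge missed by the spanning tree
    would close a cycle. *)
Lemma tree_card : is_tree G -> (0 < #|vtx G|)%N -> #|vtx G| = #|edg G|.+1.
Proof.
move=> [cG nc] /card_gt0P[x0 _].
have [d [par [hpar pinj]]] := spanning_tree x0 cG.
pose pe x := (par x).2.
have ple : (#|vtx G|.-1 <= #|edg G|)%N.
  rewrite -(cardsC1 x0) -(card_in_imset pinj).
  have <- : #|[set Some e | e in edg G]%SET| = #|edg G|.
    by rewrite card_imset //; exact: Some_inj.
  apply/subset_leq_card/fintype.subsetP => _ /imsetP[x + ->].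
  by rewrite !inE => /hpar[_ [e -> _]]; apply/imsetP; exists e.
suff : forall f, exists2 x, x != x0 & pe x = Some f.
  move=> psurj; apply/eqP; rewrite eqn_leq -{1}[#|vtx G|]prednK; last first.
    by apply/card_gt0P; exists x0.
  rewrite ltnS ple /= -[X in (_ < X)%N]prednK; last by apply/card_gt0P; exists x0.
  rewrite ltnS -(cardsC1 x0) -(card_in_imset pinj).
  have <- : #|[set Some e | e in edg G]%SET| = #|edg G|.
    by rewrite card_imset //; exact: Some_inj.
  apply/subset_leq_card/fintype.subsetP => _ /imsetP[f _ ->].
  have [x xx0 <-] := psurj f.
  by apply/imsetP; exists x => //; rewrite !inE.
move=> f; apply: contrapT => nf.
have [s] : exists s, @mcycle _ G s; last by apply/negP.
apply: (@cycle_of_extra_edge f).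
set r : rel (vtx G) := [rel y z | _].
have rsym : connect_sym r.
  apply: sym_connect_sym => x y /=; apply: eq_existsb => e.
  by rewrite joins_sym.
have c0 x : connect r x x0.
  have [n] := ubnP (d x); elim: n x => // n IH x.
  have [-> _|xx0 dx] := eqVneq x x0; first exact: connect0.
  have [dp [e ee je]] := hpar x xx0.
  apply: (connect_trans (y := (par x).1)); last by apply: IH; lia.
  apply/connect1/existsP; exists e; rewrite je andbT.
  by apply/eqP => ef; apply: nf; exists x; rewrite // /pe ee ef.
by move=> x y; apply: connect_trans (c0 x) _; rewrite rsym.
Qed.

(** Conversely, if the edges of a spanning tree are all the edges, the two edges
    of a cycle at its vertex furthest from the root both lead to its parent. *)
Lemma card_tree : mconn G -> #|vtx G| = #|edg G|.+1 -> is_tree G.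
Proof.
move=> cG cVE; split=> // s; apply/negP => /and4P[s0 cs ue us].
have [x0 _] : exists x0, x0 \in vtx G by apply/card_gt0P; rewrite cVE.
have [d [par [hpar pinj]]] := spanning_tree x0 cG.
pose pe x := (par x).2.
have psurj f : exists2 x, x != x0 & pe x = Some f.
  have sub : (pe @: [set~ x0] \subset [set Some e | e in edg G])%SET.
    apply/fintype.subsetP => _ /imsetP[x + ->].
    by rewrite !inE /pe => /hpar[_ [e -> _]]; apply/imsetP; exists e.
  have /eqP im : (pe @: [set~ x0] == [set Some e | e in edg G])%SET.
    rewrite eqEcard sub card_in_imset // card_imset; last exact: Some_inj.
    by rewrite cardsC1 cVE /=.
  have : Some f \in (pe @: [set~ x0])%SET.
    by rewrite im; apply/imsetP; exists f.
  by case/imsetP => x; rewrite !inE => xx0 ->; exists x.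
have up f x y : joins f x y -> (d y <= d x)%N -> pe x = Some f /\ (d y < d x)%N.
  move=> jf dyx; have [z zx0 ef] := psurj f.
  have [dz [e ee je]] := hpar z zx0.
  have fe : f = e by apply: Some_inj; rewrite -ef.
  rewrite fe in jf; case: (joins_eq jf je) => [[-> ->]|[xp yz]]; first by [].
  by rewrite xp yz leqNgt dz in dyx.
have [dm dms dmax] : exists2 dm, dm \in s &
    forall d', d' \in s -> (d (dsrc d') <= d (dsrc dm))%N.
  case: s s0 {cs ue us} => // d1 s _.
  elim: s d1 => [|d2 s IH] d1.
    by exists d1; [rewrite inE | move=> d'; rewrite inE => /eqP ->].
  have [dm dms h] := IH d2.
  have [le|lt] := leqP (d (dsrc d1)) (d (dsrc dm)).
    exists dm; first by rewrite in_cons dms orbT.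
    by move=> d'; rewrite in_cons => /orP[/eqP ->//|]; exact: h.
  exists d1; first by rewrite inE eqxx.
  move=> d'; rewrite in_cons => /orP[/eqP ->//|/h]; lia.
have jd (d' : edg G * bool) : joins d'.1 (dsrc d') (dtgt d').
  by rewrite /joins /dsrc /dtgt; case: d'.2; rewrite eqxx ?orbT.
have next_link : dtgt dm = dsrc (next s dm).
  by apply/eqP; exact: (next_cycle cs).
have prev_link : dtgt (prev s dm) = dsrc dm.
  by apply/eqP; exact: (prev_cycle cs).
have [pn ltn] : pe (dsrc dm) = Some dm.1 /\ (d (dtgt dm) < d (dsrc dm))%N.
  by apply: up; rewrite ?jd // next_link dmax // mem_next.
have [pp ltp] : pe (dsrc dm) = Some (prev s dm).1 /\
    (d (dsrc (prev s dm)) < d (dsrc dm))%N.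
  apply: up; last by rewrite dmax // mem_prev.
  by rewrite joins_sym -prev_link; exact: jd.
have ee : dm.1 = (prev s dm).1 by case: (etrans (esym pn) pp).
have /= := ltp; suff -> : prev s dm = dm by rewrite ltnn.
have us' : uniq s by exact: map_uniq ue.
have pms : prev s dm \in s by rewrite mem_prev.
have : nth dm.1 (map fst s) (index (prev s dm) s) =
       nth dm.1 (map fst s) (index dm s).
  by rewrite !(nth_map dm) ?index_mem // !nth_index.
move/eqP; rewrite nth_uniq ?size_map ?index_mem // => /eqP ei.
by rewrite -[LHS](nth_index dm pms) ei nth_index.
Qed.

End Trees.

(** * Colored components *)

Section Comp.
Variables (X : Type) (I : eqType) (col : X -> I) (T : tgraph X).
Implicit Types (e d : edg T) (v : vtx T) (S : {set edg T}).

Definition touch e v := (v == src e) || (v == tgt e).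

Definition meets : rel (edg T) := [rel e d |
  (col (lab e) == col (lab d)) && [exists v, touch e v && touch d v]].

(** The colored component of an edge, as a class of the relation generated by
    sharing both the color and a vertex. *)
Definition cls e : {set edg T} := [set d | connect meets e d]%SET.

Lemma meets_sym : connect_sym meets.
Proof.
apply: sym_connect_sym => e d; rewrite /meets /= eq_sym; congr (_ && _).
by apply: eq_existsb => v; rewrite andbC.
Qed.

Lemma meets_touch e d v :
  col (lab e) = col (lab d) -> touch e v -> touch d v -> connect meets e d.
Proof.
move=> cc ev dv; apply/connect1/andP; rewrite /= cc eqxx; split=> //.
by apply/existsP; exists v; rewrite ev.
Qed.

Lemma touch_src e : touch e (src e). Proof. by rewrite /touch eqxx. Qed.
Lemma touch_tgt e : touch e (tgt e). Proof. by rewrite /touch eqxx orbT. Qed.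
Hint Resolve touch_src touch_tgt : core.

Lemma sub_vtxP S v : reflect (exists2 e, e \in S & touch e v) (v \in sub_vtx S).
Proof.
by rewrite inE; apply: (iffP existsP) => -[e]; [move/andP=> []|]; exists e => //;
  apply/andP.
Qed.

Lemma mem_cls e : e \in cls e. Proof. by rewrite inE connect0. Qed.

Lemma col_connect e d : connect meets e d -> col (lab e) = col (lab d).
Proof.
case/connectP => p + ->; elim: p e => //= e' p IH e /andP[/andP[/eqP -> _]].
exact: IH.
Qed.

Lemma colored_connect S e d : colored col S -> e \in S -> d \in S ->
  connect meets e d.
Proof.
case/and3P => _ /mconnP cS colS eS dS.
have cSe x y : x \in S -> y \in S -> col (lab x) = col (lab y).
  by move=> xS yS; move/forall_inP: colS => /(_ _ xS)/forall_inP/(_ _ yS)/eqP.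
have st (x y : vtx (msub S)) : connect (@adj _ (msub S)) x y ->
    forall e d, e \in S -> d \in S -> touch e (val x) -> touch d (val y) ->
    connect meets e d.
  case/connectP => p + ->; elim: p x => [|z p IH] x /=.
    by move=> _ a b aS bS; apply: meets_touch; exact: cSe.
  case/andP => /existsP[g jg] pp a b aS bS ax bl.
  have gx : touch (val g) (val x) /\ touch (val g) (val z).
    by case/orP: jg => /eqP[-> ->].
  apply: (connect_trans (y := val g)); last first.
    by apply: (IH z pp) bl => //; [exact: valP|exact: gx.2].
  by apply: meets_touch ax gx.1; apply: cSe => //; exact: valP.
pose ee := exist (fun e => e \in S) e eS : edg (msub S).
pose dd := exist (fun e => e \in S) d dS : edg (msub S).
by apply: (st (src ee) (src dd) (cS _ _) e d).
Qed.

Lemma colored_cls e : colored col (cls e).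
Proof.
apply/and3P; split.
- by apply/finset.set0Pn; exists e; exact: mem_cls.
- suff st d : connect meets e d -> forall (x y : vtx (msub (cls e))),
      touch e (val x) -> touch d (val y) -> connect (@adj _ (msub (cls e))) x y.
    apply/mconnP => x y.
    have /sub_vtxP[a ae ax] := valP x; have /sub_vtxP[b be by_] := valP y.
    pose s := src (exist (fun d => d \in cls e) e (mem_cls e) : edg (msub (cls e))).
    apply: (connect_trans (y := s)); last first.
      by apply: (st b) => //; by move: be; rewrite inE.
    by rewrite conn_sym; apply: (st a) => //; by move: ae; rewrite inE.
  have one a (x y : vtx (msub (cls e))) : a \in cls e -> touch a (val x) ->
      touch a (val y) -> connect (@adj _ (msub (cls e))) x y.
    move=> ae; pose a' := exist (fun d => d \in cls e) a ae : edg (msub (cls e)).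
    have xE (z : vtx (msub (cls e))) : touch a (val z) -> z = src a' \/ z = tgt a'.
      by case/orP=> /eqP zE; [left|right]; exact: val_inj.
    have h : connect (@adj _ (msub (cls e))) (src a') (tgt a').
      exact/connect1/adj_edge.
    move=> /xE[] -> /xE[] ->; rewrite ?connect0 //.
    by rewrite conn_sym.
  case/connectP => p + ->; elim/last_ind: p => [|p g IH] /=.
    by move=> _ x y; apply: one; exact: mem_cls.
  rewrite rcons_path last_rcons => /andP[pp mg] x y ex gy.
  have le : connect meets e (last e p) by apply/connectP; exists p.
  have ge : g \in cls e.
    by rewrite inE; apply: connect_trans le (connect1 mg).
  case/andP: mg => _ /existsP[v /andP[lv gv]].
  have vin : v \in sub_vtx (cls e) by apply/sub_vtxP; exists g.
  apply: (connect_trans (y := exist (fun v => v \in sub_vtx (cls e)) v vin)).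
    exact: IH.
  by apply: (one g).
- apply/forall_inP => a; rewrite inE => ea; apply/forall_inP => b; rewrite inE => eb.
  by rewrite -(col_connect ea) (col_connect eb).
Qed.

Lemma componentsE S : (S \in components col T) = [exists e, S == cls e].
Proof.
rewrite inE; apply/idP/existsP => [mS|[e /eqP ->]].
  have cS := maxsetp mS; have /and3P[/finset.set0Pn[e eS] _ _] := cS.
  exists e; rewrite eq_sym; apply/eqP.
  apply: (maxsetsup mS); first exact: colored_cls.
  by apply/fintype.subsetP => d dS; rewrite inE; exact: colored_connect cS eS dS.
apply/maxsetP; split=> [|S' cS sub]; first exact: colored_cls.
apply/eqP; rewrite finset.eqEsubset sub andbT; apply/fintype.subsetP => d dS.
rewrite inE; apply: (colored_connect cS) dS.
exact: (fintype.subsetP sub) _ (mem_cls e).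
Qed.

Lemma in_comp (C : pred {set edg T}) S :
  (S \in [set S in components col T | C S]%SET) =
  (S \in components col T) && C S.
Proof. by rewrite finset.in_set. Qed.

Lemma components_cls e : cls e \in components col T.
Proof. by rewrite componentsE; apply/existsP; exists e. Qed.

Lemma component_cls S e : S \in components col T -> e \in S -> S = cls e.
Proof.
rewrite componentsE => /existsP[d /eqP ->]; rewrite inE => de.
by apply/setP => f; rewrite !inE; exact: (same_connect meets_sym).
Qed.

Lemma component_col S e d : S \in components col T -> e \in S -> d \in S ->
  col (lab e) = col (lab d).
Proof.
by move=> cS eS; rewrite (component_cls cS eS) inE => /col_connect.
Qed.

Lemma component_star S e d v : S \in components col T -> e \in S ->
  col (lab e) = col (lab d) -> touch e v -> touch d v -> d \in S.
Proof.
by move=> cS eS cc ev dv; rewrite (component_cls cS eS) inE (meets_touch cc ev dv).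
Qed.

Lemma sum_components (F : edg T -> nat) :
  \sum_(S in components col T) \sum_(e in S) F e = \sum_e F e.
Proof.
rewrite [RHS](partition_big cls (mem (components col T))) /=; last first.
  by move=> e _; exact: components_cls.
apply: eq_bigr => S cS; apply: eq_bigl => e.
apply/idP/eqP => [eS|<-]; last exact: mem_cls.
by rewrite (component_cls cS eS).
Qed.

Definition mult v := #|[set S in components col T | v \in sub_vtx S]%SET|.

Lemma sum_sub_vtx (C : pred {set edg T}) :
  \sum_(S in components col T | C S) #|sub_vtx S| =
  \sum_v #|[set S in components col T | C S && (v \in sub_vtx S)]%SET|.
Proof.
under eq_bigr => S _ do rewrite -sum1_card.
under [RHS]eq_bigr => v _ do rewrite -sum1_card.
rewrite (exchange_big_dep predT) //=; apply: eq_bigr => v _.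
by apply: eq_bigl => S; rewrite in_comp andbA.
Qed.

Lemma touched v : (0 < #|edg T|)%N -> exists e, touch e v.
Proof.
case/card_gt0P => e0 _; have /andP[_ /mconnP cT] := tg_conn T.
have /connectP[[|w p] /= pp lp] := cT v (src e0); first by exists e0; rewrite -lp.
by case/andP: pp => /existsP[e /orP[]/eqP[-> ->] _]; exists e.
Qed.

Lemma mult_gt0 v : (0 < #|edg T|)%N -> (0 < mult v)%N.
Proof.
case/(touched v) => e ev; apply/card_gt0P; exists (cls e).
rewrite in_comp components_cls; apply/sub_vtxP; exists e => //; exact: mem_cls.
Qed.

Lemma card_gcc_vtx :
  #|vtx (gcc col T)| = (#|components col T| + #|shared_vtx col T|)%N.
Proof. by rewrite card_sum !card_sig; congr addn; apply: eq_card. Qed.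

Lemma card_gcc_edg :
  #|edg (gcc col T)| = \sum_(v in shared_vtx col T) mult v.
Proof.
rewrite card_sig -sum1_card.
pose F (S : component col T) (v : {v : vtx T | v \in shared_vtx col T}) :=
  (val v \in sub_vtx (val S) : nat).
transitivity (\sum_S \sum_v F S v).
  rewrite pair_big /= big_mkcond /=; apply: eq_bigr => -[S v] _ /=.
  by rewrite /F unfold_in /=; case: (_ \in _).
rewrite exchange_big /= [RHS]big_sub; apply: eq_bigr => v _.
rewrite /mult -sum1_card (eq_bigl (fun S => (S \in components col T) &&
  (val v \in sub_vtx S))); last by move=> S; rewrite in_comp.
rewrite [RHS]big_mkcondr [RHS]big_sub.
by apply: eq_bigr => S _; rewrite /F; case: (_ \in _).
Qed.

Lemma gcc_conn : mconn (gcc col T).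
Proof.
have [E0|E0] := posnP #|edg T|.
  have noS (S : component col T) : False.
    have := valP S; rewrite componentsE => /existsP[e _].
    by have := card0_eq E0 e.
  apply/mconnP => -[S|v]; first by case: (noS S).
  have := valP v; rewrite inE => /ltnW/card_gt0P[S]; rewrite in_comp => /andP[cS _].
  by case: (noS (exist _ S cS)).
have /andP[_ /mconnP cT] := tg_conn T.
pose C e : vtx (gcc col T) := inl (exist _ (cls e) (components_cls e)).
have one v e d : touch e v -> touch d v -> connect (@adj _ (gcc col T)) (C e) (C d).
  move=> ev dv; have [ed|ned] := eqVneq (cls e) (cls d).
    suff -> : C e = C d by exact: connect0.
    by congr inl; apply: val_inj.
  have eS : v \in sub_vtx (cls e) by apply/sub_vtxP; exists e => //; exact: mem_cls.
  have dS : v \in sub_vtx (cls d) by apply/sub_vtxP; exists d => //; exact: mem_cls.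
  have vs : v \in shared_vtx col T.
    rewrite inE; apply/card_gt1P; exists (cls e), (cls d).
    by rewrite !in_comp !components_cls.
  pose w : {v : vtx T | v \in shared_vtx col T} := exist _ v vs.
  have cw a : v \in sub_vtx (cls a) ->
      connect (@adj _ (gcc col T)) (C a) (inr w).
    move=> va; apply: connect1.
    pose p := (exist _ (cls a) (components_cls a) : component col T, w).
    exact: (@adj_edge _ (gcc col T) (exist _ p va : edg (gcc col T))).
  by apply: connect_trans (cw _ eS) _; rewrite conn_sym; exact: cw.
have all_e v w e d : touch e v -> touch d w ->
    connect (@adj _ (gcc col T)) (C e) (C d).
  have /connectP[p + ->] := cT v w.
  elim: p v e => [|z p IH] v e /=; first by move=> _; exact: one.
  case/andP => /existsP[g jg] pp ev dl.
  have [gv gz] : touch g v /\ touch g z by case/orP: jg => /eqP[-> ->].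
  by apply: connect_trans (one _ _ _ ev gv) _; exact: (IH z).
have toC x : exists e, connect (@adj _ (gcc col T)) x (C e).
  case: x => [S|v].
    have := valP S; rewrite componentsE => /existsP[e /eqP eS].
    exists e; suff -> : inl S = C e by exact: connect0.
    by congr inl; apply: val_inj.
  have := valP v; rewrite inE => /ltnW/card_gt0P[S]; rewrite in_comp => /andP[cS vS].
  have := cS; rewrite componentsE => /existsP[e /eqP eS]; exists e.
  rewrite conn_sym; apply: connect1.
  have va : val v \in sub_vtx (cls e) by rewrite -eS.
  pose p := (exist _ (cls e) (components_cls e) : component col T, v).
  exact: (@adj_edge _ (gcc col T) (exist _ p va : edg (gcc col T))).
apply/mconnP => x y; have [[e xe] [d yd]] := (toC x, toC y).
apply: connect_trans xe _; rewrite conn_sym; apply: connect_trans yd _.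
exact: all_e (touch_src _) (touch_src _).
Qed.

(** The number of edges of the graph of colored components is the sum of the
    multiplicities of the shared vertices, and the other vertices of T have
    multiplicity 1, which turns the tree criterion into a statement on the
    numbers of vertices of the components. *)
Lemma gcc_tree_count : (0 < #|edg T|)%N ->
  is_tree (gcc col T) <->
  (\sum_(S in components col T) #|sub_vtx S| + 1 = #|components col T| + #|vtx T|)%N.
Proof.
move=> E0.
have -> : (\sum_(S in components col T) #|sub_vtx S| =
    #|edg (gcc col T)| + (#|vtx T| - #|shared_vtx col T|))%N.
  transitivity (\sum_(S in components col T | predT S) #|sub_vtx S|).
    by apply: eq_bigl => S; rewrite andbT.
  rewrite sum_sub_vtx card_gcc_edg (bigID (mem (shared_vtx col T))) /=; congr addn.
  rewrite -(cardsC (shared_vtx col T)) addKn -sum1_card [RHS](eq_bigl (fun v => v \notin shared_vtx col T)); last first.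
    by move=> v; rewrite inE.
  apply: eq_bigr => v; rewrite inE -leqNgt => vs.
  by apply/eqP; rewrite eqn_leq vs; exact: mult_gt0.
have V0 : (0 < #|vtx (gcc col T)|)%N.
  have [e _] := card_gt0P E0; apply/card_gt0P.
  by exists (inl (exist _ (cls e) (components_cls e))).
have sV : (#|shared_vtx col T| <= #|vtx T|)%N by exact: max_card.
split=> [/tree_card/(_ V0)|h]; first by rewrite card_gcc_vtx; lia.
by apply: card_tree gcc_conn _; rewrite card_gcc_vtx; lia.
Qed.

Lemma card_component_vtx (S : component col T) :
  #|vtx (component_graph S)| = #|sub_vtx (val S)|.
Proof. by rewrite card_sig; apply: eq_card. Qed.

Lemma card_component_edg (S : component col T) :
  #|edg (component_graph S)| = #|val S|.
Proof. by rewrite card_sig; apply: eq_card. Qed.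

End Comp.

#[global] Hint Resolve touch_src touch_tgt : core.

(** Let p and q be the numbers of components of color i0 and of another color.
    A vertex not in W belongs to exactly one component of color i0, so that
    the tree criterion reads |V| - |W| + x + 1 = p + q + |V|, where x is the
    sum of the numbers of vertices of the components of other colors. The
    hypotheses bound p from above by half the number of edges of color i0, and
    x - q from below by half the number of other edges. *)
Lemma gcc_tree_many_vtx (X : Type) (I : eqType) (col : X -> I) (T : tgraph X)
  (i0 : I) : (0 < #|edg T|)%N -> is_tree (gcc col T) ->
  (forall S, S \in components col T -> forall e, e \in S ->
     if col (lab e) == i0 then (2 <= #|S|)%N else (#|S| + 2 <= 2 * #|sub_vtx S|)%N) ->
  (#|[set e : edg T | col (lab e) != i0]%SET| + 2 <=
   #|[set e : edg T | col (lab e) == i0]%SET| +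
   2 * #|[set v : vtx T | [forall e : edg T, touch e v ==> (col (lab e) != i0)]]%SET|)%N.
Proof.
move=> E0 /(gcc_tree_count _ E0) count hS.
pose sp := [pred S : {set edg T} | [exists e in S, col (lab e) == i0]].
set W := [set v : vtx T | _]%SET.
have spE S e : S \in components col T -> e \in S -> sp S = (col (lab e) == i0).
  move=> cS eS; apply/existsP/idP => [[d /andP[dS]]|ei].
    by rewrite (component_col cS dS eS).
  by exists e; rewrite eS.
have comp_in S : S \in components col T -> exists e, e \in S.
  by rewrite componentsE => /existsP[e /eqP ->]; exists e; exact: mem_cls.
have sizeS (b : bool) : \sum_(S in components col T | sp S == b) #|S| =
    #|[set e : edg T | (col (lab e) == i0) == b]%SET|.
  rewrite -sum1_card (eq_bigl (fun e => (col (lab e) == i0) == b)); last first.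
    by move=> e; rewrite inE.
  rewrite [RHS]big_mkcond -(sum_components col) /= big_mkcondr /=.
  apply: eq_bigr => S cS; have [e eS] := comp_in S cS.
  rewrite (eq_bigr (fun=> (sp S == b : nat))); last first.
    by move=> d dS; rewrite (spE S d cS dS); case: eqP.
  by rewrite sum_nat_const; case: eqP; rewrite ?muln1 ?muln0.
have spV : (\sum_(S in components col T | sp S) #|sub_vtx S| = #|vtx T| - #|W|)%N.
  rewrite sum_sub_vtx -(cardsC W) addKn -sum1_card.
  rewrite [RHS]big_mkcond /=; apply: eq_bigr => v _.
  rewrite finset.in_setC; case: (boolP (v \in W)) => /=; rewrite inE.
    move/forallP => vW; apply/eqP; rewrite cards_eq0; apply/eqP/setP => S.
    rewrite in_comp finset.in_set0; apply/negP => /and3P[cS /existsP[e /andP[eS ei]]].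
    case/sub_vtxP => d dS dv; have := vW d; rewrite dv /=.
    by rewrite (component_col cS dS eS) ei.
  rewrite negb_forall => /existsP[e]; rewrite negb_imply negbK => /andP[ev ei].
  rewrite -(cards1 (cls col e)); apply: eq_card => S.
  rewrite finset.in_set1; apply/idP/eqP => [|->]; rewrite in_comp.
    case/and3P => cS spS /sub_vtxP[d dS dv]; apply: (component_cls cS).
    apply: (component_star cS dS _ dv ev); rewrite (eqP ei); apply/eqP.
    by rewrite -(spE S d cS dS).
  apply/and3P; split; first exact: components_cls.
    by apply/existsP; exists e; rewrite mem_cls.
  by apply/sub_vtxP; exists e => //; exact: mem_cls.
have cardE (C : pred {set edg T}) : #|[set S in components col T | C S]%SET| =
    \sum_(S in components col T | C S) 1.
  by rewrite -sum1_card; apply: eq_bigl => S; rewrite in_comp.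
have h1 : (2 * #|[set S in components col T | sp S]%SET| <=
    #|[set e : edg T | col (lab e) == i0]%SET|)%N.
  have := sizeS true; rewrite (eq_bigl (fun S => (S \in components col T) && sp S)).
    move=> sz; rewrite [X in (_ <= X)%N](_ : _ =
      #|[set e : edg T | (col (lab e) == i0) == true]%SET|); last first.
      by apply: eq_card => e; rewrite !inE eqb_id.
    rewrite -sz cardE big_distrr /=.
    apply: leq_sum => S /andP[cS spS]; have [e eS] := comp_in S cS.
    by have := hS S cS e eS; rewrite -(spE S e cS eS) (spS : sp S).
  by move=> S; rewrite eqb_id.
have h2 : (#|[set e : edg T | col (lab e) != i0]%SET| +
    2 * #|[set S in components col T | ~~ sp S]%SET| <=
    2 * \sum_(S in components col T | ~~ sp S) #|sub_vtx S|)%N.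
  have := sizeS false; rewrite (eq_bigl (fun S => (S \in components col T) && ~~ sp S)).
    move=> sz; rewrite [X in (X + _ <= _)%N](_ : _ =
      #|[set e : edg T | (col (lab e) == i0) == false]%SET|); last first.
      by apply: eq_card => e; rewrite !inE; case: (_ == i0).
    rewrite -sz cardE !big_distrr /=.
    rewrite -big_split /=.
    apply: leq_sum => S /andP[cS spS]; have [e eS] := comp_in S cS.
    by have := hS S cS e eS; rewrite -(spE S e cS eS) (negbTE (spS : ~~ sp S)); lia.
  by move=> S; case: (sp S).
have cs : #|components col T| = (#|[set S in components col T | sp S]%SET| +
    #|[set S in components col T | ~~ sp S]%SET|)%N.
  rewrite -cardsUI [X in (_ + X)%N](_ : _ = 0%N) ?addn0.
    by apply: eq_card => S; rewrite finset.in_setU !in_comp -andb_orr orbN andbT.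
  by apply/eqP; rewrite cards_eq0; apply/eqP/setP => S; rewrite finset.in_setI !in_comp finset.in_set0; case: (sp S); rewrite ?andbF.
have WV : (#|W| <= #|vtx T|)%N by exact: max_card.
move: count; rewrite (bigID sp) spV cs; move: h1 h2.
set x := \sum_(_ in _ | ~~ _) _ => h1 h2 count.
have {count} count : (#|vtx T| - #|W|) + x + 1 = #|[set S in components col T | sp S]%SET| + #|[set S in components col T | ~~ sp S]%SET| + #|vtx T| := count.
lia.
Qed.

Local Open Scope ring_scope.

(** * Quotients of graphs and sums over partitions *)

Definition is_quotient X (G H : mgraph X) (q : vtx G -> vtx H) (k : edg G -> edg H) :=
  [/\ forall y, exists x, q x = y, bijective k, forall e, src (k e) = q (src e),
      forall e, tgt (k e) = q (tgt e) & forall e, lab (k e) = lab e].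

(** A quotient is determined by the kernel of the identification: this
    replaces all explicit computations with blocks of partitions. *)
Lemma quotient_unique X (G H H' : mgraph X) q k q' k' :
  @is_quotient X G H q k -> @is_quotient X G H' q' k' ->
  (forall x y, q x = q y <-> q' x = q' y) ->
  exists f g, @miso X H H' f g /\ forall x, f (q x) = q' x.
Proof.
move=> [qs kb ks kt kl] [qs' kb' ks' kt' kl'] ker.
have [s sK] := choice qs; have [s' sK'] := choice qs'.
have [j kj jk] := kb.
exists (q' \o s), (k' \o j); split; last first.
  by move=> x /=; apply/ker; rewrite sK.
have fq x : q' (s (q x)) = q' x by apply/ker; rewrite sK.
split.
- exists (q \o s') => x /=; last by rewrite fq sK'.
  by rewrite -[RHS]sK; apply/ker; rewrite sK'.
- by apply: bij_comp kb' _; exists k.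
- by move=> e /=; rewrite ks' -fq -ks jk.
- by move=> e /=; rewrite kt' -fq -kt jk.
- by move=> e /=; rewrite kl' -kl jk.
Qed.

Lemma tiso_card X (T T' : tgraph X) : tiso T T' -> #|vtx T| = #|vtx T'|.
Proof. by move=> [f [k [bf _ _ _ _]]]; exact: bij_eq_card bf. Qed.

Section Image.
Variables (X : Type) (T : tgraph X) (K : finType) (phi : vtx T -> K).

(** Images under maps to a fixed finite set are quotients whose vertices are
    not blocks, which makes them easier to transport along isomorphisms. *)
Definition img_vtx := {y : K | y \in codom phi}.
Definition to_img (x : vtx T) : img_vtx := exist _ (phi x) (codom_f phi x).

Definition mimg : mgraph X :=
  @MGraph X img_vtx (edg T) (to_img \o src) (to_img \o tgt) lab.

Lemma to_img_surj (y : img_vtx) : exists x, to_img x = y.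
Proof.
by have /codomP[x yx] := valP y; exists x; apply: val_inj; rewrite /= yx.
Qed.

Lemma timg_conn : (0 < #|vtx mimg|)%N && mconn mimg.
Proof.
case/andP: (tg_conn T) => /card_gt0P[x0 _] /mconnP cT.
apply: (@mconn_from _ mimg (to_img x0)) => y.
have [x <-] := to_img_surj y.
apply: (@connect_img X X T mimg to_img); last exact: cT.
by move=> e; apply: connect1; exact: (@adj_edge _ mimg e).
Qed.

Definition timg : tgraph X := TGraph timg_conn.

Lemma timg_quotient : @is_quotient X T timg to_img id.
Proof. by split=> //; [exact: to_img_surj|exists id]. Qed.

Lemma to_img_eq x y : to_img x = to_img y <-> phi x = phi y.
Proof. by split=> [[]|h]; [|apply: val_inj]. Qed.

End Image.

Lemma tquot_quotient X (T : tgraph X) (P : vpart (vtx T)) :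
  @is_quotient X T (tquot P) (vblock P) id.
Proof. by split=> //; [exact: vblock_surj|exists id]. Qed.

Lemma timg_iso X (T T' : tgraph X) (K : finType) (phi : vtx T -> K)
  (phi' : vtx T' -> K) (k : edg T -> edg T') :
  bijective k -> codom phi =i codom phi' ->
  (forall e, phi' (src (k e)) = phi (src e)) ->
  (forall e, phi' (tgt (k e)) = phi (tgt e)) ->
  (forall e, lab (k e) = lab e) -> tiso (timg phi) (timg phi').
Proof.
move=> kb cc ks kt kl.
have h1 (y : img_vtx phi) : val y \in codom phi' by rewrite -cc (valP y).
have h2 (y : img_vtx phi') : val y \in codom phi by rewrite cc (valP y).
exists (fun y => exist _ (val y) (h1 y)), k; split=> //.
- by exists (fun y => exist _ (val y) (h2 y)) => y; apply: val_inj.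
- by move=> e; apply: val_inj => /=.
- by move=> e; apply: val_inj => /=.
Qed.

Section KernelPartition.
Variables (V K : finType).

Definition kerp (phi : V -> K) : vpart V :=
  exist _ (preim_partition phi [set: V]%SET) (preim_partitionP phi [set: V]%SET).

Lemma vblock_kerp (phi : V -> K) x y :
  vblock (kerp phi) x = vblock (kerp phi) y <-> phi x = phi y.
Proof.
have eqv : {in [set: V]%SET & &, equivalence_rel (fun x y => phi x == phi y)}.
  by move=> a b c _ _ _; split=> // /eqP ->.
have mem a b : (b \in finset.pblock (val (kerp phi)) a) = (phi a == phi b).
  by rewrite /= /preim_partition (pblock_equivalence_partition eqv) ?inE.
split=> [[] /setP/(_ y)|h]; last by apply: vblock_eq; rewrite mem h.
by rewrite !mem eqxx => /eqP.
Qed.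

End KernelPartition.

Lemma vblockE (V : finType) (P : vpart V) x y :
  (vblock P x == vblock P y) = (y \in finset.pblock (val P) x).
Proof.
apply/eqP/idP => [|/vblock_eq//]; case=> ->.
by have /and3P[/eqP cP _ _] := valP P; rewrite finset.mem_pblock cP inE.
Qed.

Lemma vpart_inj (V : finType) (P Q : vpart V) :
  (forall x y, vblock P x = vblock P y <-> vblock Q x = vblock Q y) -> P = Q.
Proof.
have blocks (P' : vpart V) : val P' = [set finset.pblock (val P') x | x in V]%SET.
  apply/setP => B; apply/idP/imsetP => [BP|[x _ ->]]; last exact: pblock_vpart.
  have [x xB] := vblock_surj (exist (fun B => B \in val P') B BP).
  by exists x => //; rewrite -[LHS]/(val (exist (fun B => B \in val P') B BP)) -xB.
move=> ker; apply: val_inj; rewrite (blocks P) (blocks Q).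
apply: eq_imset => x; apply/setP => y; rewrite -!vblockE.
by apply/eqP/eqP => /ker.
Qed.

Lemma kerp_vblock (V K : finType) (P : vpart V) (iota : part_block P -> K) :
  injective iota -> kerp (iota \o vblock P) = P.
Proof.
move=> ii; apply: vpart_inj => x y; rewrite vblock_kerp /=.
by split=> [/ii|->].
Qed.

(** A map is the same thing as a partition, its kernel, together with an
    injective map on the blocks. *)
Lemma sum_maps (M : nmodType) (V K : finType) (g : {ffun V -> K} -> M) :
  \sum_phi g phi = \sum_(P : vpart V)
    \sum_(iota : {ffun part_block P -> K} | injectiveb iota)
      g [ffun x => iota (vblock P x)].
Proof.
rewrite (partition_big (fun phi : {ffun V -> K} => kerp phi) predT) //=.
apply: eq_bigr => P _.
have [r rK] := choice (@vblock_surj V P).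
rewrite (reindex_onto (fun iota : {ffun part_block P -> K} =>
    [ffun x => iota (vblock P x)]) (fun phi => [ffun B => phi (r B)])).
  apply: eq_bigl => iota; apply/andP/injectiveP => [[/eqP kP _]|ii].
    move=> B B' e; have := vblock_kerp [ffun x => iota (vblock P x)] (r B) (r B').
    by rewrite kP !ffunE !rK => -[_]; exact.
  split; last by apply/eqP/ffunP => B; rewrite !ffunE rK.
  apply/eqP; rewrite -[RHS](kerp_vblock ii); apply: vpart_inj => x y.
  by rewrite !vblock_kerp !ffunE.
move=> phi /eqP kP; apply/ffunP => x; rewrite !ffunE.
by apply/vblock_kerp; rewrite kP rK.
Qed.

Definition iso_invariant X (M : Type) (h : tgraph X -> M) :=
  forall T T', tiso T T' -> h T = h T'.

(** The |K|^_n injective maps on the n blocks of a partition are averaged.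
    Sums over maps to a fixed set K can be reindexed along any bijection of
    the vertices, and split when the vertex set is a disjoint union, which
    sums over partitions cannot. *)
Lemma sum_quotients_maps (F : numFieldType) X (T : tgraph X) (h : tgraph X -> F)
  (K : finType) : iso_invariant h -> (#|vtx T| <= #|K|)%N ->
  \sum_(P : vpart (vtx T)) h (tquot P) =
  \sum_(phi : {ffun vtx T -> K}) (#|K| ^_ #|codom phi|)%:R^-1 * h (timg phi).
Proof.
move=> hi TK; rewrite sum_maps; apply: eq_bigr => P _.
have sub : (#|{: part_block P}| <= #|vtx T|)%N.
  have [r rK] := choice (@vblock_surj _ P).
  by apply: (@leq_card _ _ r) => B B' e; rewrite -(rK B) e rK.
have n0 : (#|K| ^_ #|{: part_block P}|)%:R != 0 :> F.
  by rewrite pnatr_eq0 -lt0n ffact_gt0; exact: leq_trans sub TK.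
rewrite (eq_bigr (fun=> (#|K| ^_ #|{: part_block P}|)%:R^-1 * h (tquot P))).
  rewrite sumr_const -[RHS]mulr_natl mulrA -card_inj_ffuns cardsE.
  by rewrite -card_inj_ffuns cardsE in n0; rewrite mulfV ?mul1r.
move=> iota /injectiveP ii; set phi := [ffun x => _].
have phiE x y : phi x = phi y <-> vblock P x = vblock P y.
  by rewrite !ffunE; split=> [/ii|->].
have -> : h (timg phi) = h (tquot P).
  have [f [g [fg _]]] := quotient_unique (timg_quotient phi) (tquot_quotient P)
    (fun x y => iff_trans (to_img_eq phi x y) (phiE x y)).
  by apply: hi; exists f, g.
suff -> : #|codom phi| = #|{: part_block P}| by [].
rewrite -(card_codom ii); apply: eq_card => y.
apply/codomP/codomP => -[x ->]; first by exists (vblock P x); rewrite ffunE.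
by have [z <-] := vblock_surj x; exists z; rewrite ffunE.
Qed.

Lemma card_part_block (V : finType) (P : vpart V) : (#|{: part_block P}| <= #|V|)%N.
Proof.
have [r rK] := choice (@vblock_surj _ P).
by apply: (@leq_card _ _ r) => B B' e; rewrite -(rK B) e rK.
Qed.

Lemma vblock_inj (V : finType) (P : vpart V) :
  (#|V| <= #|{: part_block P}|)%N -> injective (vblock P).
Proof.
have [r rK] := choice (@vblock_surj _ P) => le.
have [r' r'K rK'] := inj_card_bij (can_inj rK) le.
move=> x y e; rewrite -(rK' x) -(rK' y); congr r.
by rewrite -[LHS]rK -[RHS]rK !rK'.
Qed.

Definition discrete_part (V : finType) : vpart V := kerp (@id V).

Lemma tquot_iso X (T : tgraph X) (P : vpart (vtx T)) :
  injective (vblock P) -> tiso T (tquot P).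
Proof.
move=> vi; exists (vblock P), id; split=> //; last by exists id.
by apply: (inj_card_bij vi); exact: card_part_block.
Qed.

(** The partition into singletons gives back T, and all other ones decrease
    the number of vertices: this is what inductions on the injective version
    rest on. *)
Lemma sum_quotients_split (M : nmodType) X (T : tgraph X) (h : tgraph X -> M) :
  iso_invariant h ->
  \sum_(P : vpart (vtx T)) h (tquot P) =
  h T + \sum_(P : vpart (vtx T) | (#|{: part_block P}| < #|vtx T|)%N) h (tquot P).
Proof.
move=> hi; rewrite (bigD1 (discrete_part (vtx T))) //=; congr (_ + _).
  apply/esym/hi/tquot_iso => x y /vblock_kerp; exact.
apply: eq_bigl => P; apply/idP/idP => [|lt].
  apply: contraNT; rewrite -leqNgt => /vblock_inj vi; apply/eqP/vpart_inj => x y.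
  by rewrite vblock_kerp; split=> [/vi|->].
apply: contraTneq lt => ->; rewrite -leqNgt.
by apply: (@leq_card _ _ (vblock (discrete_part (vtx T)))) => x y /vblock_kerp; exact.
Qed.

(** By induction on the number of vertices, as the relation with tau is
    triangular. Restricting to a class D of graphs allows the use of
    properties of the labels. *)
Lemma injective_version_unique (M : zmodType) X (D : tgraph X -> Prop)
    (h h' : tgraph X -> M) :
  (forall T, D T -> forall P : vpart (vtx T), D (tquot P)) ->
  iso_invariant h -> iso_invariant h' ->
  (forall T, D T -> \sum_(P : vpart (vtx T)) h (tquot P) =
                    \sum_(P : vpart (vtx T)) h' (tquot P)) ->
  forall T, D T -> h T = h' T.
Proof.
move=> Dq hi hi' eqs T; have [n] := ubnP #|vtx T|.
elim: n T => // n IH T lt DT; have := eqs T DT.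
rewrite !sum_quotients_split //.
rewrite (eq_bigr (fun P => h' (@tquot _ T P))); first by move/addIr.
by move=> P ltP; apply: IH; [exact: leq_trans ltP lt|exact: Dq].
Qed.

Section Existence.
Variables (F : numFieldType) (X : Type) (t : tgraph X -> F).
Hypothesis ti : iso_invariant t.

(** The triangular relation is solved for the term of the partition into
    singletons; the fuel n bounds the number of vertices. *)
Fixpoint inj_version_rec n (T : tgraph X) : F :=
  if n is n'.+1 then
    t T - \sum_(P : vpart (vtx T) | (#|{: part_block P}| < #|vtx T|)%N)
             inj_version_rec n' (tquot P)
  else 0.

Definition inj_version (T : tgraph X) := inj_version_rec #|vtx T| T.

Lemma sum_smaller_quotients (T T' : tgraph X) (h : tgraph X -> F) :
  iso_invariant h -> tiso T T' ->
  \sum_(P : vpart (vtx T) | (#|{: part_block P}| < #|vtx T|)%N) h (tquot P) =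
  \sum_(P : vpart (vtx T') | (#|{: part_block P}| < #|vtx T'|)%N) h (tquot P).
Proof.
move=> hi iso; have cTT := tiso_card iso.
pose h' (G : tgraph X) := if (#|vtx G| < #|vtx T|)%N then h G else 0.
have hi' : iso_invariant h'.
  by move=> G G' GG; rewrite /h' (tiso_card GG) (hi _ _ GG).
have E (U : tgraph X) : #|vtx T| = #|vtx U| ->
    \sum_(P : vpart (vtx U) | (#|{: part_block P}| < #|vtx U|)%N) h (tquot P) =
    \sum_(P : vpart (vtx U)) h' (tquot P).
  by move=> cU; rewrite big_mkcond; apply: eq_bigr => P _; rewrite /h' cU.
rewrite (E T) // (E T') //.
rewrite (sum_quotients_maps hi' (leqnn _)).
rewrite (sum_quotients_maps (K := vtx T) hi') -?cTT //.
have [f [k [[g fg gf] kb ks kt kl]]] := iso.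
rewrite (reindex (fun phi : {ffun vtx T' -> vtx T} => [ffun x => phi (f x)])).
  apply: eq_bigr => phi _.
  have cc : codom [ffun x => phi (f x)] =i codom phi.
    move=> y; apply/codomP/codomP => -[x ->]; first by exists (f x); rewrite ffunE.
    by exists (g x); rewrite ffunE gf.
  rewrite (eq_card cc); congr (_ * _); apply: hi'.
  by apply: (timg_iso (k := k)) => // e; rewrite ?ks ?kt ffunE.
exists (fun phi : {ffun vtx T -> vtx T} => [ffun x => phi (g x)]) => phi _; apply/ffunP => x; rewrite !ffunE.
  by rewrite gf.
by rewrite fg.
Qed.

Lemma inj_version_rec_iso n : iso_invariant (inj_version_rec n).
Proof.
elim: n => [|n IH] T T' iso //=.
by rewrite (ti iso) (sum_smaller_quotients IH iso).
Qed.

Lemma inj_version_recE n (T : tgraph X) : (#|vtx T| <= n)%N -> inj_version_rec n T = inj_version T.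
Proof.
have [m] := ubnP n; elim: m n T => // m IH [|n] T /= nm Tn.
  by rewrite /inj_version; move: Tn; rewrite leqn0 => /eqP ->.
have [V0|V0] := posnP #|vtx T|.
  by have /andP[] := tg_conn T; rewrite V0.
case E: #|vtx T| V0 Tn => [//|p] _ pn.
rewrite /inj_version E /= E; congr (_ - _); apply: eq_bigr => P lP.
have {}lP : (#|vtx (tquot P)| < p.+1)%N := lP.
by rewrite (IH n) ?(IH p) //; lia.
Qed.

Lemma inj_version_iso : iso_invariant inj_version.
Proof.
by move=> T T' iso; rewrite /inj_version -(tiso_card iso); exact: inj_version_rec_iso.
Qed.

Lemma inj_versionP (T : tgraph X) : t T = \sum_(P : vpart (vtx T)) inj_version (tquot P).
Proof.
rewrite (sum_quotients_split _ inj_version_iso).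
have V0 : (0 < #|vtx T|)%N by have /andP[] := tg_conn T.
rewrite {1}/inj_version -(prednK V0) /= prednK // -addrA.
rewrite [X in - X + _](eq_bigr (fun P => inj_version (@tquot _ T P))).
  by rewrite addNr addr0.
by move=> P ltP; apply: inj_version_recE; rewrite -ltnS prednK.
Qed.

End Existence.

(** * Flattening *)

Section FlattenQuotient.
Variables (X : Type) (T : tgraph (gop X)).

Lemma vblock_fl_part x y :
  vblock (fl_part T) x = vblock (fl_part T) y <-> fl_rel x y.
Proof.
split=> [/eqP|]; last exact: fl_part_eq.
by rewrite vblockE /= (pblock_equivalence_partition (@fl_rel_equiv X T)) ?inE.
Qed.

Lemma fl_rel_sym : connect_sym [rel x y | @fl_glue X T x y || fl_glue y x].
Proof. by apply: sym_connect_sym => a b /=; rewrite orbC. Qed.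

Lemma fl_relC x y : @fl_rel X T x y = fl_rel y x.
Proof. exact: fl_rel_sym. Qed.

Lemma fl_rel_src e : fl_rel (fl_outer (src e)) (fl_inner (gin (lab e : gop X)) : vtx (fl_union T)).
Proof.
by apply/connect1/orP; left; apply/existsP; exists e; rewrite eqxx.
Qed.

Lemma fl_rel_tgt e : fl_rel (fl_outer (tgt e)) (fl_inner (gout (lab e : gop X)) : vtx (fl_union T)).
Proof.
by apply/connect1/orP; left; apply/existsP; exists e; rewrite eqxx orbT.
Qed.

(** To identify a flattened graph it suffices to map its vertices, before
    gluing, compatibly with the gluing, and to give a section s such that x
    and s (q x) are glued. *)
Lemma flatten_iso (G : mgraph X) (q : vtx (fl_union T) -> vtx G)
    (k : edg (fl_union T) -> edg G) (s : vtx G -> vtx (fl_union T)) :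
  is_quotient q k ->
  (forall e : edg T, q (fl_outer (src e)) = q (fl_inner (gin (lab e)))) ->
  (forall e : edg T, q (fl_outer (tgt e)) = q (fl_inner (gout (lab e)))) ->
  (forall x, fl_rel x (s (q x))) ->
  exists f g, @miso X (tflatten T) G f g /\ forall x, f (vblock (fl_part T) x) = q x.
Proof.
move=> qq qs qt sq; apply: (@quotient_unique _ (fl_union T) (tflatten T) G) qq _.
  by split=> //; [exact: vblock_surj|exists id].
move=> x y; rewrite vblock_fl_part; split=> [|e]; last first.
  by apply: connect_trans (sq x) _; rewrite e fl_rel_sym; exact: sq.
case/connectP => p + ->; elim: p x => //= z p IH x /andP[xz /IH <-] {IH p}.
by case/orP: xz => /existsP[e /orP[]/eqP[-> ->]].
Qed.

End FlattenQuotient.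

(** * Paths and cycles *)

Section Paths.
Variable X : Type.

Definition mpath n (b : 'I_n -> X) : mgraph X :=
  @MGraph X 'I_n.+1 'I_n (fun j => inord j.+1) (fun j => inord j) b.

Lemma path_conn n (b : 'I_n -> X) : (0 < #|vtx (mpath b)|)%N && mconn (mpath b).
Proof.
apply: (@mconn_from _ (mpath b) ord0) => -[i li].
elim: i li => [|i IH] li.
  by rewrite (_ : Ordinal li = ord0) ?connect0 //; exact: val_inj.
have lj : (i < n)%N by [].
apply: (connect_trans (IH (ltnW li))); apply: connect1.
have := @adj_edge _ (mpath b) (Ordinal lj); rewrite /adj /=.
congr is_true; apply: eq_existsb => e; rewrite orbC.
have -> : Ordinal li = inord i.+1 by apply: val_inj; rewrite /= inordK.
have -> // : Ordinal (ltnW li) = inord i.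
by apply: val_inj; rewrite /= inordK // ltnW.
Qed.

Definition path_graph n (b : 'I_n -> X) : tgraph X := TGraph (path_conn b).

(** The edge j goes from the vertex j + 1 to the vertex j, so that the operation
    is the product of the labels in the order of their indices. *)
Definition path_op n (b : 'I_n -> X) : gop X := @GOp X (path_graph b) ord_max ord0.

Definition mcyc n (b : 'I_n.+1 -> X) : mgraph X :=
  @MGraph X 'I_n.+1 'I_n.+1 (fun j => ordS j) id b.

Lemma cyc_conn n (b : 'I_n.+1 -> X) : (0 < #|vtx (mcyc b)|)%N && mconn (mcyc b).
Proof.
apply: (@mconn_from _ (mcyc b) ord0) => -[i li].
elim: i li => [|i IH] li.
  by rewrite (_ : Ordinal li = ord0) ?connect0 //; exact: val_inj.
apply: (connect_trans (IH (ltnW li))); apply: connect1.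
have := @adj_edge _ (mcyc b) (Ordinal (ltnW li)); rewrite /adj /=.
congr is_true; apply: eq_existsb => e; rewrite orbC.
have -> // : Ordinal li = ordS (Ordinal (ltnW li)).
by apply: val_inj; rewrite /= modn_small.
Qed.

Definition cycle_graph n (b : 'I_n.+1 -> X) : tgraph X := TGraph (cyc_conn b).

Definition catf m n (b : 'I_m -> X) (c : 'I_n -> X) (i : 'I_(m + n)) : X :=
  match fintype.split i with inl j => b j | inr j => c j end.

Lemma catf_lt m n (b : 'I_m -> X) (c : 'I_n -> X) (i : 'I_(m + n)) (lt : (i < m)%N) :
  catf b c i = b (Ordinal lt).
Proof.
rewrite /catf; case: fintype.splitP => j ij; first by congr b; apply: val_inj.
by have := lt; rewrite {1}ij ltnNge leq_addr.
Qed.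

Lemma catf_ge m n (b : 'I_m -> X) (c : 'I_n -> X) (i : 'I_(m + n)) (ge : (m <= i)%N)
  (lt : (i - m < n)%N) : catf b c i = c (Ordinal lt).
Proof.
rewrite /catf; case: fintype.splitP => j ij; first by have := ge; rewrite {1}ij leqNgt ltn_ord.
by congr c; apply: val_inj; rewrite /= ij addKn.
Qed.

Lemma flatten_path_cat m n (b : 'I_m -> X) (c : 'I_n -> X) :
  giso (gflatten (path2_op (path_op b) (path_op c))) (path_op (catf b c)).
Proof.
set T := path2_op (path_op b) (path_op c).
pose qn (x : vtx (fl_union T)) : nat := match x with
  | inl (Some true) => 0%N | inl None => m | inl (Some false) => (m + n)%N
  | inr (existT true i) => i | inr (existT false i) => (m + i)%N end.
pose q x : vtx (path_op (catf b c)) := inord (qn x).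
pose k (d : edg (fl_union T)) : edg (path_op (catf b c)) := match d with
  | existT true j => lshift n j | existT false j => rshift m j end.
pose s (v : vtx (path_op (catf b c))) : vtx (fl_union T) :=
  if (v <= m)%N then @fl_inner _ T true (inord v)
  else @fl_inner _ T false (inord (v - m)).
have qn_le x : (qn x <= m + n)%N.
  case: x => [[[]|]|[[] i]] //=; rewrite ?leq_addr //.
    by apply: leq_trans (leq_addr _ _); rewrite -ltnS.
  by rewrite leq_add2l -ltnS.
have qv x : q x = qn x :> nat by rewrite inordK ?ltnS.
have [] := @flatten_iso X T (path_op (catf b c)) q k s.
- split.
  + move=> v; exists (s v); apply: ord_inj; rewrite qv /s.
    have lv : (v <= m + n)%N by rewrite -ltnS.
    by case: leqP => vm /=; rewrite inordK ?ltnS //; lia.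
  + exists (fun j => match fintype.split j with
      | inl i => existT (fun e : edg T => edg (lab e)) true i
      | inr i => existT (fun e : edg T => edg (lab e)) false i end).
      by move=> [[] j] /=; [rewrite (fintype.unsplitK (inl j))|rewrite (fintype.unsplitK (inr j))].
    move=> j /=; rewrite -[RHS]fintype.splitK; by case: fintype.split.
  + move=> [[] j] /=; rewrite /q /=; congr inord; rewrite /= inordK ?ltnS //.
    by rewrite addnS.
  + move=> [[] j] /=; rewrite /q /=; congr inord; rewrite /= inordK ?ltnS //;
    by rewrite ltnW.
  + by move=> [[] j] /=; rewrite /catf ?(fintype.unsplitK (inl j)) ?(fintype.unsplitK (inr j)).
- by move=> []; rewrite /q.
- by move=> []; rewrite /q /= ?addn0.
- have inner_false (i : 'I_n.+1) : fl_rel (@fl_inner _ T false i) (s (q (@fl_inner _ T false i))).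
    rewrite /s qv /=; have [i0|i0] := posnP i.
      rewrite i0 addn0 leqnn.
      have -> : i = gout (path_op c) by exact: val_inj.
      apply: (connect_trans (y := @fl_outer _ T None)).
        by rewrite fl_rel_sym; exact: (@fl_rel_tgt _ T false).
      have -> : inord m = gin (path_op b) by apply: val_inj; rewrite /= inordK.
      exact: (@fl_rel_src _ T true).
    have -> : (m + i <= m)%N = false by lia.
    by rewrite addKn inord_val; exact: connect0.
  have inner_true (i : 'I_m.+1) : fl_rel (@fl_inner _ T true i) (s (q (@fl_inner _ T true i))).
    by rewrite /s qv /= -ltnS ltn_ord inord_val; exact: connect0.
  move=> [[[]|]|[[] i]] //.
  + apply: (connect_trans (y := @fl_inner _ T true ord0)).
      exact: (@fl_rel_tgt _ T true).
    exact: inner_true.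
  + apply: (connect_trans (y := @fl_inner _ T false ord_max)).
      exact: (@fl_rel_src _ T false).
    exact: inner_false.
  + apply: (connect_trans (y := @fl_inner _ T true ord_max)).
      exact: (@fl_rel_src _ T true).
    exact: inner_true.
  + exact: inner_true.
  + exact: inner_false.
move=> f [g [fg fq]]; exists f, g; split=> //=; rewrite fq; apply: ord_inj; rewrite qv //=.
Qed.

Lemma path1_iso (x : X) : giso (path_op (fun _ : 'I_1 => x)) (edge_op x).
Proof.
pose f (v : 'I_2) : bool := v == ord0.
exists f, (fun=> tt); split=> //; split=> //.
- exists (fun v : bool => if v then ord0 else ord_max) => [[[|[|//]] li]|[]] //;
    exact: val_inj.
- by exists (fun=> ord0 : 'I_1) => [i|[]] //; exact/esym/ord1.
- move=> e; rewrite (ord1 e) /f; apply/esym/negP => /eqP/(congr1 val).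
  by rewrite /= inordK.
- by move=> e; rewrite (ord1 e) /f; apply/esym/eqP/val_inj; rewrite /= inordK.
Qed.

Lemma path0_iso (b : 'I_0 -> X) : giso (path_op b) point_op.
Proof.
exists (fun=> tt), (fun i : 'I_0 => match notF (ltn_ord i) with end).
split=> //; split=> //; try by case.
- by exists (fun=> ord0 : 'I_1) => [v|[]] //; exact/esym/ord1.
- by exists (fun i : void => match i with end) => -[].
Qed.

Lemma flatten_loop_path n (b : 'I_n.+1 -> X) :
  tiso (tflatten (loop_graph (path_op b))) (cycle_graph b).
Proof.
set T := loop_graph (path_op b).
pose q (x : vtx (fl_union T)) : 'I_n.+1 := match x with
  | inl _ => ord0 | inr (existT _ i) => inord (i %% n.+1) end.
pose k (d : edg (fl_union T)) : edg (cycle_graph b) := tagged d.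
pose s (v : vtx (cycle_graph b)) : vtx (fl_union T) :=
  @fl_inner _ T tt (inord v).
have [] := @flatten_iso X T (cycle_graph b) q k s.
- split.
  + move=> v; exists (s v); apply: val_inj; rewrite /= inordK ?ltn_pmod //.
    by rewrite inordK ?modn_small // ltnW // ltnS.
  + by exists (fun j => existT (fun e : edg T => edg (lab e)) tt j) => [[[] j]|j].
  + move=> [[] j]; apply: val_inj; rewrite /= inordK ?ltn_pmod //.
    by rewrite inordK //; exact: (ltn_ord (j : 'I_n.+1)).
  + move=> [[] j]; apply: val_inj; rewrite /= inordK ?ltn_pmod // inordK.
      by rewrite modn_small.
    by rewrite ltnW // ltnS.
  + by move=> [[] j].
- by move=> []; apply: val_inj; rewrite /= inordK modnn.
- by move=> []; apply: val_inj; rewrite /= inordK mod0n.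
- have inner i : fl_rel (@fl_inner _ T tt i) (s (q (@fl_inner _ T tt i))).
    rewrite /s /= inordK ?ltn_pmod //; have [ilt|ige] := ltnP i n.+1.
      by rewrite modn_small // inord_val; exact: connect0.
    have -> : i = gin (path_op b).
      by apply: val_inj; apply/eqP; rewrite /= eqn_leq ige -ltnS ltn_ord.
    rewrite /= modnn; apply: (connect_trans (y := @fl_outer _ T tt)).
      by rewrite fl_rel_sym; exact: (@fl_rel_src _ T tt).
    have -> : inord 0 = gout (path_op b) by apply: val_inj; rewrite /= inordK.
    exact: (@fl_rel_tgt _ T tt).
  move=> [[]|[[] i]]; last exact: inner.
  apply: (connect_trans (y := @fl_inner _ T tt ord0)).
    exact: (@fl_rel_tgt _ T tt).
  rewrite (_ : q (inl tt) = q (@fl_inner _ T tt ord0)); first exact: inner.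
  by apply: val_inj; rewrite /= inordK mod0n.
by move=> f [g [fg _]]; exists f, g.
Qed.

Lemma flatten_edge (g : gop X) : tiso (tflatten (edge_graph g)) g.
Proof.
set T := edge_graph g.
pose q (x : vtx (fl_union T)) : vtx g := match x with
  | inl false => gin g | inl true => gout g | inr (existT _ i) => i end.
pose k (d : edg (fl_union T)) : edg g := tagged d.
have [] := @flatten_iso X T g q k (@fl_inner _ T tt).
- split.
  + by move=> v; exists (@fl_inner _ T tt v).
  + by exists (fun j => existT (fun e : edg T => edg (lab e)) tt j) => [[[] j]|j].
  + by move=> [[] j].
  + by move=> [[] j].
  + by move=> [[] j].
- by move=> e; exact: erefl.
- by move=> e; exact: erefl.
- move=> [[]|[[] i]]; last exact: connect0.
    exact: (@fl_rel_tgt _ T tt).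
  exact: (@fl_rel_src _ T tt).
by move=> f [h [fg _]]; exists f, h.
Qed.

End Paths.

Section Subdivision.
Variables (X : Type) (T : tgraph X) (Y : Type) (c : edg T -> 'I_3 -> Y).

(** Every edge e of T is replaced by a path of three edges, of which inr (e,
    false) and inr (e, true) are the inner vertices. The edges of the path are
    numbered from the target of e to its source, as the factors of a product. *)
Definition sub3_src (d : edg T * 'I_3) : vtx T + edg T * bool :=
  match val d.2 with 0%N => inr (d.1, false) | 1%N => inr (d.1, true) | _ => inl (src d.1) end.
Definition sub3_tgt (d : edg T * 'I_3) : vtx T + edg T * bool :=
  match val d.2 with 0%N => inl (tgt d.1) | 1%N => inr (d.1, false) | _ => inr (d.1, true) end.

Definition msub3 : mgraph Y :=
  @MGraph Y (vtx T + edg T * bool)%type (edg T * 'I_3)%type sub3_src sub3_tgt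
    (fun d => c d.1 d.2).

Definition sub3_ops : tgraph (gop Y) := @trelab X (gop Y) T (fun e => path_op (c e)).

Lemma flatten_sub3 : exists f g, @miso Y (tflatten sub3_ops) msub3 f g.
Proof.
pose q (x : vtx (fl_union sub3_ops)) : vtx msub3 := match x with
  | inl v => inl v
  | inr (existT e i) => match val i with 0%N => inl (tgt e) | 1%N => inr (e, false)
      | 2%N => inr (e, true) | _ => inl (src e) end end.
pose k (d : edg (fl_union sub3_ops)) : edg msub3 := (tag d, tagged d).
pose s (v : vtx msub3) : vtx (fl_union sub3_ops) := match v with
  | inl v => inl v
  | inr (e, b) => @fl_inner _ sub3_ops e (if b then inord 2 else inord 1) end.
have [] := @flatten_iso Y sub3_ops msub3 q k s.
- split.
  + by move=> [v|[e []]]; [exists (inl v)|exists (s (inr (e, true)))|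
      exists (s (inr (e, false)))]; rewrite /= ?inordK.
  + by exists (fun d => existT (fun e : edg sub3_ops => edg (lab e)) d.1 d.2) => -[].
  + by move=> [e [[|[|[|//]]] li]]; rewrite /= /sub3_src /= ?inordK.
  + by move=> [e [[|[|[|//]]] li]]; rewrite /= /sub3_tgt /= ?inordK.
  + by move=> [].
- by [].
- by [].
- move=> [v|[e [[|[|[|[|]]]] li]]] //; try exact: connect0.
  + rewrite /q /s /= fl_relC.
    rewrite (_ : Ordinal li = gout (path_op (c e))); last exact: val_inj.
    exact: (@fl_rel_tgt _ sub3_ops e).
  + rewrite /q /s /= (_ : inord 1 = Ordinal li); first exact: connect0.
    by apply: val_inj; rewrite /= inordK.
  + rewrite /q /s /= (_ : inord 2 = Ordinal li); first exact: connect0.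
    by apply: val_inj; rewrite /= inordK.
  + rewrite /q /s /= fl_relC.
    rewrite (_ : Ordinal li = gin (path_op (c e))); last exact: val_inj.
    exact: (@fl_rel_src _ sub3_ops e).
by move=> f [g [fg _]]; exists f, g.
Qed.

Lemma sub3_conn : (0 < #|vtx msub3|)%N && mconn msub3.
Proof.
have [f [g [[f' fK f'K] _ hs ht _]]] := flatten_sub3.
have /andP[/card_gt0P[x _] /mconnP cF] := tg_conn (tflatten sub3_ops).
apply: (@mconn_from _ msub3 (f x)) => y; rewrite -(f'K y).
apply: (@connect_img _ _ (tflatten sub3_ops) msub3 f) (cF _ _) => e.
by rewrite -hs -ht; apply: connect1; exact: adj_edge.
Qed.

Definition sub3_graph : tgraph Y := TGraph sub3_conn.

End Subdivision.

Local Open Scope classical_set_scope.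
Local Open Scope ring_scope.

(** * The algebra structure *)

Section Algebra.
Variables (R : realType) (A : galgebra R).
Implicit Types (x y z : A) (B M : set A).

Lemma gmap_path2 (f : gop A -> A) (g h : gop A) :
  giso (gmap f (path2_op g h)) (path2_op (f g) (f h)).
Proof.
by exists id, id; split=> //; split=> //; [exists id|exists id|case].
Qed.

Lemma gmul_gact g h : gmul (gact g) (gact h) = gact (gflatten (path2_op g h)) :> A.
Proof. by rewrite -gact_comp; apply/esym/gact_iso/gmap_path2. Qed.

Lemma gmul_path m n (b : 'I_m -> A) (c : 'I_n -> A) :
  gmul (gact (path_op b)) (gact (path_op c)) = gact (path_op (catf b c)).
Proof. by rewrite gmul_gact; exact/gact_iso/flatten_path_cat. Qed.

Lemma gact_path1 x : gact (path_op (fun _ : 'I_1 => x)) = x.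
Proof. by rewrite -[RHS]gact_id; exact/gact_iso/path1_iso. Qed.

Lemma gact_path0 (b : 'I_0 -> A) : gact (path_op b) = gone A.
Proof. exact/gact_iso/path0_iso. Qed.

Lemma gmulA : associative (@gmul R A).
Proof.
move=> x y z; rewrite -(gact_path1 x) -(gact_path1 y) -(gact_path1 z) !gmul_path.
congr (gact (path_op _)); apply/funext => -[[|[|[|//]]] li].
- rewrite (@catf_lt _ 1 2 _ _ (Ordinal li) isT) (@catf_lt _ 2 1 _ _ (Ordinal li) isT).
  by rewrite (@catf_lt _ 1 1 _ _ (@Ordinal 2 0 isT) isT).
- rewrite (@catf_ge _ 1 2 _ _ (Ordinal li) isT isT) (@catf_lt _ 2 1 _ _ (Ordinal li) isT).
  rewrite (@catf_lt _ 1 1 _ _ (@Ordinal 2 0 isT) isT).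
  by rewrite (@catf_ge _ 1 1 _ _ (@Ordinal 2 1 isT) isT isT).
- rewrite (@catf_ge _ 1 2 _ _ (Ordinal li) isT isT) (@catf_ge _ 2 1 _ _ (Ordinal li) isT isT).
  by rewrite (@catf_ge _ 1 1 _ _ (@Ordinal 2 1 isT) isT isT).
Qed.

Lemma gmulg1 : right_id (gone A) (@gmul R A).
Proof.
move=> x; rewrite -(gact_path1 x) -(gact_path0 (fun i => match notF (ltn_ord i) with end)).
rewrite gmul_path; congr (gact (path_op _)); apply/funext => i.
by rewrite /catf; case: fintype.splitP => // -[].
Qed.

Lemma gmul_linl c x y z : gmul (c *: x + y) z = c *: gmul x z + gmul y z.
Proof.
have E w : gmul w z = gact (@grelab _ _ (path2_op x z) [eta lab with (true : edg (path2_op x z)) |-> w]).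
  apply: gact_iso; exists id, id; split=> //; split=> //; [exists id|exists id|] => //.
  by case.
by rewrite !E gact_linear.
Qed.

Lemma gmul_linr c x y z : gmul z (c *: x + y) = c *: gmul z x + gmul z y.
Proof.
have E w : gmul z w = gact (@grelab _ _ (path2_op z x) [eta lab with (false : edg (path2_op z x)) |-> w]).
  apply: gact_iso; exists id, id; split=> //; split=> //; [exists id|exists id|] => //.
  by case.
by rewrite !E gact_linear.
Qed.

(** Products are operations on paths; composing operations amounts to
    flattening, and flattened paths are paths. *)
Lemma gprod_path n (b : 'I_n -> A) : gprod b = gact (path_op b).
Proof.
elim: n b => [|n IH] b; first by rewrite /gprod big_ord0 gact_path0.
rewrite /gprod big_ord_recl -/(gprod (fun i => b (lift ord0 i))) IH.
rewrite -[b ord0]gact_path1 gmul_path; congr (gact (path_op _)); apply/funext => i.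
rewrite /catf; case: fintype.splitP => j ij; congr b; apply: val_inj => /=.
  by rewrite ij (ord1 j).
by rewrite /bump /= ij.
Qed.

(** ** Generated subspaces and subalgebras *)

Definition lin_span M : set A := smallest (@is_subspace R A) M.

Lemma lin_span_min M B : is_subspace B -> M `<=` B -> lin_span M `<=` B.
Proof. by move=> sB MB x; apply. Qed.

Lemma sub_lin_span M : M `<=` lin_span M.
Proof. by move=> x Mx B [_]; apply. Qed.

Lemma lin_span_subspace M : is_subspace (lin_span M).
Proof.
split=> [B [[]] //|c x y xM yM B hB].
by case: (hB) => -[_ BZ] _; apply: BZ; [exact: xM|exact: yM].
Qed.

Lemma lin_span_mul M x y : (forall x y, M x -> M y -> M (gmul x y)) ->
  lin_span M x -> lin_span M y -> lin_span M (gmul x y).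
Proof.
move=> Mm; have [S0 SZ] := lin_span_subspace M.
have z0 z : gmul 0 z = 0 /\ gmul z 0 = 0.
  have := gmul_linl (- 1) 0 0 z; have := gmul_linr (- 1) 0 0 z.
  by rewrite scaler0 addr0 !scaleN1r !addNr.
have l1 z : M z -> lin_span M `<=` [set x | lin_span M (gmul x z)].
  move=> Mz; apply: lin_span_min; last by move=> w Mw; apply: sub_lin_span; exact: Mm.
  split=> /= [|c a b ha hb]; first by rewrite (z0 z).1.
  by rewrite gmul_linl; exact: SZ.
move=> xM; apply: (@lin_span_min M [set y | lin_span M (gmul x y)]).
  split=> /= [|c a b ha hb]; first by rewrite (z0 x).2.
  by rewrite gmul_linr; exact: SZ.
by move=> z Mz; exact: l1 xM.
Qed.

Lemma nusubalgebra_span M : (forall x y, M x -> M y -> M (gmul x y)) ->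
  is_nusubalgebra (lin_span M).
Proof. by move=> Mm; split; [exact: lin_span_subspace|move=> x y; exact: lin_span_mul]. Qed.

End Algebra.

(** ** Multilinear extension *)

Definition multilinear_form (R : realType) (A : galgebra R) (E : finType)
    (F : (E -> A) -> Cplx R) :=
  forall (l : E -> A) e c x y,
    F [eta l with e |-> c *: x + y] =
    c * F [eta l with e |-> x] + F [eta l with e |-> y].

(** The labels are replaced one at a time, along an enumeration of E. *)
Lemma multilinear_ext (R : realType) (A : galgebra R) (E : finType)
    (F G : (E -> A) -> Cplx R) (M : set A) :
  multilinear_form F -> multilinear_form G ->
  (forall l, (forall e, M (l e)) -> F l = G l) ->
  forall l, (forall e, lin_span M (l e)) -> F l = G l.
Proof.
move=> Fl Gl FG l Hl.
suff gen (s : seq E) l' : (forall e, e \in s -> lin_span M (l' e)) ->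
    (forall e, e \notin s -> M (l' e)) -> F l' = G l'.
  by apply: (gen (enum E)) => e; [move=> _|rewrite mem_enum].
elim: s l' => [|e s IH] l' hs hn; first by apply: FG => e; exact: hn.
have -> : l' = [eta l' with e |-> l' e].
  by apply/funext => d /=; case: eqP => // ->.
have : lin_span M (l' e) by apply: hs; rewrite inE eqxx.
move: (l' e) => x; move: x.
apply: (@lin_span_min _ _ _ [set x | F [eta l' with e |-> x] = G [eta l' with e |-> x]]).
  split=> /= [|c x y hx hy]; last by rewrite Fl Gl hx hy.
  have H0 (H : (E -> A) -> Cplx R) : multilinear_form H -> H [eta l' with e |-> 0] = 0.
    move=> Hl0; have := Hl0 l' e (- 1) 0 0.
    by rewrite scaler0 addr0 mulN1r addNr.
  by rewrite !H0.
move=> x Mx /=; apply: IH => d.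
  move=> ds /=; case: eqP => [_|_]; first exact: sub_lin_span.
  by apply: hs; rewrite inE ds orbT.
move=> ds /=; case: eqP => [//|/eqP de].
by apply: hn; rewrite inE negb_or de.
Qed.

Section TauForms.
Variables (R : realType) (A : traffic_space R).

Lemma tau_multilinear (T : tgraph A) :
  multilinear_form (fun l : edg T -> A => tau (trelab l)).
Proof. by move=> l e c x y; exact: (@tau_linear _ _ (trelab l)). Qed.

Lemma tau_flatten_map (K : Type) (h : K -> A)
    (T : tgraph (gop K)) :
  tau (tmap gact (tmap (gmap h) T)) = tau (tmap h (tflatten T)).
Proof.
rewrite tau_subst; apply: tau_iso; exists id, id; split=> //; try by exists id.
  by move=> e; apply: val_inj.
by move=> e; apply: val_inj.
Qed.

Lemma tau_loop_gact (g : gop A) :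
  tau (loop_graph (gact g)) = tau (tflatten (loop_graph g)).
Proof.
rewrite -tau_subst; apply: tau_iso.
by exists id, id; split=> //; exists id.
Qed.

(** Closing a path into a loop gives a cycle. *)
Lemma trace_gprod n (b : 'I_n.+1 -> A) :
  traffic_trace (gprod b) = tau (cycle_graph b).
Proof.
rewrite /traffic_trace gprod_path tau_loop_gact.
exact/tau_iso/flatten_loop_path.
Qed.

Lemma antitrace_gact (g : gop A) : traffic_antitrace (gact g) = tau g.
Proof.
rewrite /traffic_antitrace -(tau_iso (flatten_edge g)) -tau_subst; apply: tau_iso.
by exists id, id; split=> //; exists id.
Qed.

End TauForms.

(** * Traffic independence of colored labels *)

Section IndepForm.
Variables (R : realType) (A : traffic_space R) (I : finType) (B : I -> set A).
Variable tau0 : tgraph A -> Cplx R.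
Hypothesis tau0P : injective_version tau0.
Hypothesis B0 : forall i, B i 0.

Definition factorizes := forall (J : I -> Type) (a : forall i, J i -> A),
  (forall i j, B i (a i j)) -> forall T : tgraph {i : I & J i},
    tau0 (tmap (eval_families a) T) =
    if `[< is_tree (gcc (@tag I J) T) >] then
      \prod_(S : component (@tag I J) T)
        tau0 (tmap (eval_families a) (component_graph S))
    else 0.

(** Independence is a statement on variables whose type depends on the color.
    Here the labels have a fixed type X, and only the labels that occur in T
    have to be in the subalgebra of their color: the other ones are evaluated
    at 0. *)
Lemma indep_form (X : Type) (ev : X -> A) (T : tgraph {i : I & X}) :
  factorizes -> (forall e : edg T, B (tag (lab e)) (ev (tagged (lab e)))) ->
  tau0 (tmap (fun x => ev (tagged x)) T) =
    if `[< is_tree (gcc (@tag I (fun=> X)) T) >] then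
      \prod_(S : component (@tag I (fun=> X)) T)
        tau0 (tmap (fun x => ev (tagged x)) (component_graph S))
    else 0.
Proof.
move=> fact hB.
pose a (i : I) (x : X) : A := if `[< B i (ev x) >] then ev x else 0.
have ha i x : B i (a i x) by rewrite /a; case: asboolP.
have aE (e : edg T) : eval_families a (lab e) = ev (tagged (lab e)).
  by rewrite /eval_families /a; case: asboolP => // /(_ (hB e)).
have tE (U : tgraph {i : I & X}) (g : edg U -> edg T) :
    (forall d, lab d = lab (g d)) ->
    tmap (eval_families a) U = tmap (fun x => ev (tagged x)) U.
  by move=> gl; congr (trelab _); apply/funext => d; rewrite gl; exact: aE.
rewrite -(tE T id) // fact //; case: asboolP => // _; apply: eq_bigr => S _.
by rewrite (tE (component_graph S) (fun d : edg (msub (val S)) => val d)).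
Qed.

End IndepForm.

(** * Graphs with one vertex and diagonal elements *)

Definition one_vertex X (G : mgraph X) := forall x y : vtx G, x = y.

Lemma one_vertex_card X (T : tgraph X) : one_vertex T -> #|vtx T| = 1%N.
Proof.
move=> oT; have /andP[/card_gt0P[x _] _] := tg_conn T.
by rewrite -(card1 x); apply: eq_card => y; rewrite !inE (oT x y) eqxx.
Qed.

Lemma card_one_vertex X (T : tgraph X) : (#|vtx T| <= 1)%N -> one_vertex T.
Proof. by move=> /card_le1_eqP h x y; apply: h. Qed.

Lemma one_vertex_miso X (T T' : tgraph X) (k : edg T -> edg T') (x' : vtx T') :
  one_vertex T -> one_vertex T' -> bijective k -> (forall e, lab (k e) = lab e) ->
  @miso X T T' (fun=> x') k.
Proof.
move=> oT oT' kb kl; have /andP[/card_gt0P[x _] _] := tg_conn T.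
by split=> //; exists (fun=> x).
Qed.

Lemma one_vertex_tiso X (T T' : tgraph X) (k : edg T -> edg T') :
  one_vertex T -> one_vertex T' -> bijective k -> (forall e, lab (k e) = lab e) ->
  tiso T T'.
Proof.
move=> oT oT' kb kl; have /andP[/card_gt0P[x' _] _] := tg_conn T'.
by exists (fun=> x'), k; exact: one_vertex_miso.
Qed.

Lemma one_vertex_giso X (g g' : gop X) (k : edg g -> edg g') :
  one_vertex g -> one_vertex g' -> bijective k -> (forall e, lab (k e) = lab e) ->
  giso g g'.
Proof.
move=> og og' kb kl; exists (fun=> gin g'), k; split=> //.
exact: one_vertex_miso.
Qed.

Section Bouquet.
Variables (X : Type) (E : finType) (x : E -> X).

Definition mbouquet : mgraph X := @MGraph X unit E (fun=> tt) (fun=> tt) x.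

Lemma bouquet_conn : (0 < #|vtx mbouquet|)%N && mconn mbouquet.
Proof. by apply: (@mconn_from _ mbouquet tt) => -[]; exact: connect0. Qed.

Definition bouquet : tgraph X := TGraph bouquet_conn.
Definition bouquet_op : gop X := @GOp X bouquet tt tt.

Lemma bouquet_one_vertex : one_vertex bouquet. Proof. by move=> [] []. Qed.

End Bouquet.

Lemma loop_one_vertex X (x : X) : one_vertex (loop_op x). Proof. by move=> [] []. Qed.

Hint Resolve bouquet_one_vertex loop_one_vertex : core.

(** Gluing an operation with one vertex to an edge identifies the ends of the
    edge. *)
Lemma flatten_one_vertex X (T : tgraph (gop X)) :
  (forall e : edg T, one_vertex (lab e)) -> one_vertex (tflatten T).
Proof.
move=> o1.
have gl (e : edg T) (x : vtx (lab e)) : fl_rel (@fl_inner X T e x) (fl_outer (src e)).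
  by rewrite (o1 e x (gin (lab e))) fl_relC fl_rel_src.
have gl' (e : edg T) (x : vtx (lab e)) : fl_rel (@fl_inner X T e x) (fl_outer (tgt e)).
  by rewrite (o1 e x (gout (lab e))) fl_relC fl_rel_tgt.
have out (x y : vtx T) : fl_rel (@fl_outer X T x) (fl_outer y).
  have /andP[_ /mconnP cT] := tg_conn T.
  have /connectP[p + ->] := cT x y.
  elim: p x {y} => [|z p IH] x /=; first by move=> _; exact: connect0.
  case/andP => /existsP[e xz] /IH; apply: connect_trans.
  have es : fl_rel (@fl_outer X T (src e)) (fl_outer (tgt e)).
    apply: (connect_trans (y := @fl_inner X T e (gin (lab e)))); last exact: gl'.
    by rewrite fl_rel_sym; exact: gl.
  by case/orP: xz => /eqP[-> ->] //; rewrite fl_rel_sym; exact: es.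
have toout (x : vtx (fl_union T)) : exists y, fl_rel x (@fl_outer X T y).
  case: x => [y|[e y]]; first by exists y; exact: connect0.
  by exists (src e); exact: gl.
move=> x y; have [x' <-] := vblock_surj x; have [y' <-] := vblock_surj y.
apply/vblock_fl_part; have [[u hu] [v hv]] := (toout x', toout y').
apply: connect_trans hu _; rewrite fl_rel_sym; apply: connect_trans hv _.
exact: out.
Qed.

Section OneVertexTau.
Variables (R : realType) (A : traffic_space R).

Lemma tau0_one_vertex (tau0 : tgraph A -> Cplx R) (T : tgraph A) :
  injective_version tau0 -> one_vertex T -> tau0 T = tau T.
Proof.
move=> [t0i t0E] oT; rewrite t0E sum_quotients_split // big_pred0 ?addr0 // => P.
rewrite one_vertex_card // ltnS leqn0; apply/negbTE; rewrite -lt0n.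
by have /andP[] := tg_conn (tquot P).
Qed.

(** In a graph with one vertex the colored components are the sets of all
    edges of a given color. *)
Lemma prod_components_one_vertex (I : finType) X (col : X -> I) (T : tgraph X)
    (F : {set edg T} -> Cplx R) : one_vertex T -> F finset.set0 = 1 ->
  \prod_(S : component col T) F (val S) =
  \prod_i F [set e : edg T | col (lab e) == i]%SET.
Proof.
move=> oT F0; rewrite -(big_sub (mem (components col T)) F) /=.
pose c i := [set e : edg T | col (lab e) == i]%SET.
have clsE e : cls col e = c (col (lab e)).
  apply/setP => d; rewrite !inE; apply/idP/eqP => [/col_connect -> //|cde].
  by apply: (@meets_touch _ _ _ _ _ _ (src e)) => //; rewrite /touch (oT (src e) (src d)) eqxx.
have cN i : c i != finset.set0 -> exists2 e, col (lab e) = i & c i = cls col e.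
  by case/finset.set0Pn => e; rewrite inE => /eqP <-; exists e.
have -> : components col T = [set c i | i in [pred i | c i != finset.set0]]%SET.
  apply/setP => S; rewrite componentsE; apply/existsP/imsetP; last case=> i.
    case=> e /eqP ->.
    exists (col (lab e)) => //; rewrite inE; apply/finset.set0Pn; exists e.
    by rewrite inE eqxx.
  by rewrite inE => /cN[e _ ->] ->; exists e.
rewrite big_imset /=; last first.
  move=> i j /cN[e ei _] _ cij.
  have : e \in c j by rewrite -cij inE ei.
  by rewrite inE ei => /eqP.
rewrite [RHS](bigID (fun i => c i == finset.set0)) /= [X in _ = X * _]big1 ?mul1r //.
by move=> i /eqP ci; rewrite -/(c i) ci.
Qed.

Definition sub_bouquet X (T : tgraph X) (S : {set edg T}) (ev : X -> A) : tgraph A :=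
  bouquet (fun e : {e : edg T | e \in S} => ev (lab (val e))).

Lemma tau_sub_bouquet0 X (T : tgraph X) (ev : X -> A) :
  tau (sub_bouquet (@finset.set0 (edg T)) ev) = 1.
Proof.
rewrite -(tau_point A); apply/esym/tau_iso.
have noe (e : {e : edg T | e \in finset.set0}) : False.
  by have := valP e; rewrite finset.in_set0.
apply: (@one_vertex_tiso _ point_graph (sub_bouquet finset.set0 ev)
  (fun v : void => match v with end)) => //; try by [move=> [] []|case].
by exists (fun e => match noe e with end) => [[]|e]; case: (noe e).
Qed.

(** All components share the only vertex, so that they form a star. *)
Lemma one_vertex_gcc_tree (I : eqType) X (col : X -> I) (T : tgraph X) :
  one_vertex T -> is_tree (gcc col T).
Proof.
move=> oT; have [E0|E0] := posnP #|edg T|.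
  split=> [|s]; first exact: gcc_conn.
  apply/negP; case: s => //= -[[[S v] /= _] b] s _.
  have := valP S; rewrite componentsE => /existsP[e _].
  by have := card0_eq E0 e.
apply/(gcc_tree_count _ E0); rewrite one_vertex_card //; congr addn.
rewrite -sum1_card; apply: eq_bigr => S cS.
have := cS; rewrite componentsE => /existsP[e /eqP eS].
rewrite -(one_vertex_card oT); apply: eq_card => v; rewrite [RHS]inE.
apply/sub_vtxP; exists e; first by rewrite eS mem_cls.
by rewrite /touch (oT v (src e)) eqxx.
Qed.

Lemma tau0_one_vertex_product (I : finType) (tau0 : tgraph A -> Cplx R)
    X (col : X -> I) (T : tgraph X) (ev : X -> A) :
  injective_version tau0 -> one_vertex T ->
  \prod_(S : component col T) tau0 (tmap ev (component_graph S)) =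
  \prod_i tau (sub_bouquet [set e : edg T | col (lab e) == i]%SET ev).
Proof.
move=> t0P oT.
rewrite -(prod_components_one_vertex (F := fun S : {set edg T} =>
  tau (sub_bouquet S ev)) _ oT); last exact: tau_sub_bouquet0.
apply: eq_bigr => S _.
have oS : one_vertex (component_graph S).
  by move=> x y; apply: val_inj; exact: oT.
rewrite tau0_one_vertex //; apply: tau_iso.
apply: (@one_vertex_tiso A (tmap ev (component_graph S)) (sub_bouquet (val S) ev) id) => //.
  exact: bouquet_one_vertex.
by exists id.
Qed.

End OneVertexTau.

Section Diagonal.
Variables (R : realType) (A : traffic_space R).

Definition diag_set : set A := [set x | is_diagonal x].

Lemma diag_bouquet (E : finType) (x : E -> A) : is_diagonal (gact (bouquet_op x)).
Proof.
rewrite /is_diagonal /gdelta.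
transitivity (gact (gflatten (loop_op (bouquet_op x)))); last first.
  rewrite -gact_comp; apply: gact_iso.
  by apply: (@one_vertex_giso _ _ _ id) => //; [move=> [] []|move=> [] []|exists id].
apply: gact_iso; apply/(@one_vertex_giso _ (bouquet_op x)
  (gflatten (loop_op (bouquet_op x)))
  (fun e => existT (fun e : edg (loop_op (bouquet_op x)) => edg (lab e)) tt e)) => //.
- by move=> [] [].
- by apply: flatten_one_vertex => e [] [].
- by exists (fun d : edg (gflatten (loop_op (bouquet_op x))) => tagged d) => // -[[] d].
Qed.

Lemma gact_one_vertex (g : gop A) : one_vertex g ->
  gact g = gact (bouquet_op (@lab _ g)).
Proof.
move=> og; apply: gact_iso; apply: (@one_vertex_giso _ g (bouquet_op (@lab _ g)) id) => //.
  by move=> [] [].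
by exists id.
Qed.

(** Replacing every diagonal label by a loop contracts the graph to a vertex. *)
Lemma tau_diag (T : tgraph A) : (forall e : edg T, is_diagonal (lab e)) ->
  tau T = tau (bouquet (@lab _ T)).
Proof.
move=> dT.
pose T' := @trelab A (gop A) T (fun e => loop_op (lab e)).
transitivity (tau (tmap gact T')).
  apply: tau_iso; exists id, id; split=> //; try by exists id.
  by move=> e; exact/esym/dT.
rewrite tau_subst; apply: tau_iso.
apply: (@one_vertex_tiso _ (tflatten T') (bouquet (@lab _ T))
  (fun d : edg (tflatten T') => tag d)) => //.
- by apply: flatten_one_vertex => e [] [].
- by exists (fun e => existT (fun e : edg T' => edg (lab e)) e tt) => // -[e []].
Qed.

Lemma gact_diag (g : gop A) : (forall e : edg g, is_diagonal (lab e)) ->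
  gact g = gact (bouquet_op (@lab _ g)).
Proof.
move=> dg.
pose h := @grelab A (gop A) g (fun e => loop_op (lab e)).
have -> : gact g = gact (gmap gact h).
  apply: gact_iso; exists id, id; split=> //; split=> //; try by exists id.
  by move=> e; exact/esym/dg.
rewrite gact_comp; apply: gact_iso.
apply: (@one_vertex_giso _ (gflatten h) (bouquet_op (@lab _ g))
  (fun d : edg (gflatten h) => tag d)) => //.
- by apply: flatten_one_vertex => e [] [].
- by move=> [] [].
- by exists (fun e => existT (fun e : edg h => edg (lab e)) e tt) => // -[e []].
Qed.

Lemma diag_gsubalgebra : is_gsubalgebra diag_set.
Proof.
split; last by move=> g dg; rewrite /diag_set /= gact_diag //; exact: diag_bouquet.
have dl c (x y : A) : gdelta (c *: x + y) = c *: gdelta x + gdelta y.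
  have E w : gdelta w = gact (@grelab _ _ (loop_op x) [eta lab with (tt : edg (loop_op x)) |-> w]).
    by apply: gact_iso; exists id, id; split=> //; split=> //; try by [exists id|case].
  by rewrite !E gact_linear.
split=> [|c x y]; rewrite /diag_set /= /is_diagonal; last by rewrite dl => <- <-.
by have := dl (- 1) 0 0; rewrite scaler0 addr0 scaleN1r addNr.
Qed.

Lemma gsubalgebra_subalgebra (B : set A) : is_gsubalgebra B -> is_subalgebra B.
Proof.
move=> [Bs Bg]; split; first split=> // x y xB yB.
  by apply: Bg => -[].
by apply: Bg => -[].
Qed.

Section DiagSubalgebra.
Variable B : set A.
Hypotheses (Bs : is_subalgebra B) (Bd : B `<=` diag_set).

Lemma gprod_mem n (b : 'I_n -> A) : (forall i, B (b i)) -> B (gprod b).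
Proof. by move=> hb; apply: big_ind => //; case: Bs => [[]]. Qed.

Lemma bouquet_enum (E : finType) (x : E -> A) : (forall e, is_diagonal (x e)) ->
  gact (bouquet_op x) = gprod (fun i : 'I_#|E| => x (enum_val i)).
Proof.
move=> dx; rewrite gprod_path [RHS]gact_diag; last by move=> i; exact: dx.
apply: gact_iso.
apply: (@one_vertex_giso _ (bouquet_op x)
  (bouquet_op (fun i : 'I_#|E| => x (enum_val i))) (@enum_rank E)).
- by move=> [] [].
- by move=> [] [].
- by exists enum_val; [exact: enum_rankK|exact: enum_valK].
- by move=> e /=; rewrite enum_rankK.
Qed.

Lemma bouquet_mem (E : finType) (x : E -> A) : (forall e, B (x e)) ->
  B (gact (bouquet_op x)).
Proof.
by move=> hx; rewrite bouquet_enum; [apply: gprod_mem|move=> e; exact: Bd].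
Qed.

(** For diagonal labels, an operation is the product of its labels. *)
Lemma diag_subalgebra_gsubalgebra : is_gsubalgebra B.
Proof.
split=> [|g gB]; first by case: Bs => [[]].
by rewrite gact_diag; [exact: bouquet_mem|move=> e; exact: Bd].
Qed.

End DiagSubalgebra.

Lemma trace_bouquet (E : finType) (x : E -> A) :
  traffic_trace (gact (bouquet_op x)) = tau (bouquet x).
Proof.
rewrite /traffic_trace tau_loop_gact; apply: tau_iso.
apply: (@one_vertex_tiso _ (tflatten (loop_graph (bouquet_op x))) (bouquet x)
  (fun d : edg (tflatten (loop_graph (bouquet_op x))) => tagged d)).
- by apply: flatten_one_vertex => e [] [].
- by move=> [] [].
- exists (fun e => existT (fun e : edg (loop_graph (bouquet_op x)) => edg (lab e)) tt e) => //.
  by move=> [[] d].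
- by move=> [[] d].
Qed.

Lemma antitrace_bouquet (E : finType) (x : E -> A) :
  traffic_antitrace (gact (bouquet_op x)) = tau (bouquet x).
Proof. by rewrite antitrace_gact. Qed.

(** Contracting the edge labeled by x turns it into a loop. *)
Lemma trace_antitrace_diag (x : A) : is_diagonal x ->
  traffic_trace x = traffic_antitrace x.
Proof.
move=> dx; rewrite dx /gdelta.
have -> : gact (loop_op x) = gact (bouquet_op (fun _ : unit => x)).
  by apply: gact_one_vertex.
by rewrite trace_bouquet antitrace_bouquet.
Qed.

Lemma bouquet_by_color (L : nat) (E : finType) (c : E -> 'I_L) (x : E -> A) :
  gact (bouquet_op x) =
  gprod (fun l => gact (bouquet_op (fun e : {e : E | e \in [set e | c e == l]%SET} => x (val e)))).
Proof.
rewrite gprod_path [RHS]gact_diag; last by move=> l; exact: diag_bouquet.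
pose h := bouquet_op (fun l : 'I_L =>
  bouquet_op (fun e : {e : E | e \in [set e | c e == l]%SET} => x (val e))).
transitivity (gact (gmap gact h)); last first.
  apply: gact_iso; exists id, id; split=> //; split=> //; by exists id.
rewrite gact_comp; apply: gact_iso.
have ce e : e \in [set e' | c e' == c e]%SET by rewrite inE.
pose k (e : E) : edg (gflatten h) :=
  existT (fun e : edg h => edg (lab e)) (c e) (exist _ e (ce e)).
apply: (@one_vertex_giso _ (bouquet_op x) (gflatten h) k).
- by move=> [] [].
- by apply: flatten_one_vertex => l [] [].
- exists (fun d : edg (gflatten h) => val (tagged d)) => // -[l [e el]] /=.
  have le : l = c e by apply/esym/eqP; move: el; rewrite inE.
  by subst l; rewrite /k; congr existT; apply: val_inj.
- by [].
Qed.

End Diagonal.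

(** * Diagonal families *)

Section GenGsub.
Variables (R : realType) (A : galgebra R).

Lemma gsubalgebra_smallest (B : set A) :
  is_gsubalgebra (smallest (@is_gsubalgebra R A) B).
Proof.
split; first split=> [C [[[]]] //|c x y hx hy C hC].
  by case: (hC) => -[[_ CZ] _] _; apply: CZ; [exact: hx|exact: hy].
move=> g hg C hC; case: (hC) => -[_ Cg] _; apply: Cg => e; exact: hg.
Qed.

Lemma subalgebra_smallest (B : set A) :
  is_subalgebra (smallest (@is_subalgebra R A) B).
Proof.
split; last by move=> C [[_ C1] _].
split; first split=> [C [[[[]]]] //|c x y hx hy C hC].
  by case: (hC) => -[[[_ CZ] _] _] _; apply: CZ; [exact: hx|exact: hy].
move=> x y hx hy C hC; case: (hC) => -[[_ Cm] _] _; apply: Cm; [exact: hx|exact: hy].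
Qed.

End GenGsub.

Section DiagonalFamilies.
Variables (R : realType) (A : traffic_space R) (L : nat).
Variables (J : 'I_L -> Type) (a : forall l, J l -> A).
Hypothesis ad : forall l j, is_diagonal (@a l j).

Local Notation B := (fun l => smallest (@is_gsubalgebra R A) (range (@a l))).
Local Notation G := (gen_subalgebra a).

Lemma gen_diag l : G l `<=` @diag_set R A.
Proof.
apply: smallest_sub; first exact/gsubalgebra_subalgebra/diag_gsubalgebra.
by move=> _ [j _ <-]; exact: ad.
Qed.

Lemma gen_gsub l : G l `<=` B l.
Proof.
apply: smallest_sub; last exact: sub_gen_smallest.
exact/gsubalgebra_subalgebra/gsubalgebra_smallest.
Qed.

Lemma gsub_gen l : B l `<=` G l.
Proof.
apply: smallest_sub; last exact: sub_gen_smallest.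
by apply: diag_subalgebra_gsubalgebra; [exact: subalgebra_smallest|exact: gen_diag].
Qed.

Lemma gprod_bouquet n (b : 'I_n -> A) : (forall i, is_diagonal (b i)) ->
  gprod b = gact (bouquet_op b).
Proof. by move=> bd; rewrite gprod_path gact_diag. Qed.

Lemma diag_comm (x y : A) : is_diagonal x -> is_diagonal y -> gmul x y = gmul y x.
Proof.
move=> dx dy; rewrite /gmul gact_diag; last by case.
rewrite [RHS]gact_diag; last by case.
apply: gact_iso.
apply: (@one_vertex_giso _ (bouquet_op (@lab _ (path2_op x y)))
  (bouquet_op (@lab _ (path2_op y x))) negb); try by [move=> [] []|case].
by exists negb; exact: negbK.
Qed.

Lemma trace_gprod_diag (tau0 : tgraph A -> Cplx R) (b : 'I_L -> A) :
  injective_version tau0 -> factorizes B tau0 -> (forall l, G l (b l)) ->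
  traffic_trace (gprod b) = \prod_l traffic_trace (b l).
Proof.
move=> t0P fact hb.
have bd l : is_diagonal (b l) by exact: (gen_diag (hb l)).
rewrite gprod_bouquet // trace_bouquet.
pose T : tgraph {l : 'I_L & 'I_L} := bouquet (fun l => existT (fun=> 'I_L) l l).
have oT : one_vertex T by move=> [] [].
transitivity (tau0 (tmap (fun x => b (tagged x)) T)).
  by rewrite tau0_one_vertex //; apply: tau_iso; exists id, id; split=> //; exists id.
rewrite (indep_form _ fact).
- case: asboolP => [_|]; last by case; exact: one_vertex_gcc_tree.
  rewrite (tau0_one_vertex_product _ _ t0P oT).
  apply: eq_bigr => l _; apply: tau_iso.
  pose S := [set e : edg T | tag (lab e) == l]%SET.
  have lS : l \in S by rewrite inE.
  apply: (@one_vertex_tiso _ (sub_bouquet S (fun x => b (tagged x)))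
    (loop_graph (b l)) (fun=> tt)).
  + by move=> [] [].
  + by move=> [] [].
  + exists (fun=> exist _ l lS) => [[e eS]|[]] //; apply: val_inj => /=.
    by move: eS; rewrite inE => /eqP.
  + by move=> [e eS] /=; move: (eS); rewrite inE => /eqP /= ->.
- by move=> l; case: (gsubalgebra_smallest (range (@a l))) => -[].
- by move=> l; exact: (gen_gsub (hb l)).
Qed.

Lemma diag_tensor : indep_families a ->
  tensor_indep (@traffic_trace R A) a /\ tensor_indep (@traffic_antitrace R A) a.
Proof.
move=> [tau0 t0P fact].
have comm l l' x y : l != l' -> G l x -> G l' y -> gmul x y = gmul y x.
  by move=> _ /gen_diag dx /gen_diag dy; exact: diag_comm.
split; (split; first exact: comm) => b hb; first exact: (trace_gprod_diag t0P fact hb).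
rewrite -trace_antitrace_diag; last first.
  by rewrite gprod_bouquet; [exact: diag_bouquet|move=> l; exact: (gen_diag (hb l))].
rewrite (trace_gprod_diag t0P fact hb); apply: eq_bigr => l _.
by apply: trace_antitrace_diag; exact: (gen_diag (hb l)).
Qed.

Lemma nonloop_edge (X : Type) (T : tgraph X) : ~ one_vertex T ->
  exists e : edg T, src e != tgt e.
Proof.
move=> nT; apply: contrapT => ne; apply: nT => x y.
have /andP[_ /mconnP cT] := tg_conn T.
have /connectP[p + ->] := cT x y; elim: p x => //= z p IH x /andP[xz /IH <-].
have [//|xz'] := eqVneq x z; exfalso; apply: ne.
by case/existsP: xz => e /orP[]/eqP[ex ez]; exists e; rewrite -ex -ez // eq_sym.
Qed.

(** Contraction makes tau the value at the quotient with one vertex. The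
    function that is tau on graphs with one vertex and 0 elsewhere has
    therefore the property that defines tau0. *)
Lemma tau0_diag (tau0 : tgraph A -> Cplx R) (T : tgraph A) :
  injective_version tau0 -> (forall e : edg T, is_diagonal (lab e)) ->
  tau0 T = if (#|vtx T| <= 1)%N then tau T else 0.
Proof.
move=> [t0i t0E] dT.
pose h' (T : tgraph A) := if (#|vtx T| <= 1)%N then tau T else 0.
apply: (@injective_version_unique _ _ (fun T : tgraph A => forall e : edg T,
  is_diagonal (lab e)) tau0 h') dT => //.
  by move=> U U' iso; rewrite /h' (tiso_card iso) (tau_iso iso).
move=> U dU; rewrite -t0E.
have /andP[/card_gt0P[x0 _] _] := tg_conn U.
pose P0 := kerp (fun _ : vtx U => tt).
have oP0 : one_vertex (tquot P0).
  move=> x y; have [x' <-] := vblock_surj x; have [y' <-] := vblock_surj y.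
  exact/vblock_kerp.
rewrite (bigD1 P0) //= big1 ?addr0; last first.
  move=> P /negP nP; rewrite /h'; case: leqP => // /card_one_vertex oP; case: nP.
  by apply/eqP/vpart_inj => x y; rewrite vblock_kerp; split=> // _; exact: oP.
rewrite /h' one_vertex_card // (tau_diag dU).
apply: tau_iso; apply: (@one_vertex_tiso _ (bouquet (@lab _ U)) (tquot P0) id) => //; by exists id.
Qed.

(** A graph with several vertices has an edge which is not a loop, and its
    component has several vertices too: both sides of the factorization
    vanish. On a graph with one vertex, the factorization is that of the trace
    of a product. *)
Lemma tensor_diag : tensor_indep (@traffic_trace R A) a -> indep_families a.
Proof.
move=> [_ prodE]; pose tau0 := inj_version (@tau R A).
have t0P : injective_version tau0.
  by split; [exact: inj_version_iso (@tau_iso R A)|exact: inj_versionP (@tau_iso R A)].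
exists tau0 => // J' a' ha' T.
set ev := eval_families a'; set col := @tag _ J'.
have hG (e : edg T) : G (col (lab e)) (ev (lab e)) by apply: gsub_gen; exact: ha'.
have hd (e : edg T) : is_diagonal (ev (lab e)) by exact: (gen_diag (hG e)).
have [oT|nT] := pselect (one_vertex T).
  case: asboolP => [_|]; last by case; exact: one_vertex_gcc_tree.
  rewrite (tau0_one_vertex_product _ _ t0P oT) tau0_one_vertex // tau_diag //.
  rewrite -trace_bouquet (bouquet_by_color (fun e : edg T => col (lab e))) prodE.
    by apply: eq_bigr => l _; exact: trace_bouquet.
  move=> l; apply: bouquet_mem; [exact: subalgebra_smallest|exact: gen_diag|].
  by move=> [e el] /=; move: (el); rewrite inE => /eqP <-; exact: hG.
rewrite tau0_diag // ifF; last by apply/negP => /card_one_vertex.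
case: asboolP => // _; have [e ne] := nonloop_edge nT.
rewrite (bigD1 (exist _ (cls col e) (components_cls col e))) //=.
rewrite tau0_diag; [|exact: t0P|by move=> d; exact: hd].
rewrite ifF ?mul0r //; apply/negP => /card_one_vertex /=.
have ee := mem_cls col e.
pose e' := exist (fun d => d \in cls col e) e ee : edg (msub (cls col e)).
by move=> /(_ (src e') (tgt e')) /(congr1 val) /= /eqP; rewrite (negbTE ne).
Qed.

Lemma tensor_antitrace_trace : tensor_indep (@traffic_antitrace R A) a ->
  tensor_indep (@traffic_trace R A) a.
Proof.
move=> [comm prodE]; split=> // b hb.
rewrite trace_antitrace_diag ?prodE //; last first.
  by rewrite gprod_bouquet; [exact: diag_bouquet|move=> l; exact: (gen_diag (hb l))].
by apply: eq_bigr => l _; apply/esym/trace_antitrace_diag; exact: (gen_diag (hb l)).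
Qed.

End DiagonalFamilies.

(** * Families of Boolean type *)

Lemma nontree_card X (T : tgraph X) : (#|vtx T| <= #|edg T|)%N -> ~ is_tree T.
Proof.
have /andP[V0 _] := tg_conn T.
by move=> le /tree_card/(_ V0) E; rewrite E ltnn in le.
Qed.

Lemma card_nontree X (T : tgraph X) : ~ is_tree T -> (#|vtx T| <= #|edg T|)%N.
Proof.
move=> nt; rewrite leqNgt; apply/negP => lt; apply: nt; apply: card_tree.
  by have /andP[] := tg_conn T.
apply/eqP; rewrite eqn_leq lt andbT.
have /andP[/card_gt0P[x0 _] cT] := tg_conn T.
have [d [par [hpar pinj]]] := spanning_tree x0 cT.
rewrite -(prednK (n := #|vtx T|)) ?ltnS; last by apply/card_gt0P; exists x0.
rewrite -(cardsC1 x0) -(card_in_imset pinj).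
have <- : #|[set Some e | e in edg T]%SET| = #|edg T|.
  by rewrite card_imset //; exact: Some_inj.
apply/subset_leq_card/fintype.subsetP => _ /imsetP[x + ->].
by rewrite !inE => /hpar[_ [e -> _]]; apply/imsetP; exists e.
Qed.

Lemma leq_card_surj (U V : finType) (f : U -> V) :
  (forall y, exists x, f x = y) -> (#|V| <= #|U|)%N.
Proof.
move=> fs; have [g gK] := choice fs.
by apply: (@leq_card _ _ g) => x y e; rewrite -(gK x) e gK.
Qed.

(** Every inner vertex of the paths comes with an edge, so that |V| - |E| does
    not grow; for a connected graph, |V| <= |E| says that it is not a tree. *)
Lemma flatten_paths_card X (T : tgraph X) Y (n : edg T -> nat)
    (w : forall e, 'I_(n e).+1 -> Y) : (#|vtx T| <= #|edg T|)%N ->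
  (#|vtx (tflatten (@trelab X (gop Y) T (fun e => path_op (@w e))))| <=
   #|edg (tflatten (@trelab X (gop Y) T (fun e => path_op (@w e))))|)%N.
Proof.
set T' := trelab _; move=> le.
pose U : finType := (vtx T + {e : edg T & 'I_(n e)})%type.
pose f (u : U) : vtx (tflatten T') := vblock (fl_part T') (match u with
  | inl v => inl v
  | inr (existT e i) => @fl_inner Y T' e (inord i.+1) end).
have cE : #|edg (tflatten T')| = (#|{: {e : edg T & 'I_(n e)}}| + #|edg T|)%N.
  have -> : #|edg (tflatten T')| = \sum_(e : edg T) (n e).+1.
    by rewrite card_tagged sumnE big_map big_enum; apply: eq_bigr => e _; rewrite card_ord.
  rewrite card_tagged sumnE big_map big_enum -sum1_card -big_split /=.
  by apply: eq_bigr => e _; rewrite card_ord addn1.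
apply: (@leq_trans #|U|); last first.
  by rewrite card_sum cE addnC leq_add2l.
apply: (leq_card_surj (f := f)) => B.
have [[v|[e i]] <-] := vblock_surj B; first by exists (inl v).
have [i0|i0] := posnP (val i).
  exists (inl (tgt e)); apply/vblock_fl_part.
  rewrite (_ : i = gout (path_op (@w e))); first exact: (@fl_rel_tgt _ T' e).
  exact: val_inj.
have [ilt|ige] := ltnP i (n e).+1.
  have lt : (i.-1 < n e)%N by rewrite -ltnS prednK.
  exists (inr (existT (fun e => 'I_(n e)) e (Ordinal lt))); rewrite /f /=.
  rewrite (_ : inord i.-1.+1 = i) //; apply: val_inj.
  by rewrite /= prednK // inordK // ltnW.
exists (inl (src e)); apply/vblock_fl_part.
rewrite (_ : i = gin (path_op (@w e))); first exact: (@fl_rel_src _ T' e).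
by apply: val_inj; apply/eqP; rewrite /= eqn_leq ige andbT -ltnS ltn_ord.
Qed.

Section BooleanType.
Variables (R : realType) (A : traffic_space R) (K : Type) (a : K -> A).
Hypothesis ab : boolean_type a.

Definition words : set A :=
  [set x | exists n (w : 'I_n.+1 -> K), x = gact (path_op (a \o w))].

Lemma wordsM x y : words x -> words y -> words (gmul x y).
Proof.
move=> [m [v ->]] [n [w ->]]; exists (m + n.+1)%N, (catf v w : 'I_(m.+1 + n.+1) -> K).
rewrite gmul_path; congr (gact (path_op _)); apply/funext => i.
by rewrite /catf /=; case: fintype.splitP.
Qed.

Lemma gen_nusub_span :
  smallest (@is_nusubalgebra R A) (range a) `<=` lin_span words.
Proof.
apply: smallest_sub; first exact/nusubalgebra_span/wordsM.
move=> _ [j _ <-]; apply: sub_lin_span; exists 0%N, (fun=> j).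
by rewrite /= gact_path1.
Qed.

Lemma tau_words (T : tgraph A) : ~ is_tree T -> (forall e : edg T, words (lab e)) ->
  tau T = 0.
Proof.
move=> nT hT.
have ch (e : edg T) : exists p : {n : nat & 'I_n.+1 -> K},
    lab e = gact (path_op (a \o tagged p)).
  by have [n [w ew]] := hT e; exists (existT (fun n => 'I_n.+1 -> K) n w).
have [p pE] := choice ch.
pose T1 := @trelab _ (gop K) T (fun e => path_op (tagged (p e))).
transitivity (tau (tmap gact (tmap (gmap a) T1))).
  apply: tau_iso; exists id, id; split=> //; try by exists id.
  move=> e; rewrite [RHS]pE; apply: gact_iso.
  by exists id, id; split=> //; split=> //; exists id.
rewrite tau_flatten_map.
apply: ab; apply: nontree_card; apply: flatten_paths_card; exact: card_nontree.
Qed.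

Lemma tau_span_words (T : tgraph A) : ~ is_tree T ->
  (forall e : edg T, lin_span words (lab e)) -> tau T = 0.
Proof.
move=> nT hT.
have -> : tau T = tau (trelab (@lab _ T)).
  by apply: tau_iso; exists id, id; split=> //; exists id.
apply: (@multilinear_ext R A (edg T) (fun l => tau (@trelab A A T l)) (fun=> 0) words
  (tau_multilinear (T := T)) _ _ (@lab _ T)) => //.
  by move=> *; rewrite mulr0 addr0.
by move=> l hl; exact: (@tau_words (trelab l)).
Qed.

(** The difference |V| - |E| does not grow either when vertices are
    identified, whence an induction on the number of vertices. *)
Lemma tau0_span_words (tau0 : tgraph A -> Cplx R) (T : tgraph A) :
  injective_version tau0 -> (forall e : edg T, lin_span words (lab e)) ->
  (#|vtx T| <= #|edg T|)%N -> tau0 T = 0.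
Proof.
move=> [t0i t0E]; have [n] := ubnP #|vtx T|; elim: n T => // n IH T lt hT le.
have := t0E T; rewrite sum_quotients_split // big1 ?addr0 => [<-|P ltP].
  by apply: tau_span_words => //; exact: nontree_card.
apply: IH => //; first exact: leq_trans ltP lt.
exact: leq_trans (ltnW ltP) le.
Qed.

(** Any identification of vertices turns a tree into a graph with |V| <= |E|,
    to which the previous lemma applies. *)
Lemma tau0_span_words_tree (tau0 : tgraph A -> Cplx R) (T : tgraph A) :
  injective_version tau0 -> (forall e : edg T, lin_span words (lab e)) ->
  (#|vtx T| <= #|edg T|.+1)%N -> tau0 T = tau T.
Proof.
move=> t0P hT le; have [t0i t0E] := t0P; rewrite t0E sum_quotients_split //.
rewrite big1 ?addr0 // => P ltP; apply: tau0_span_words => //.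
by rewrite -ltnS; exact: leq_trans ltP le.
Qed.

End BooleanType.

(** In a path whose consecutive edges have different colors, the colored
    components are the edges. *)
Section AlternatingPath.
Variables (X : Type) (I : eqType) (col : X -> I) (n : nat) (b : 'I_n -> X).
Hypothesis alt : forall j k : 'I_n, k = j.+1 :> nat -> col (b j) != col (b k).

Lemma path_cls (e : edg (path_graph b)) : @cls _ _ col (path_graph b) e = [set e]%SET.
Proof.
apply/setP => d; rewrite !inE; apply/idP/eqP => [|->]; last exact: connect0.
case/connectP => p + ->; elim: p e => //= k p IH e /andP[ek /IH ->].
case/andP: ek => /eqP ck /existsP[v /andP[ev kv]].
have tE (i : 'I_n) : @touch X (path_graph b) i v -> val v = i \/ val v = i.+1.
  by case/orP=> /eqP ->; [right|left]; rewrite /= inordK // ltnS ?ltn_ord // ltnW.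
have h (j k' : 'I_n) : col (b j) = col (b k') -> k' = j.+1 :> nat -> False.
  by move=> cc /alt; rewrite cc eqxx.
apply: val_inj => /=; case: (tE _ ev) (tE _ kv) => -> [] //.
- by move=> ek; case: (h k e).
- by move=> ek; case: (h e k).
- by case.
Qed.

Lemma path_src_tgt (e : edg (path_graph b)) : src e != tgt e.
Proof.
apply/eqP => /(congr1 val) /=; rewrite !inordK ?ltnS ?ltn_ord //; last exact: ltnW.
by move/eqP; rewrite -[X in _ == X]addn0 -addn1 eqn_add2l.
Qed.

Lemma path_gcc_tree : (0 < n)%N -> is_tree (gcc col (path_graph b)).
Proof.
move=> n0; apply/gcc_tree_count; first by rewrite card_ord.
have cE : components col (path_graph b) = [set [set e] | e in edg (path_graph b)]%SET.
  apply/setP => S; rewrite componentsE; apply/existsP/imsetP => -[e].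
    by rewrite path_cls => /eqP ->; exists e.
  by move=> _ ->; exists e; rewrite path_cls.
rewrite (eq_bigr (fun=> 2%N)); last first.
  move=> S; rewrite cE => /imsetP[e _ ->].
  have <- : #|[set src e; tgt e]%SET| = 2%N by rewrite cards2 path_src_tgt.
  apply: eq_card => v; rewrite finset.in_set2.
  apply/sub_vtxP/idP => [[d]|].
    by rewrite inE => /eqP ->.
  by move=> ev; exists e; rewrite ?inE.
rewrite sum_nat_const cE card_imset; last exact: finset.set1_inj.
by rewrite !card_ord; lia.
Qed.

End AlternatingPath.

(** The anti-trace of b_1 ... b_n is tau of a path T with n edges. If a
    quotient of T contributes, its components have more vertices than edges,
    and the tree criterion forces the quotient to have at least n + 1
    vertices: no vertices are identified. Hence tau T = tau0 T, and this
    factorizes over the edges. *)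
Lemma boolean_indep_families (R : realType) (A : traffic_space R) (L : nat)
    (J : 'I_L -> Type) (a : forall l, J l -> A) :
  indep_families a -> (forall l, boolean_type (@a l)) ->
  boolean_indep (@traffic_antitrace R A) a.
Proof.
move=> [tau0 t0P fact] ab n l b n0 alt hb.
rewrite gprod_path antitrace_gact /=.
pose B l := smallest (@is_gsubalgebra R A) (range (@a l)).
have B0 i : B i 0 by case: (gsubalgebra_smallest (range (@a i))) => -[].
have nuB i : gen_nusubalgebra a i `<=` B i.
  apply: smallest_sub; last exact: sub_gen_smallest.
  by case: (gsubalgebra_subalgebra (gsubalgebra_smallest (range (@a i)))).
have hw j : lin_span (words (@a (l j))) (b j) by exact: (gen_nusub_span (hb j)).
pose T := path_graph (fun j => existT (fun _ : 'I_L => A) (l j) (b j)).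
pose tv (x : {_ : 'I_L & A}) : A := tagged x.
have form (T' : tgraph {_ : 'I_L & A}) :
    (forall e : edg T', B (tag (lab e)) (tv (lab e))) ->
    tau0 (tmap tv T') = if `[< is_tree (gcc (@tag 'I_L (fun=> A)) T') >] then
      \prod_(S : component (@tag 'I_L (fun=> A)) T') tau0 (tmap tv (component_graph S))
    else 0.
  by move=> hT'; exact: (@indep_form _ _ _ _ _ B0 _ id T' fact hT').
have small (P : vpart (vtx T)) : (#|{: part_block P}| < #|vtx T|)%N ->
    tau0 (tmap tv (tquot P)) = 0.
  move=> ltP; rewrite form; last by move=> e; exact: (nuB _ _ (hb e)).
  case: asboolP => // /gcc_tree_count count.
  apply/eqP; apply: contraTT ltP => /prodf_neq0 nz.
  have E0 : (0 < #|edg (tquot P)|)%N by rewrite card_ord.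
  have {}count := count E0.
  rewrite -leqNgt [X in (X <= _)%N]card_ord.
  have big : (\sum_(S in components (@tag 'I_L (fun=> A)) (tquot P)) (#|S| + 1) <=
      \sum_(S in components (@tag 'I_L (fun=> A)) (tquot P)) #|sub_vtx S|)%N.
    apply: leq_sum => S cS; rewrite addn1 ltnNge; apply/negP => le.
    have := nz (exist _ S cS) isT; apply/negP; rewrite negbK; apply/eqP.
    have := cS; rewrite componentsE => /existsP[e /eqP eS].
    apply: (@tau0_span_words _ _ _ (@a (l e)) (ab (l e)) tau0) => //.
      move=> d /=; have -> : l e = l (val d).
        apply: (component_col cS); first by rewrite eS mem_cls.
        exact: (valP d).
      exact: hw.
    by rewrite (@card_component_vtx _ _ _ _ (exist _ S cS)) card_component_edg.
  have sz : (\sum_(S in components (@tag 'I_L (fun=> A)) (tquot P)) #|S| = n)%N.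
    have := sum_components (@tag 'I_L (fun=> A)) (T := tquot P) (fun=> 1%N).
    rewrite sum1_card card_ord => <-; apply: eq_bigr => S _.
    by rewrite sum1_card.
  have cV : #|vtx (tquot P)| = #|{: part_block P}| by [].
  move: count big; rewrite big_split /= sum1_card sz cV => c1 c2.
  have := leq_add c2 (leqnn 1%N); rewrite c1 addnAC [X in (_ <= X)%N]addnC leq_add2r.
  by rewrite addn1.
have -> : tau (path_graph b) = tau0 (tmap tv T).
  have [t0i t0E] := t0P; transitivity (tau (tmap tv T)).
    by apply: tau_iso; exists id, id; split=> //; exists id.
  rewrite t0E sum_quotients_split // big1 ?addr0 // => P ltP.
  rewrite -[RHS](small P ltP); apply: t0i.
  by exists id, id; split=> //; exists id.
rewrite form; last by move=> e; exact: (nuB _ _ (hb e)).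
case: asboolP => [_|]; last by case; exact: path_gcc_tree.
pose C (e : edg T) : component (@tag 'I_L (fun=> A)) T :=
  exist _ (cls (@tag 'I_L (fun=> A)) e) (components_cls (@tag 'I_L (fun=> A)) e).
have CE e : val (C e) = [set e]%SET by rewrite /= path_cls.
have Cb : bijective C.
  apply: inj_card_bij => [e d /(congr1 val)|].
    by rewrite !CE => /finset.set1_inj.
  rewrite card_sig -[X in (_ <= X)%N](card_imset _ (@finset.set1_inj _)).
  apply/subset_leq_card/fintype.subsetP => S SP.
  have := SP : S \in components (@tag 'I_L (fun=> A)) T; rewrite componentsE.
  by case/existsP => e /eqP ->; rewrite path_cls //; apply/imsetP; exists e.
rewrite (reindex C) /=; last exact: onW_bij.
apply: eq_bigr => e0 _; move: (e0 : edg T) => {e0} e.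
have eC : e \in val (C e) by exact: mem_cls.
have memC d : (d \in val (C e)) = (d == e) by rewrite CE inE.
have eq_e (d : edg (component_graph (C e))) : val d = e.
  by apply/eqP; rewrite -memC; exact: (valP d).
have vE (v : vtx (component_graph (C e))) : @touch _ T e (val v).
  by have /sub_vtxP[d] := valP v; rewrite memC => /eqP ->.
pose e' : edg (component_graph (C e)) := exist _ e eC.
have iso : tiso (edge_graph (b e)) (tmap tv (component_graph (C e))).
  exists (fun v : bool => if v then tgt e' else src e'), (fun=> e'); split=> //.
    exists (fun v : vtx (component_graph (C e)) => val v == tgt e) => [[]|v] /=; first by rewrite eqxx.
      by apply/negbTE; exact: path_src_tgt.
    case: eqP => [vt|nvt]; first exact: val_inj.
    by apply: val_inj => /=; case/orP: (vE v) => /eqP.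
  by exists (fun=> tt) => [[]|d] //; apply: val_inj; rewrite eq_e.
rewrite /traffic_antitrace (tau_iso iso).
apply: (@tau0_span_words_tree _ _ _ (@a (l e)) (ab (l e)) tau0) => //.
  by move=> d /=; rewrite eq_e; exact: hw.
by rewrite -(tiso_card iso) card_bool ltnS; apply/card_gt0P; exists e'.
Qed.

(** * Moments of Haar unitary matrices *)

Section HaarExpectation.
Variables (R : realType) (n : nat).
Local Notation C := (Cplx R).
Local Notation M := (mxBorel R n.+1).
Variable mu : probability M R.
Hypothesis haar : is_haar mu.

Definition uni : set M := [set U : M | (U : 'M[C]_n.+1) \is unitarymx].

Lemma normRe_le (z : C) : `|complex.Re z|%:C%C <= `|z| :> C.
Proof.
rewrite normc_def lecR -sqrtr_sqr; apply: ler_wsqrtr.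
by rewrite lerDl sqr_ge0.
Qed.

Lemma normIm_le (z : C) : `|complex.Im z|%:C%C <= `|z| :> C.
Proof.
rewrite normc_def lecR -sqrtr_sqr; apply: ler_wsqrtr.
by rewrite lerDr sqr_ge0.
Qed.

Lemma open_entry (g : C -> R) i j (a b : R) :
  (forall z w : C, `|g z - g w|%:C%C <= `|z - w|) ->
  open [set U : 'M[C]_n.+1 | a < g (U i j) < b].
Proof.
move=> lip; rewrite openE => U /= /andP[aU Ub].
pose e := Num.min (g (U i j) - a) (b - g (U i j)).
have e0 : 0 < e by rewrite lt_min !subr_gt0 aU.
rewrite /interior; apply/nbhs_ballP; exists (e%:C)%C => /=; first by rewrite ltcR.
move=> V [_ UV].
have := UV i j; rewrite /ball /= => h.
have : `|g (U i j) - g (V i j)|%:C%C < e%:C%C :> C by exact: le_lt_trans (lip _ _) h.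
rewrite ltcR ltr_norml lt_min => /andP[h1 h2].
have e1 : e <= g (U i j) - a by rewrite ge_min lexx.
have e2 : e <= b - g (U i j) by rewrite ge_min lexx orbT.
apply/andP; split; lra.
Qed.

Lemma measurable_entry (g : C -> R) i j :
  (forall z w : C, `|g z - g w|%:C%C <= `|z - w|) ->
  measurable_fun setT (fun U : M => g ((U : 'M[C]_n.+1) i j)).
Proof.
move=> lip; apply: (measurability _ (measurable_realfun.RGenOpens.measurableE R)).
move=> _ [_ [a [b ->] <-]]; rewrite setTI.
apply: sub_sigma_algebra.
by rewrite (_ : _ @^-1` _ = [set U : 'M[C]_n.+1 | a < g (U i j) < b]);
  [exact: open_entry|apply/seteqP; split => U /=; rewrite in_itv].
Qed.

Lemma measurable_Re i j :
  measurable_fun setT (fun U : M => complex.Re ((U : 'M[C]_n.+1) i j)).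
Proof.
apply: measurable_entry => z w; have := normRe_le (z - w).
by rewrite (_ : complex.Re (z - w) = complex.Re z - complex.Re w) //; case: z w => ? ? [].
Qed.

Lemma measurable_Im i j :
  measurable_fun setT (fun U : M => complex.Im ((U : 'M[C]_n.+1) i j)).
Proof.
apply: measurable_entry => z w; have := normIm_le (z - w).
by rewrite (_ : complex.Im (z - w) = complex.Im z - complex.Im w) //; case: z w => ? ? [].
Qed.

Lemma unitary_entry_le (U : 'M[C]_n.+1) i j : U \is unitarymx -> `|U i j| <= 1.
Proof.
move/unitarymxP/matrixP/(_ i i); rewrite !mxE eqxx /= => h.
have : `|U i j| ^+ 2 <= 1.
  rewrite -[X in _ <= X]h (bigD1 j) //= !mxE -normCK lerDl; apply: sumr_ge0 => k _.
  by rewrite !mxE -normCK exprn_ge0.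
by rewrite -[X in _ <= X](expr1n _ 2) ler_pXn2r ?nnegrE.
Qed.

(** Measurability of the translations is derived from their continuity, the
    Borel sets being generated by the open sets. *)
Lemma open_mulmx (V : 'M[C]_n.+1) (B : set 'M[C]_n.+1) : V \is unitarymx ->
  open B -> open [set U : 'M[C]_n.+1 | B (V *m U)].
Proof.
move=> Vu oB; rewrite openE => U /= VU.
move: oB; rewrite openE => /(_ _ VU); rewrite /interior => /nbhs_ballP[e /= e0 eB].
rewrite /interior; apply: (iffRL (@nbhs_ballP _ _ U _)); exists (e / n.+1%:R) => /=; first by rewrite divr_gt0.
move=> W [_ UW]; apply: eB; split=> // i j.
rewrite /ball /= !mxE -sumrB.
apply: (@le_lt_trans _ _ (\sum_(k < n.+1) `|U k j - W k j|)).
  apply: le_trans (ler_norm_sum _ _ _) _; apply: ler_sum => k _.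
  rewrite -mulrBr normrM -[X in _ <= X]mul1r.
  by apply: ler_wpM2r => //; exact: unitary_entry_le.
have -> : e = \sum_(k < n.+1) e / n.+1%:R.
  by rewrite sumr_const card_ord -[RHS]mulr_natr divfK ?pnatr_eq0.
apply: ltr_sum => [|k _]; last exact: UW.
by apply/hasP; exists ord0; rewrite ?mem_index_enum.
Qed.

Lemma measurable_mulmx (V : 'M[C]_n.+1) : V \is unitarymx ->
  measurable_fun setT (fun U : M => V *m U : M).
Proof.
move=> Vu; apply: (@measurability _ _ M M setT (fun U : M => V *m U : M)
  (@open 'M[C]_n.+1)) => //.
by move=> _ [B oB <-]; rewrite setTI; apply: sub_sigma_algebra; exact: open_mulmx.
Qed.

Definition cmeas (f : M -> C) :=
  measurable_fun setT (fun U => complex.Re (f U)) /\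
  measurable_fun setT (fun U => complex.Im (f U)).

Lemma cReD (z w : C) : complex.Re (z + w) = complex.Re z + complex.Re w.
Proof. by case: z w => ? ? []. Qed.
Lemma cImD (z w : C) : complex.Im (z + w) = complex.Im z + complex.Im w.
Proof. by case: z w => ? ? []. Qed.
Lemma cReM (z w : C) :
  complex.Re (z * w) = complex.Re z * complex.Re w - complex.Im z * complex.Im w.
Proof. by case: z w => ? ? []. Qed.
Lemma cImM (z w : C) :
  complex.Im (z * w) = complex.Re z * complex.Im w + complex.Im z * complex.Re w.
Proof. by case: z w => ? ? []. Qed.
Lemma cReJ (z : C) : complex.Re z^* = complex.Re z.
Proof. by case: z. Qed.
Lemma cImJ (z : C) : complex.Im z^* = - complex.Im z.
Proof. by case: z. Qed.

Lemma cmeas_cst (c : C) : cmeas (fun=> c).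
Proof. by split; exact: measurable_cst. Qed.

Lemma cmeasD f g : cmeas f -> cmeas g -> cmeas (fun U => f U + g U).
Proof.
move=> [f1 f2] [g1 g2]; split.
  by under eq_fun do rewrite cReD; exact: measurable_funD.
by under eq_fun do rewrite cImD; exact: measurable_funD.
Qed.

Lemma cmeasM f g : cmeas f -> cmeas g -> cmeas (fun U => f U * g U).
Proof.
move=> [f1 f2] [g1 g2]; split.
  by under eq_fun do rewrite cReM; apply: measurable_funB; exact: measurable_funM.
by under eq_fun do rewrite cImM; apply: measurable_funD; exact: measurable_funM.
Qed.

Lemma cmeas_conj f : cmeas f -> cmeas (fun U => (f U)^*).
Proof.
move=> [f1 f2]; split; first by under eq_fun do rewrite cReJ.
by under eq_fun do rewrite cImJ; exact: measurableT_comp.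
Qed.

Lemma cmeas_sum (I : Type) (s : seq I) (f : I -> M -> C) :
  (forall i, cmeas (f i)) -> cmeas (fun U => \sum_(i <- s) f i U).
Proof.
move=> hf; elim: s => [|i s IH].
  by under eq_fun do rewrite big_nil; exact: cmeas_cst.
by under eq_fun do rewrite big_cons; exact: cmeasD.
Qed.

Lemma cmeas_entry i j : cmeas (fun U : M => (U : 'M[C]_n.+1) i j).
Proof. by split; [exact: measurable_Re|exact: measurable_Im]. Qed.

(** U is unitary when the sum of the squared moduli of the entries of U U^* -
    1 vanishes, and this sum is a measurable function of U. *)
Lemma measurable_uni : measurable uni.
Proof.
pose d (i j : 'I_n.+1) (U : M) : C :=
  ((U : 'M[C]_n.+1) *m (U : 'M[C]_n.+1)^t*%sesqui) i j - (i == j)%:R.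
have dm i j : cmeas (d i j).
  apply: cmeasD; last exact: cmeas_cst.
  under eq_fun do rewrite mxE; apply: cmeas_sum => k.
  apply: cmeasM; first exact: cmeas_entry.
  by under eq_fun do rewrite !mxE; apply: cmeas_conj; exact: cmeas_entry.
pose h (U : M) : R := \sum_(i < n.+1) \sum_(j < n.+1)
  (complex.Re (d i j U) ^+ 2 + complex.Im (d i j U) ^+ 2).
have hm : measurable_fun setT h.
  apply: measurable_sum => i; apply: measurable_sum => j.
  by apply: measurable_funD; apply: measurable_funX; case: (dm i j).
have -> : uni = h @^-1` [set 0].
  apply/seteqP; split => U /=.
    move/unitarymxP => UU; rewrite /h big1 // => i _; rewrite big1 // => j _.
    by rewrite /d UU !mxE subrr /= expr0n addr0.
  have sq (x y : R) : 0 <= x ^+ 2 + y ^+ 2 by rewrite addr_ge0 ?sqr_ge0.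
  move/eqP; rewrite psumr_eq0 => [/allP h0|i _]; last exact: sumr_ge0.
  apply/unitarymxP/matrixP => i j; apply/eqP; rewrite -subr_eq0 [X in _ - X]mxE.
  have := h0 i; rewrite mem_index_enum => /(_ isT).
  rewrite psumr_eq0 => [/allP/(_ j)|//]; rewrite mem_index_enum => /(_ isT) /=.
  rewrite paddr_eq0 ?sqr_ge0 // !sqrf_eq0 => /andP[re im].
  by rewrite eq_complex /= re im.
by rewrite -[X in measurable X]setTI; apply: hm.
Qed.

Lemma mu_uni : mu uni = 1%E. Proof. by case: haar. Qed.

Lemma mu_not_uni : mu (~` uni) = 0%E.
Proof.
rewrite probability_setC; last exact: measurable_uni.
rewrite [X in (_ - X)%E](_ : _ = 1%E) ?subee //; exact: mu_uni.
Qed.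

(** ** Bounded random variables *)

(** Boundedness is required on the unitary matrices, which carry the measure:
    the entries of a matrix are bounded only there. *)
Definition nice (f : M -> R) :=
  measurable_fun setT f /\ exists K, forall U, uni U -> `|f U| <= K.

Definition expect (f : M -> R) : R := \int[mu]_(U in setT) f U.
Local Notation E := expect.

Lemma expect_ext f g : f =1 g -> E f = E g.
Proof. by move=> fg; congr expect; apply/funext. Qed.

Lemma expect_ge0 f : (forall U, 0 <= f U) -> 0 <= E f.
Proof. by move=> f0; apply: Rintegral_ge0. Qed.

Lemma nice_integrable f : nice f -> mu.-integrable setT (EFin \o f).
Proof.
move=> [mf [K fK]].
have mN : measurable (~` uni) by apply: measurableC; exact: measurable_uni.
apply/(negligible_integrable mN) => //; first exact/measurable_EFinP.
  exact: mu_not_uni.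
rewrite setTD setCK; apply: measurable_bounded_integrable.
- exact: measurable_uni.
- rewrite [X in (X < _)%E](_ : _ = 1%E) ?ltry //; exact: mu_uni.
- exact: measurable_funTS.
- by exists K; split; [exact: num_real|move=> x Kx U /fK le; exact: le_trans le (ltW Kx)].
Qed.

Lemma nice_E_uni f : nice f -> E f = \int[mu]_(U in uni) f U.
Proof.
move=> fn; rewrite /expect /Rintegral (@negligible_integral _ _ _ mu setT (~` uni)) //.
- by rewrite setTD setCK.
- by apply: measurableC; exact: measurable_uni.
- exact: nice_integrable.
- exact: mu_not_uni.
Qed.

Lemma nice_uni_integrable f : nice f -> mu.-integrable uni (EFin \o f).
Proof.
move=> /nice_integrable; apply: integrableS => //; exact: measurable_uni.
Qed.

Lemma E_le f g : nice f -> nice g -> (forall U, uni U -> f U <= g U) -> E f <= E g.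
Proof.
move=> fn gn fg; rewrite !nice_E_uni //; apply: le_Rintegral => //.
- exact: measurable_uni.
- exact: nice_uni_integrable.
- exact: nice_uni_integrable.
Qed.

Lemma E_eq f g : nice f -> nice g -> (forall U, uni U -> f U = g U) -> E f = E g.
Proof.
by move=> fn gn fg; apply/eqP; rewrite eq_le !E_le // => U uU; rewrite fg.
Qed.

Lemma E_cst (c : R) : E (fun=> c) = c.
Proof. rewrite /expect Rintegral_cst // [X in fine X](_ : _ = 1%E) ?mulr1 //; exact: probability_setT. Qed.

Lemma E_add f g : nice f -> nice g -> E (fun U => f U + g U) = E f + E g.
Proof. by move=> fn gn; apply: RintegralD => //; exact: nice_integrable. Qed.

Lemma E_scale (c : R) f : nice f -> E (fun U => c * f U) = c * E f.
Proof. by move=> fn; apply: RintegralZl => //; exact: nice_integrable. Qed.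

Lemma uni_mul (V U : 'M[C]_n.+1) : V \is unitarymx -> uni U -> uni (V *m U).
Proof. exact: mul_unitarymx. Qed.

Lemma nice_mulmx f (V : 'M[C]_n.+1) : V \is unitarymx -> nice f ->
  nice (fun U : M => f (V *m U : M)).
Proof.
move=> Vu [mf [K fK]]; split; last by exists K => U uU; apply: fK; exact: uni_mul.
exact: (measurableT_comp mf (measurable_mulmx Vu)).
Qed.

Lemma E_mulmx f (V : 'M[C]_n.+1) : V \is unitarymx -> nice f ->
  E (fun U : M => f (V *m U : M)) = E f.
Proof.
move=> Vu fn; rewrite /expect /Rintegral; congr fine.
pose phi (U : M) : M := V *m U.
have mphi : measurable_fun setT phi by exact: measurable_mulmx.
transitivity (\int[pushforward mu phi]_(U in setT) (f U)%:E)%E.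
  rewrite (@integral_pushforward _ _ _ _ _ phi mphi mu setT (fun U => (f U)%:E)) //.
  - by apply/measurable_EFinP; case: fn.
  - exact: (nice_integrable (nice_mulmx Vu fn)).
by apply: eq_measure_integral => B mB _; exact: (haar.2 V Vu B mB).
Qed.

Lemma nice_cst (c : R) : nice (fun=> c).
Proof. by split; [exact: measurable_cst|exists `|c|]. Qed.

Lemma niceD f g : nice f -> nice g -> nice (fun U => f U + g U).
Proof.
move=> [mf [K fK]] [mg [K' gK]]; split; first exact: measurable_funD.
exists (K + K') => U uU; apply: le_trans (ler_normD _ _) _.
by apply: lerD; [exact: fK|exact: gK].
Qed.

Lemma niceM f g : nice f -> nice g -> nice (fun U => f U * g U).
Proof.
move=> [mf [K fK]] [mg [K' gK]]; split; first exact: measurable_funM.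
by exists (K * K') => U uU; rewrite normrM; apply: ler_pM => //; [exact: fK|exact: gK].
Qed.

Lemma niceX f k : nice f -> nice (fun U => f U ^+ k).
Proof.
move=> fn; elim: k => [|k IH]; first exact: nice_cst.
by under eq_fun do rewrite exprS; exact: niceM.
Qed.

Lemma nice_sum (I : Type) (s : seq I) (f : I -> M -> R) :
  (forall i, nice (f i)) -> nice (fun U => \sum_(i <- s) f i U).
Proof.
move=> hf; elim: s => [|i s IH].
  by under eq_fun do rewrite big_nil; exact: nice_cst.
by under eq_fun do rewrite big_cons; exact: niceD.
Qed.

Lemma E_sum (I : Type) (s : seq I) (f : I -> M -> R) :
  (forall i, nice (f i)) ->
  E (fun U => \sum_(i <- s) f i U) = \sum_(i <- s) E (f i).
Proof.
move=> hf; elim: s => [|i s IH].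
  by under eq_fun do rewrite big_nil; rewrite big_nil E_cst.
under eq_fun do rewrite big_cons.
by rewrite big_cons E_add ?IH //; exact: nice_sum.
Qed.

End HaarExpectation.

(** ** Unitary matrices acting on two coordinates *)

Section PlaneMatrix.
Variables (C : numClosedFieldType) (n : nat) (i k : 'I_n).
Hypothesis ik : i != k.
Variables (p q r s : C).

(** The identity, except in the rows and columns i and k, where it is the 2 by
    2 matrix with rows (p, q) and (r, s). *)
Definition plane_mx : 'M[C]_n := \matrix_(a, b)
  if a == i then p * (b == i)%:R + q * (b == k)%:R
  else if a == k then r * (b == i)%:R + s * (b == k)%:R else (a == b)%:R.

Lemma sum_delta (g : 'I_n -> C) a : \sum_b (b == a)%:R * g b = g a.
Proof.
rewrite (bigD1 a) //= eqxx mul1r big1 ?addr0 // => b /negbTE ->.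
by rewrite mul0r.
Qed.

Lemma sum_plane (g : 'I_n -> C) a : \sum_b plane_mx a b * g b =
  if a == i then p * g i + q * g k else if a == k then r * g i + s * g k else g a.
Proof.
have two (c d : C) : \sum_b (c * (b == i)%:R + d * (b == k)%:R) * g b =
    c * g i + d * g k.
  under eq_bigr do rewrite mulrDl -!mulrA; rewrite big_split /= -!mulr_sumr.
  by rewrite !sum_delta.
case: (boolP (a == i)) => ai.
  by under eq_bigr do rewrite mxE ai; exact: two.
case: (boolP (a == k)) => ak.
  by under eq_bigr do rewrite mxE (negbTE ai) ak; exact: two.
under eq_bigr do rewrite mxE (negbTE ai) (negbTE ak) eq_sym.
exact: sum_delta.
Qed.

Lemma plane_unitary : p * p^* + q * q^* = 1 -> r * r^* + s * s^* = 1 ->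
  p * r^* + q * s^* = 0 -> plane_mx \is unitarymx.
Proof.
move=> h1 h2 h3.
have h3' : r * p^* + s * q^* = 0.
  have /= := congr1 (fun z => z^*) h3; rewrite rmorphD !rmorphM /= !conjCK rmorph0 => <-.
  by rewrite mulrC [q^* * _]mulrC.
apply/unitarymxP/matrixP => a b; rewrite mxE.
under eq_bigr do rewrite !mxE -/(plane_mx _ _).
have -> : \sum_j (if a == i then p * (j == i)%:R + q * (j == k)%:R
   else if a == k then r * (j == i)%:R + s * (j == k)%:R else (a == j)%:R) *
   (if b == i then p * (j == i)%:R + q * (j == k)%:R
   else if b == k then r * (j == i)%:R + s * (j == k)%:R else (b == j)%:R)^* =
   \sum_j plane_mx a j * (plane_mx b j)^*.
  by apply: eq_bigr => j _; rewrite !mxE.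
have ki : (k == i) = false by rewrite eq_sym (negbTE ik).
have ik' := negbTE ik.
rewrite sum_plane !mxE !eqxx ki ik' !(mulr1, mulr0, addr0, add0r).
case: (eqVneq a i) => [->|ai].
  case: (eqVneq b i) => [_|bi]; first exact: h1.
  case: (eqVneq b k) => [_|bk]; first by rewrite ?ik' ?ki h3.
  by rewrite !conjC0 !mulr0 addr0.
case: (eqVneq a k) => [->|ak].
  case: (eqVneq b i) => [->|bi]; first by rewrite ?ik' ?ki h3'.
  case: (eqVneq b k) => [_|bk]; first exact: h2.
  by rewrite !conjC0 !mulr0 addr0.
case: (eqVneq b i) => [->|bi].
  by rewrite ?(negbTE ai) ?(negbTE ak) !mulr0 addr0 conjC0.
case: (eqVneq b k) => [->|bk].
  by rewrite ?(negbTE ai) ?(negbTE ak) !mulr0 addr0 conjC0.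
by rewrite conjC_nat eq_sym.
Qed.

Lemma plane_mulmx m (U : 'M[C]_(n, m)) a j : (plane_mx *m U) a j =
  if a == i then p * U i j + q * U k j
  else if a == k then r * U i j + s * U k j else U a j.
Proof. by rewrite mxE sum_plane. Qed.

End PlaneMatrix.

(** ** Moments of the entries *)

Section Moments.
Variables (R : realType) (n : nat).
Local Notation C := (Cplx R).
Local Notation M := (mxBorel R n.+1).
Variable mu : probability M R.
Hypothesis haar : is_haar mu.
Local Notation E := (expect mu).

Definition rent i j (U : M) : R := complex.Re ((U : 'M[C]_n.+1) i j).
Definition ient i j (U : M) : R := complex.Im ((U : 'M[C]_n.+1) i j).
Definition sqent i j (U : M) : R := rent i j U ^+ 2 + ient i j U ^+ 2.

Lemma sqent_norm i j (U : M) : (sqent i j U)%:C%C = `|(U : 'M[C]_n.+1) i j| ^+ 2.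
Proof. exact: add_Re2_Im2. Qed.

Lemma sqent_ge0 i j U : 0 <= sqent i j U.
Proof. by rewrite addr_ge0 ?sqr_ge0. Qed.

Lemma sqent_sum j U : uni U -> \sum_i sqent i j U = 1.
Proof.
rewrite /uni /= -trmxC_unitary => /unitarymxP/matrixP/(_ j j).
rewrite !mxE eqxx /= => h; apply: complexI.
rewrite rmorph_sum rmorph1 /= -[RHS]h; apply: eq_bigr => i _.
rewrite [LHS]sqent_norm !mxE normCK mulrC.
by rewrite conjCK.
Qed.

Lemma sqent_le1 i j U : uni U -> sqent i j U <= 1.
Proof.
move=> uU; rewrite -(sqent_sum j uU) (bigD1 i) //= lerDl.
by apply: sumr_ge0 => k _; exact: sqent_ge0.
Qed.

Lemma nice_rent i j : nice (rent i j).
Proof.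
split; first exact: measurable_Re.
exists 1 => U uU; rewrite -(ler_pXn2r (n := 2)) ?nnegrE // expr1n real_normK ?num_real //.
by apply: le_trans (sqent_le1 i j uU); rewrite lerDl sqr_ge0.
Qed.

Lemma nice_ient i j : nice (ient i j).
Proof.
split; first exact: measurable_Im.
exists 1 => U uU; rewrite -(ler_pXn2r (n := 2)) ?nnegrE // expr1n real_normK ?num_real //.
by apply: le_trans (sqent_le1 i j uU); rewrite lerDr sqr_ge0.
Qed.

Lemma nice_sqent i j : nice (sqent i j).
Proof. by apply: niceD; apply: niceX; [exact: nice_rent|exact: nice_ient]. Qed.

Section TwoRows.
Variables (i k j : 'I_n.+1).
Hypothesis ik : i != k.
Let a := rent i j.
Let b := ient i j.
Let c := rent k j.
Let d := ient k j.
Let s U := sqent i j U + sqent k j U.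
Let dl U := (sqent i j U - sqent k j U) / 2.
Let r1 U := a U * c U + b U * d U.
Let r2 U := b U * c U - a U * d U.

Let rt : R := (Num.sqrt 2)^-1.

Let rt2 : rt ^+ 2 = 2^-1.
Proof. by rewrite /rt exprVn sqr_sqrtr. Qed.

Let niceN f : nice f -> nice (fun U : M => - f U).
Proof.
move=> fn; under eq_fun do rewrite -mulN1r.
by apply: niceM => //; exact: nice_cst.
Qed.

Let nice_s : nice s. Proof. by apply: niceD; exact: nice_sqent. Qed.
Let nice_dl : nice dl.
Proof.
apply: niceM; last exact: nice_cst.
by apply: niceD; [exact: nice_sqent|apply: niceN; exact: nice_sqent].
Qed.
Let nice_r1 : nice r1.
Proof. by apply: niceD; apply: niceM; [exact: nice_rent|exact: nice_rent|exact: nice_ient|exact: nice_ient]. Qed.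
Let nice_r2 : nice r2.
Proof.
by apply: niceD; [|apply: niceN]; apply: niceM; [exact: nice_ient|exact: nice_rent|exact: nice_rent|exact: nice_ient].
Qed.

Let rC (x : R) : (x%:C%C : C)^* = x%:C%C.
Proof. exact: conjc_real. Qed.

(** The unitary matrix which replaces the rows i and k by their normalized sum
    and difference turns dl into r1 and preserves s. *)
Let e_r1 m : E (fun U => dl U ^+ 2 * s U ^+ m) = E (fun U => r1 U ^+ 2 * s U ^+ m).
Proof.
pose V : 'M[C]_n.+1 := plane_mx i k rt%:C%C rt%:C%C rt%:C%C (- rt%:C%C).
have rr : rt * rt + rt * rt = 1.
  by rewrite -expr2 rt2; lra.
have Vu : V \is unitarymx.
  apply: plane_unitary => //; rewrite ?rmorphN /= !rC ?mulrNN -?rmorphM -?rmorphD /= ?rr //.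
  by rewrite mulrN -rmorphM subrr.
rewrite -(E_mulmx haar Vu); last by apply: niceM; apply: niceX.
have act U : [/\ rent i j (V *m U : M) = rt * (a U + c U),
    ient i j (V *m U : M) = rt * (b U + d U),
    rent k j (V *m U : M) = rt * (a U - c U) &
    ient k j (V *m U : M) = rt * (b U - d U)].
  have ki : (k == i) = false by rewrite eq_sym (negbTE ik).
  rewrite /a /b /c /d /rent /ient !plane_mulmx // !eqxx ki.
  case: ((U : 'M[C]_n.+1) i j) ((U : 'M[C]_n.+1) k j) => [x1 y1] [x2 y2]; rewrite ?mulNr ?cReD ?cImD ?cReM ?cImM /=.
  by split; ring.
apply: expect_ext => U; have [h1 h2 h3 h4] := act U.
have -> : dl (V *m U : M) = r1 U.
  by rewrite /dl /sqent h1 h2 h3 h4 !exprMn rt2 /r1; field.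
suff -> : s (V *m U : M) = s U by [].
by rewrite /s /sqent h1 h2 h3 h4 !exprMn rt2 -/a -/b -/c -/d; field.
Qed.

(** The same, once the row k is multiplied by the imaginary unit. *)
Let e_r2 m : E (fun U => dl U ^+ 2 * s U ^+ m) = E (fun U => r2 U ^+ 2 * s U ^+ m).
Proof.
pose V : 'M[C]_n.+1 := plane_mx i k rt%:C%C (Complex 0 rt) rt%:C%C (Complex 0 (- rt)).
have rr : rt * rt + rt * rt = 1.
  by rewrite -expr2 rt2; lra.
have iC (x : R) : (Complex 0 x : C)^* = Complex 0 (- x) by [].
have Vu : V \is unitarymx.
  apply: plane_unitary => //; rewrite rC iC; apply/eqP; rewrite eq_complex /=;
    apply/andP; split; apply/eqP; rewrite -?rr /=; ring.
rewrite -(E_mulmx haar Vu); last by apply: niceM; apply: niceX.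
have act U : [/\ rent i j (V *m U : M) = rt * (a U - d U),
    ient i j (V *m U : M) = rt * (b U + c U),
    rent k j (V *m U : M) = rt * (a U + d U) &
    ient k j (V *m U : M) = rt * (b U - c U)].
  have ki : (k == i) = false by rewrite eq_sym (negbTE ik).
  rewrite /a /b /c /d /rent /ient !plane_mulmx // !eqxx ki.
  case: ((U : 'M[C]_n.+1) i j) ((U : 'M[C]_n.+1) k j) => [x1 y1] [x2 y2].
  by rewrite ?cReD ?cImD ?cReM ?cImM /=; split; ring.
apply: expect_ext => U; have [h1 h2 h3 h4] := act U.
have -> : dl (V *m U : M) = r2 U.
  by rewrite /dl /sqent h1 h2 h3 h4 !exprMn rt2 /r2; field.
suff -> : s (V *m U : M) = s U by [].
by rewrite /s /sqent h1 h2 h3 h4 !exprMn rt2 -/a -/b -/c -/d; field.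
Qed.

(** The vector (dl, r1, r2) has norm s / 2 and, by invariance, coordinates
    with the same second moments; hence the factor 3 in the proof. As the
    product of the two squared moduli is s^2 / 4 - dl^2, it accounts for a
    sixth of s^2. *)
Let e_prod m : E (fun U => s U ^+ m.+2) =
  6 * E (fun U => sqent i j U * sqent k j U * s U ^+ m).
Proof.
have nX f : nice f -> nice (fun U => f U ^+ 2 * s U ^+ m).
  by move=> fn; apply: niceM; apply: niceX => //; exact: nice_s.
have [nd n1 n2] := And3 (nX _ nice_dl) (nX _ nice_r1) (nX _ nice_r2).
have h1 : E (fun U => s U ^+ m.+2) =
    4 * (3 * E (fun U => dl U ^+ 2 * s U ^+ m)).
  transitivity (E (fun U => 4 * (dl U ^+ 2 * s U ^+ m +
      (r1 U ^+ 2 * s U ^+ m + r2 U ^+ 2 * s U ^+ m)))).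
    apply: expect_ext => U; rewrite -!mulrDl mulrA -addn2 addnC exprD.
    by congr (_ * _); rewrite /s /dl /r1 /r2 /sqent -/a -/b -/c -/d; field.
  rewrite E_scale //; last by apply: niceD => //; exact: niceD.
  rewrite E_add //; last exact: niceD.
  rewrite E_add //.
  by rewrite -e_r1 -e_r2; congr (_ * _); ring.
have h2 : E (fun U => s U ^+ m.+2) =
    4 * (E (fun U => dl U ^+ 2 * s U ^+ m) +
         E (fun U => sqent i j U * sqent k j U * s U ^+ m)).
  have nXY : nice (fun U => sqent i j U * sqent k j U * s U ^+ m).
    by apply: niceM; [apply: niceM; exact: nice_sqent|exact: niceX].
  rewrite -E_add // -E_scale //; last exact: niceD.
  apply: expect_ext => U; rewrite -!mulrDl mulrA -addn2 addnC exprD.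
  by congr (_ * _); rewrite /s /dl; field.
lra.
Qed.

Let e_swap m : E (fun U => sqent i j U * sqent k j U ^+ m) =
  E (fun U => sqent i j U ^+ m * sqent k j U).
Proof.
pose V : 'M[C]_n.+1 := plane_mx i k 0 1 1 0.
have Vu : V \is unitarymx.
  by apply: plane_unitary => //; rewrite ?conjC0 ?conjC1 !(mulr0, mul0r, mulr1, addr0, add0r).
rewrite -(E_mulmx haar Vu); last first.
  by apply: niceM; [exact: nice_sqent|apply: niceX; exact: nice_sqent].
have ki : (k == i) = false by rewrite eq_sym (negbTE ik).
apply: expect_ext => U; rewrite /sqent /rent /ient !plane_mulmx // !eqxx ki.
by rewrite !(mul0r, mul1r, addr0, add0r) mulrC.
Qed.

(** Bound the left-hand side by a moment of s, turn s^2 into a product of the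
    two squared moduli, and split the remaining power of s. *)
Lemma moment_two_rows m : E (fun U => sqent i j U ^+ m.+1) <=
  6 * 2 ^+ m * E (fun U => sqent i j U ^+ m * sqent k j U).
Proof.
have nq l l' : nice (fun U => sqent i j U ^+ l * sqent k j U ^+ l').
  by apply: niceM; apply: niceX; exact: nice_sqent.
have n1 l : nice (fun U => sqent i j U ^+ l * sqent k j U).
  by apply: niceM; [apply: niceX|]; exact: nice_sqent.
have n2 l : nice (fun U => sqent i j U * sqent k j U ^+ l).
  by apply: niceM; [|apply: niceX]; exact: nice_sqent.
case: m => [|m].
  have -> : E (fun U => sqent i j U ^+ 1) = E (sqent k j).
    transitivity (E (fun U => sqent i j U * sqent k j U ^+ 0)).
      by apply: expect_ext => U; rewrite mulr1.
    by rewrite e_swap; apply: expect_ext => U; rewrite mul1r.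
  have -> : E (fun U => sqent i j U ^+ 0 * sqent k j U) = E (sqent k j).
    by apply: expect_ext => U; rewrite mul1r.
  rewrite expr0 mulr1 -[X in X <= _]mul1r; apply: ler_wpM2r; last lra.
  by apply: expect_ge0 => U; exact: sqent_ge0.
have le1 : E (fun U => sqent i j U ^+ m.+2) <= E (fun U => s U ^+ m.+2).
  apply: E_le => // [||U _]; first by apply: niceX; exact: nice_sqent.
    exact: niceX.
  have le_s : sqent i j U <= s U by rewrite /s lerDl sqent_ge0.
  have s0 := le_trans (sqent_ge0 i j U) le_s.
  by apply: lerXn2r; rewrite ?nnegrE ?sqent_ge0.
apply: (le_trans le1); rewrite e_prod.
have pow (x y : R) : 0 <= x -> 0 <= y -> (x + y) ^+ m <= 2 ^+ m * (x ^+ m + y ^+ m).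
  move=> x0 y0; wlog xy : x y x0 y0 / x <= y.
    by move=> w; have [/w|/ltW/w] := leP x y; [exact|rewrite addrC [y ^+ m + _]addrC; exact].
  apply: (@le_trans _ _ ((2 * y) ^+ m)).
    by apply: lerXn2r; rewrite ?nnegrE ?addr_ge0 ?mulr_ge0 //; lra.
  by rewrite exprMn ler_wpM2l ?exprn_ge0 // lerDr exprn_ge0.
have le2 : E (fun U => sqent i j U * sqent k j U * s U ^+ m) <=
    E (fun U => 2 ^+ m * (sqent i j U ^+ m.+1 * sqent k j U +
                          sqent i j U * sqent k j U ^+ m.+1)).
  apply: E_le => // [||U _].
  - by apply: niceM; [apply: niceM; exact: nice_sqent|exact: niceX].
  - by apply: niceM; [exact: nice_cst|exact: niceD].
  have x0 := sqent_ge0 i j U; have y0 := sqent_ge0 k j U.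
  have := ler_wpM2l (mulr_ge0 x0 y0) (pow _ _ x0 y0); rewrite /s => h.
  by apply: (le_trans h); rewrite !exprS; rewrite le_eqVlt; apply/orP; left; apply/eqP; ring.
have := ler_wpM2l (_ : 0 <= 6 :> R) le2.
rewrite E_scale; last exact: niceD.
rewrite E_add // e_swap => h; apply: (le_trans (h _)) => //.
  by rewrite exprS; rewrite le_eqVlt; apply/orP; left; apply/eqP; ring.
exact: haar.
Qed.

End TwoRows.

Fixpoint moment_cst m : R :=
  if m is m'.+1 then (6 * 2 ^+ m' + 1) * moment_cst m' else 1.

(** In a column of a unitary matrix the squared moduli sum to 1. Summing the
    previous bound over k therefore gains a factor N while losing one squared
    modulus. *)
Lemma moment_le m i j : E (fun U => sqent i j U ^+ m) * n.+1%:R ^+ m <= moment_cst m.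
Proof.
have nX l : nice (fun U => sqent i j U ^+ l) by apply: niceX; exact: nice_sqent.
elim: m => [|m IH].
  by under eq_fun do rewrite expr0; rewrite E_cst // mul1r.
suff h : E (fun U => sqent i j U ^+ m.+1) * n.+1%:R <=
    (6 * 2 ^+ m + 1) * E (fun U => sqent i j U ^+ m).
  rewrite [n.+1%:R ^+ m.+1]exprS mulrA /=.
  have c0 : 0 <= 6 * 2 ^+ m + 1 :> R by rewrite addr_ge0 ?mulr_ge0 ?exprn_ge0.
  apply: le_trans (ler_wpM2l c0 IH); rewrite mulrA; apply: ler_wpM2r => //.
have nXk k : nice (fun U => sqent i j U ^+ m * sqent k j U).
  by apply: niceM => //; exact: nice_sqent.
have tot : \sum_(k < n.+1) E (fun U => sqent i j U ^+ m * sqent k j U) =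
    E (fun U => sqent i j U ^+ m).
  rewrite -E_sum //; apply: E_eq => // [|U uU]; first exact: nice_sum.
  by rewrite -mulr_sumr sqent_sum // mulr1.
have pos k : 0 <= E (fun U => sqent i j U ^+ m * sqent k j U).
  by apply: expect_ge0 => U; rewrite mulr_ge0 ?exprn_ge0 ?sqent_ge0.
have c0 : 0 <= 6 * 2 ^+ m :> R by rewrite mulr_ge0 ?exprn_ge0.
have -> : E (fun U => sqent i j U ^+ m.+1) * n.+1%:R =
    \sum_(k < n.+1) E (fun U => sqent i j U ^+ m.+1).
  by rewrite sumr_const card_ord mulr_natr.
rewrite (bigD1 i) //= mulrDl mul1r addrC; apply: lerD; last first.
  apply: E_le => // U uU; rewrite exprSr -[X in _ <= X]mulr1.
  by apply: ler_wpM2l; [rewrite exprn_ge0 ?sqent_ge0|exact: sqent_le1].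
rewrite -tot mulr_sumr [X in _ <= X](bigD1 i) //=.
apply: (@le_trans _ _ (\sum_(k < n.+1 | k != i)
    6 * 2 ^+ m * E (fun U => sqent i j U ^+ m * sqent k j U))).
  by apply: ler_sum => k ki; apply: moment_two_rows; rewrite eq_sym.
by rewrite lerDr mulr_ge0.
Qed.

End Moments.

(** ** Expectations of monomials *)

Section Monomials.
Variables (R : realType) (n : nat).
Local Notation C := (Cplx R).
Local Notation M := (mxBorel R n.+1).
Variable mu : probability M R.
Hypothesis haar : is_haar mu.
Local Notation E := (expect mu).
Local Notation EC := (Cexpect mu).

Definition cnice (f : M -> C) :=
  cmeas f /\ exists K : R, forall U, uni U -> `|f U| <= K%:C%C.

Lemma cnice_Re f : cnice f -> nice (fun U => complex.Re (f U)).
Proof.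
move=> [[mf _] [K fK]]; split=> //; exists K => U /fK le.
by rewrite -(@lecR R); exact: le_trans (normRe_le _) le.
Qed.

Lemma cnice_Im f : cnice f -> nice (fun U => complex.Im (f U)).
Proof.
move=> [[_ mf] [K fK]]; split=> //; exists K => U /fK le.
by rewrite -(@lecR R); exact: le_trans (normIm_le _) le.
Qed.

Lemma cexpectE f : EC f = Complex (E (fun U => complex.Re (f U))) (E (fun U => complex.Im (f U))).
Proof. by []. Qed.

Lemma cexpect_eq f g : cnice f -> cnice g -> (forall U, uni U -> f U = g U) -> EC f = EC g.
Proof.
move=> fn gn fg; rewrite !cexpectE; congr Complex; apply: (E_eq haar).
- exact: cnice_Re.
- exact: cnice_Re.
- by move=> U uU; rewrite fg.
- exact: cnice_Im.
- exact: cnice_Im.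
- by move=> U uU; rewrite fg.
Qed.

Lemma cexpect_mulmx f (V : 'M[C]_n.+1) : V \is unitarymx -> cnice f ->
  EC (fun U : M => f (V *m U : M)) = EC f.
Proof.
move=> Vu fn; rewrite !cexpectE; congr Complex.
  exact: (E_mulmx haar Vu (cnice_Re fn)).
exact: (E_mulmx haar Vu (cnice_Im fn)).
Qed.

Lemma cnice_cst (c : C) : cnice (fun=> c).
Proof.
split; first exact: cmeas_cst.
exists (complex.Re `|c|) => U _; rewrite RRe_real //; exact: normr_real.
Qed.

Lemma cniceD f g : cnice f -> cnice g -> cnice (fun U => f U + g U).
Proof.
move=> [mf [K fK]] [mg [K' gK]]; split; first exact: cmeasD.
exists (K + K') => U uU; rewrite rmorphD; apply: le_trans (ler_normD _ _) _.
by apply: lerD; [exact: fK|exact: gK].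
Qed.

Lemma cniceM f g : cnice f -> cnice g -> cnice (fun U => f U * g U).
Proof.
move=> [mf [K fK]] [mg [K' gK]]; split; first exact: cmeasM.
exists (K * K') => U uU; rewrite rmorphM normrM.
by apply: ler_pM => //; [exact: fK|exact: gK].
Qed.

Lemma cnice_sum (I : Type) (s : seq I) (P : pred I) (f : I -> M -> C) :
  (forall i, cnice (f i)) -> cnice (fun U => \sum_(i <- s | P i) f i U).
Proof.
move=> hf; elim: s => [|i s IH].
  by under eq_fun do rewrite big_nil; exact: cnice_cst.
under eq_fun do rewrite big_cons; case: (P i) => //; exact: cniceD.
Qed.

Lemma cnice_prod (I : Type) (s : seq I) (f : I -> M -> C) :
  (forall i, cnice (f i)) -> cnice (fun U => \prod_(i <- s) f i U).
Proof.
move=> hf; elim: s => [|i s IH].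
  by under eq_fun do rewrite big_nil; exact: cnice_cst.
by under eq_fun do rewrite big_cons; exact: cniceM.
Qed.

Lemma cexpect_add f g : cnice f -> cnice g ->
  EC (fun U => f U + g U) = EC f + EC g.
Proof.
move=> fn gn; rewrite !cexpectE; apply/eqP; rewrite eq_complex /=.
rewrite -(E_add haar (cnice_Re fn) (cnice_Re gn)) -(E_add haar (cnice_Im fn) (cnice_Im gn)).
by apply/andP; split; apply/eqP; apply: expect_ext => U; rewrite ?cReD ?cImD.
Qed.

Lemma cexpect_scale (c : C) f : cnice f -> EC (fun U => c * f U) = c * EC f.
Proof.
move=> fn; have [fr fi] := (cnice_Re fn, cnice_Im fn).
rewrite !cexpectE; apply/eqP; rewrite eq_complex cReM cImM /=.
have sc (x : R) (g : M -> R) : nice g -> nice (fun U => x * g U).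
  by move=> gn; apply: niceM => //; exact: nice_cst.
rewrite -mulNr -!(E_scale haar) // -!(E_add haar); try exact: sc.
apply/andP; split; apply/eqP; apply: expect_ext => U; rewrite ?cReM ?cImM //.
by rewrite mulNr.
Qed.

Lemma cexpect_sum (I : Type) (s : seq I) (P : pred I) (f : I -> M -> C) :
  (forall i, cnice (f i)) ->
  EC (fun U => \sum_(i <- s | P i) f i U) = \sum_(i <- s | P i) EC (f i).
Proof.
move=> hf; elim: s => [|i s IH].
  have -> : (fun U : M => \sum_(i <- [::] | P i) f i U) = (fun=> 0).
    by apply/funext => U; rewrite big_nil.
  by rewrite big_nil cexpectE /= !E_cst.
have -> : (fun U : M => \sum_(i <- i :: s | P i) f i U) =
    (fun U => (if P i then f i U else 0) + \sum_(i <- s | P i) f i U).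
  by apply/funext => U; rewrite big_cons; case: (P i); rewrite ?add0r.
rewrite big_cons -IH; case: (P i).
  by rewrite cexpect_add //; exact: cnice_sum.
by congr Cexpect; apply/funext => U; rewrite add0r.
Qed.

(** The factor 2 comes from the separate treatment of the real and imaginary
    parts. *)
Lemma cexpect_le f g : cnice f -> nice g ->
  (forall U, uni U -> `|f U| <= (g U)%:C%C) -> `|EC f| <= (2 * E g)%:C%C.
Proof.
move=> fn gn fg; rewrite cexpectE.
have bnd h : nice h -> (forall U, uni U -> `|h U| <= g U) -> `|E h| <= E g.
  move=> hn hg; rewrite ler_norml; apply/andP; split.
    have ng : nice (fun U => -1 * g U) by apply: niceM => //; exact: nice_cst.
    rewrite -mulN1r -(E_scale haar) //; apply: (E_le haar) => // U /hg.
    by rewrite ler_norml mulN1r => /andP[].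
  by apply: (E_le haar) => // U /hg; rewrite ler_norml => /andP[].
have h1 : `|E (fun U => complex.Re (f U))| <= E g.
  apply: bnd; first exact: cnice_Re.
  by move=> U uU; rewrite -lecR; exact: le_trans (normRe_le _) (fg U uU).
have h2 : `|E (fun U => complex.Im (f U))| <= E g.
  apply: bnd; first exact: cnice_Im.
  by move=> U uU; rewrite -lecR; exact: le_trans (normIm_le _) (fg U uU).
set x := E _ in h1 *; set y := E _ in h2 *.
have -> : Complex x y = x%:C%C + 'i%C * y%:C%C :> C.
  apply/eqP; rewrite eq_complex cReD cImD cReM cImM /=.
  by apply/andP; split; apply/eqP; ring.
apply: le_trans (ler_normD _ _) _; rewrite normrM.
have nC (z : R) : `|z%:C%C : C| = `|z|%:C%C.
  by rewrite normc_def /= expr0n addr0 sqrtr_sqr.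
have -> : `|'i%C : C| = 1 by rewrite normc_def /= expr0n expr1n add0r sqrtr1.
rewrite mul1r !nC -rmorphD lecR mulrDl mul1r.
exact: lerD.
Qed.

Section Mono.
Variable Ed : finType.
Implicit Types (eps : Ed -> bool) (i j : Ed -> 'I_n.+1).

Definition mono_factor (b : bool) a a' (U : M) : C :=
  if b then ((U : 'M[C]_n.+1) a a')^* else (U : 'M[C]_n.+1) a a'.

Definition mono eps i j (U : M) : C := \prod_e mono_factor (eps e) (i e) (j e) U.

Lemma cnice_factor b a a' : cnice (mono_factor b a a').
Proof.
split.
  by rewrite /mono_factor; case: b; [apply: cmeas_conj|]; exact: cmeas_entry.
exists 1 => U uU; rewrite /mono_factor; case: b; rewrite ?norm_conjC;
  exact: unitary_entry_le.
Qed.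

Lemma cnice_mono eps i j : cnice (mono eps i j).
Proof. by apply: cnice_prod => e; exact: cnice_factor. Qed.

Lemma mono_mulmx eps i j (V U : 'M[C]_n.+1) : mono eps i j (V *m U) =
  \sum_(k : {ffun Ed -> 'I_n.+1}) mono eps i k V * mono eps k j U.
Proof.
rewrite /mono.
transitivity (\prod_e \sum_c mono_factor (eps e) (i e) c V * mono_factor (eps e) c (j e) U).
  apply: eq_bigr => e _; rewrite /mono_factor; case: (eps e); rewrite mxE //.
  by rewrite rmorph_sum; apply: eq_bigr => c _; rewrite rmorphM.
rewrite bigA_distr_bigA /=; apply: eq_bigr => k _.
by rewrite big_split.
Qed.

Lemma mono_adj eps i j (U : 'M[C]_n.+1) :
  mono eps i j (U^t*)%sesqui = mono (negb \o eps) j i U.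
Proof.
apply: eq_bigr => e _; rewrite /mono_factor /=; case: (eps e); rewrite !mxE //.
by rewrite conjCK.
Qed.

(** The inverse of a Haar unitary is Haar: average the monomials of W^* U over
    both U and W. Expanding the product separates U from W in a finite sum,
    which spares a double integral. *)
Lemma cexpect_mono_adj eps i j :
  EC (mono eps i j) = EC (mono (negb \o eps) j i).
Proof.
have unit_adj (W : 'M[C]_n.+1) : uni W -> (W^t*)%sesqui \is unitarymx.
  by rewrite trmxC_unitary.
have nn e i' j' : cnice (mono e i' j') by exact: cnice_mono.
have sep V : V \is unitarymx -> EC (mono eps i j) =
    \sum_(k : {ffun Ed -> 'I_n.+1}) mono eps i k V * EC (mono eps k j).
  move=> Vu; rewrite -(cexpect_mulmx Vu (nn _ _ _)).
  transitivity (EC (fun U => \sum_(k : {ffun Ed -> 'I_n.+1})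
      mono eps i k V * mono eps k j U)).
    by congr Cexpect; apply/funext => U; rewrite mono_mulmx.
  rewrite cexpect_sum; last by move=> k; apply: cniceM => //; exact: cnice_cst.
  by apply: eq_bigr => k _; rewrite cexpect_scale.
have sep' U : uni U -> EC (mono (negb \o eps) j i) =
    \sum_(k : {ffun Ed -> 'I_n.+1}) mono eps k j U * EC (mono (negb \o eps) k i).
  move=> uU; rewrite -(cexpect_mulmx (unit_adj U uU) (nn _ _ _)).
  transitivity (EC (fun W => \sum_(k : {ffun Ed -> 'I_n.+1})
      mono eps k j U * mono (negb \o eps) k i W)).
    congr Cexpect; apply/funext => W; rewrite -mono_adj.
    have -> : (((U^t*)%sesqui *m W)^t*)%sesqui = (W^t*)%sesqui *m U.
      apply/matrixP => a b; rewrite !mxE rmorph_sum; apply: eq_bigr => k _.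
      by rewrite !mxE rmorphM /= conjCK mulrC.
    by rewrite mono_mulmx; apply: eq_bigr => k _; rewrite mono_adj mulrC.
  rewrite cexpect_sum; last by move=> k; apply: cniceM => //; exact: cnice_cst.
  by apply: eq_bigr => k _; rewrite cexpect_scale.
have cst (c : C) : EC (fun=> c) = c.
  by rewrite cexpectE !E_cst //; case: c.
transitivity (\sum_(k : {ffun Ed -> 'I_n.+1})
    EC (mono (negb \o eps) k i) * EC (mono eps k j)).
  rewrite -[LHS]cst.
  rewrite (@cexpect_eq _ (fun W => \sum_(k : {ffun Ed -> 'I_n.+1})
      EC (mono eps k j) * mono (negb \o eps) k i W)).
  - rewrite cexpect_sum; last by move=> k; apply: cniceM => //; exact: cnice_cst.
    by apply: eq_bigr => k _; rewrite cexpect_scale // mulrC.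
  - exact: cnice_cst.
  - by apply: cnice_sum => k; apply: cniceM => //; exact: cnice_cst.
  - move=> W uW; rewrite (sep _ (unit_adj W uW)).
    by apply: eq_bigr => k _; rewrite mono_adj mulrC.
rewrite -[RHS]cst.
rewrite [RHS](@cexpect_eq _ (fun U => \sum_(k : {ffun Ed -> 'I_n.+1})
    EC (mono (negb \o eps) k i) * mono eps k j U)).
- rewrite cexpect_sum; last by move=> k; apply: cniceM => //; exact: cnice_cst.
  by apply: eq_bigr => k _; rewrite cexpect_scale.
- exact: cnice_cst.
- by apply: cnice_sum => k; apply: cniceM => //; exact: cnice_cst.
- move=> U uU; rewrite (sep' _ uU).
  by apply: eq_bigr => k _; rewrite mulrC.
Qed.

(** Multiplying the row r by a complex number z of modulus 1 multiplies the
    monomial by a power of z, and z is chosen so that this power is -1. *)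
Lemma cexpect_mono_row eps i j r :
  #|[set e | ~~ eps e && (i e == r)]%SET| != #|[set e | eps e && (i e == r)]%SET| ->
  EC (mono eps i j) = 0.
Proof.
set p := #|_|; set q := #|_| => pq.
(* A root of -1 of order |p - q|. *)
have [z zz1 zpq] : exists2 z : C, z * z^* = 1 & z ^+ p * z^* ^+ q = -1.
  pose d := maxn (p - q) (q - p).
  have d0 : (0 < d)%N by move: pq; rewrite /d neq_ltn; case/orP; lia.
  pose z : C := d.-root (-1).
  have zd : z ^+ d = -1 by exact: rootCK.
  have z1 : `|z| = 1.
    apply/eqP; rewrite -(pexpr_eq1 d0) // -normrX zd normrN1 //.
  have zz : z * z^* = 1 by rewrite -normCK z1 expr1n.
  exists z => //; have [qp|pq'] := leqP q p.
    rewrite -(subnK qp) exprD -mulrA -exprMn zz expr1n mulr1 -zd /d; congr (_ ^+ _); lia.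
  rewrite -(subnK (ltnW pq')) addnC [z^* ^+ _]exprD mulrA -exprMn zz expr1n mul1r.
  rewrite -rmorphXn /= (_ : (q - p)%N = d) ?zd ?rmorphN1 //; rewrite /d; lia.
pose V : 'M[C]_n.+1 := \matrix_(a, b) (if a == b then if a == r then z else 1 else 0).
have VU (U : 'M[C]_n.+1) a b : (V *m U) a b = (if a == r then z else 1) * U a b.
  rewrite mxE (bigD1 a) //= big1 ?addr0 => [|c ca]; first by rewrite mxE eqxx.
  by rewrite mxE eq_sym (negbTE ca) mul0r.
have Vu : V \is unitarymx.
  apply/unitarymxP/matrixP => a b; rewrite VU !mxE.
  have [->|ab] := eqVneq a b; last first.
    by rewrite conjC0 mulr0.
  by case: (b == r); rewrite ?zz1 ?conjC1 ?mulr1.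
have act U : mono eps i j (V *m U : 'M[C]_n.+1) = - mono eps i j U.
  rewrite /mono -mulN1r -zpq.
  have -> : z ^+ p * z^* ^+ q =
      \prod_e (if i e == r then if eps e then z^* else z else 1).
    rewrite /p /q -!prodr_const [RHS](bigID eps) /= [RHS]mulrC; congr (_ * _).
      rewrite [RHS]big_mkcond [LHS]big_mkcond /=; apply: eq_bigr => e _.
      by rewrite inE; case: (eps e); case: (i e == r).
    rewrite [RHS]big_mkcond [LHS]big_mkcond /=; apply: eq_bigr => e _.
    by rewrite inE; case: (eps e); case: (i e == r).
  rewrite -big_split /=; apply: eq_bigr => e _; rewrite /mono_factor !VU.
  by case: (eps e); case: (i e == r); rewrite ?rmorphM ?rmorph1 ?mul1r.
have : EC (mono eps i j) = - EC (mono eps i j).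
  rewrite -mulN1r -cexpect_scale; last exact: cnice_mono.
  rewrite -{1}(cexpect_mulmx Vu (cnice_mono _ _ _)).
  by congr Cexpect; apply/funext => U; rewrite act mulN1r.
move/eqP; rewrite -subr_eq0 opprK -mulr2n mulrn_eq0 /= => /eqP //.
Qed.

(** A product of 2k nonnegative numbers is at most the power 2k of the largest
    one, hence at most the sum of all these powers. *)
Lemma cexpect_mono_le k eps i j : #|Ed| = (k.*2)%N -> (0 < k)%N ->
  `|EC (mono eps i j)| * n.+1%:R ^+ k <= (2 * (k.*2)%:R * moment_cst R k)%:C%C.
Proof.
move=> cE k0.
pose g (U : M) : R := \sum_e sqent (i e) (j e) U ^+ k.
have gn : nice g by apply: nice_sum => e; apply: niceX; exact: nice_sqent.
have le U : uni U -> `|mono eps i j U| <= (g U)%:C%C.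
  move=> uU; rewrite /mono normr_prod.
  have fE e : `|mono_factor (eps e) (i e) (j e) U| = `|(U : 'M[C]_n.+1) (i e) (j e)|.
    by rewrite /mono_factor; case: (eps e); rewrite ?norm_conjC.
  under eq_bigr do rewrite fE.
  have [e0 _] : exists e0, e0 \in Ed by apply/card_gt0P; rewrite cE double_gt0.
  pose x e : R := Num.sqrt (sqent (i e) (j e) U).
  have xE e : `|(U : 'M[C]_n.+1) (i e) (j e)| = (x e)%:C%C by rewrite normc_def.
  have x0 e : 0 <= x e by exact: sqrtr_ge0.
  under eq_bigr do rewrite xE.
  rewrite -rmorph_prod lecR /g.
  pose em := [arg max_(e > e0) x e]%O.
  have xm e : x e <= x em by rewrite /em; case: arg_maxP => // m _; exact.
  have xk : x em ^+ k.*2 = sqent (i em) (j em) U ^+ k.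
    by rewrite -muln2 mulnC exprM sqr_sqrtr // sqent_ge0.
  apply: (@le_trans _ _ (x em ^+ k.*2)).
    by rewrite -cE -prodr_const; apply: ler_prod => e _; rewrite x0 xm.
  rewrite xk (bigD1 em) //= lerDl; apply: sumr_ge0 => e _.
  by rewrite exprn_ge0 // sqent_ge0.
have := cexpect_le (cnice_mono eps i j) gn le.
have N0 : 0 <= (n.+1%:R ^+ k : C) by rewrite exprn_ge0.
move/(ler_wpM2r N0) => h; apply: le_trans h _.
have -> : (n.+1%:R ^+ k : C) = (n.+1%:R ^+ k)%:C%C by rewrite rmorphXn /= rmorph_nat.
rewrite -rmorphM lecR -!mulrA; apply: ler_wpM2l => //.
rewrite (E_sum haar); last by move=> e; apply: niceX; exact: nice_sqent.
rewrite mulr_suml mulr_natl -cE -sumr_const.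
by apply: ler_sum => e _; exact: moment_le.
Qed.

End Mono.

End Monomials.

(** ** The limit of Haar unitary matrices *)

(** The label true stands for the adjoint: an edge contributes the entry of U
    whose row is the value at row_end, conjugated if the label is true. *)
Definition row_end (T : mgraph bool) (e : edg T) := if lab e then src e else tgt e.
Definition col_end (T : mgraph bool) (e : edg T) := if lab e then tgt e else src e.

Section InjTrace.
Variables (R : realType) (n : nat).
Local Notation C := (Cplx R).
Local Notation M := (mxBorel R n.+1).
Variable mu : probability M R.
Hypothesis haar : is_haar mu.
Local Notation EC := (Cexpect mu).

Definition graph_mono (T : tgraph bool) (phi : vtx T -> 'I_n.+1) : M -> C :=
  mono (fun e : edg T => lab e) (fun e => phi (row_end e)) (fun e => phi (col_end e)).

Definition inj_trace (T : tgraph bool) : C :=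
  n.+1%:R^-1 * \sum_(phi : {ffun vtx T -> 'I_n.+1} | injectiveb phi)
                 EC (graph_mono phi).

(** Sorting the maps by their kernels shows that the sums over injective maps
    are the injective version of the expected trace. *)
Lemma expected_trace (T : tgraph bool) :
  EC (mx_trace T) = \sum_(P : vpart (vtx T)) inj_trace (tquot P).
Proof.
have -> : mx_trace T = (fun U : M =>
    n.+1%:R^-1 * \sum_(phi : {ffun vtx T -> 'I_n.+1}) graph_mono phi U).
  apply/funext => U; rewrite /mx_trace; congr (_ * _); apply: eq_bigr => phi _.
  apply: eq_bigr => e _; rewrite /mono_factor /row_end /col_end.
  by case: (lab e); rewrite ?mxE.
have gn (phi : {ffun vtx T -> 'I_n.+1}) : cnice (graph_mono phi) by exact: cnice_mono.
rewrite cexpect_scale //; last by apply: cnice_sum => phi; exact: gn.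
rewrite cexpect_sum // (sum_maps (fun phi : {ffun vtx T -> 'I_n.+1} => EC (graph_mono phi))).
rewrite mulr_sumr; apply: eq_bigr => P _; rewrite /inj_trace; congr (_ * _).
apply: eq_bigr => iota _; congr Cexpect; apply/funext => U.
apply: eq_bigr => e _; rewrite /mono_factor /row_end /col_end /=.
by case: (lab e); rewrite !ffunE.
Qed.

Lemma inj_trace_iso : iso_invariant inj_trace.
Proof.
move=> T T' [f [k [[g fg gf] kb ks kt kl]]]; rewrite /inj_trace; congr (_ * _).
rewrite (reindex (fun phi : {ffun vtx T' -> 'I_n.+1} => [ffun x => phi (f x)])) /=.
  apply: eq_big => [phi|phi _].
    apply/injectiveP/injectiveP => inj x y; last by rewrite !ffunE => /inj/(can_inj fg).
    by move=> e; rewrite -(gf x) -(gf y); congr f; apply: inj; rewrite !ffunE !gf.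
  congr Cexpect; apply/funext => U; rewrite /graph_mono /mono [RHS](reindex k) /=.
    apply: eq_bigr => e _; rewrite /mono_factor /row_end /col_end kl ks kt.
    by case: (lab e); rewrite !ffunE.
  exact: onW_bij.
exists (fun phi : {ffun vtx T -> 'I_n.+1} => [ffun x => phi (g x)]) => phi _;
  by apply/ffunP => x; rewrite !ffunE ?gf ?fg.
Qed.

(** As phi is injective, the row phi v occurs exactly in the factors of the
    edges whose row_end is v. *)
Lemma inj_trace_row (T : tgraph bool) v :
  #|[set e : edg T | ~~ lab e && (tgt e == v)]%SET| !=
  #|[set e : edg T | lab e && (src e == v)]%SET| -> inj_trace T = 0.
Proof.
move=> ne; rewrite /inj_trace big1 ?mulr0 // => phi /injectiveP pi.
apply: (@cexpect_mono_row _ _ _ haar _ _ _ _ (phi v)); apply: contra ne => /eqP e.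
apply/eqP; etransitivity; last (etransitivity; first exact: e); last first.
  by apply: eq_card => d; rewrite !inE /row_end; case: (lab d); rewrite //= (inj_eq pi).
by apply: eq_card => d; rewrite !inE /row_end; case: (lab d); rewrite //= (inj_eq pi).
Qed.

Lemma inj_trace_col (T : tgraph bool) v :
  #|[set e : edg T | ~~ lab e && (src e == v)]%SET| !=
  #|[set e : edg T | lab e && (tgt e == v)]%SET| -> inj_trace T = 0.
Proof.
move=> ne; rewrite /inj_trace big1 ?mulr0 // => phi /injectiveP pi.
rewrite /graph_mono (cexpect_mono_adj haar).
apply: (@cexpect_mono_row _ _ _ haar _ _ _ _ (phi v)); apply: contra ne => /eqP e.
apply/eqP; apply/esym; etransitivity; last (etransitivity; first exact: e); last first.
  by apply: eq_card => d; rewrite !inE /col_end /=; case: (lab d); rewrite //= (inj_eq pi).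
by apply: eq_card => d; rewrite !inE /col_end /=; case: (lab d); rewrite //= (inj_eq pi).
Qed.

(** The sum has at most N^|V| terms of size O(N^-k), and |V| <= k; what
    remains is the factor 1 / N of the normalized trace. *)
Lemma inj_trace_le k (T : tgraph bool) : #|edg T| = (k.*2)%N -> (#|vtx T| <= k)%N ->
  `|inj_trace T| * n.+1%:R <= (2 * (k.*2)%:R * moment_cst R k)%:C%C.
Proof.
move=> cE Vk.
have V0 : (0 < #|vtx T|)%N by have /andP[] := tg_conn T.
set B := (2 * _ * _)%:C%C.
have N0 : 0 < n.+1%:R :> C by rewrite ltr0n.
have bnd (phi : {ffun vtx T -> 'I_n.+1}) : `|EC (graph_mono phi)| <= B / n.+1%:R ^+ #|vtx T|.
  rewrite ler_pdivlMr ?exprn_gt0 //.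
  have := cexpect_mono_le haar (fun e : edg T => lab e) (fun e => phi (row_end e))
    (fun e => phi (col_end e)) cE (leq_trans V0 Vk).
  apply: le_trans; apply: ler_wpM2l => //.
  by apply: ler_weXn2l => //; rewrite ler1n.
rewrite normrM normfV normr_nat mulrC mulrA divff ?gt_eqF // mul1r.
apply: le_trans (ler_norm_sum _ _ _) _.
apply: (@le_trans _ _ (\sum_(phi : {ffun vtx T -> 'I_n.+1}) B / n.+1%:R ^+ #|vtx T|)).
  rewrite big_mkcond /=; apply: ler_sum => phi _; case: ifP => _; first exact: bnd.
  exact: le_trans (normr_ge0 _) (bnd phi).
rewrite sumr_const card_ffun card_ord -[X in X <= _]mulr_natr natrX divfK //.
Qed.

End InjTrace.

Lemma cvg_bigsum (K : numFieldType) (I : Type) (s : seq I) (P : pred I)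
    (f : I -> nat -> K) (l : I -> K) :
  (forall i, P i -> f i @ \oo --> l i) ->
  (fun n => \sum_(i <- s | P i) f i n) @ \oo --> \sum_(i <- s | P i) l i.
Proof.
move=> fl; elim: s => [|i s IH].
  by rewrite big_nil; under eq_fun do rewrite big_nil; exact: cvg_cst.
rewrite big_cons; under eq_fun do rewrite big_cons.
by case: ifP => // Pi; apply: cvgD => //; exact: fl.
Qed.

Section HaarLimit.
Variables (R : realType) (A : traffic_space R) (u us : A).
Hypothesis lim : haar_limit u us.
Variable tau0 : tgraph A -> Cplx R.
Hypothesis t0P : injective_version tau0.

Definition uvar (b : bool) : A := if b then us else u.

(** The injective traces converge to tau0, by induction on the number of
    vertices. They vanish on unbalanced graphs, and those of the graphs with
    |V| <= |E| / 2 are of order 1 / N. *)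
Lemma haar_tau0_support (T : tgraph bool) : tau0 (tmap uvar T) != 0 ->
  [/\ forall v, #|[set e : edg T | ~~ lab e && (tgt e == v)]%SET| =
                #|[set e : edg T | lab e && (src e == v)]%SET|,
      forall v, #|[set e : edg T | ~~ lab e && (src e == v)]%SET| =
                #|[set e : edg T | lab e && (tgt e == v)]%SET| &
      (#|edg T| + 2 <= 2 * #|vtx T|)%N].
Proof.
case: lim => mu haar cv t0N.
have {}cv (T' : tgraph bool) :
    (fun n => inj_trace (mu n) T') @ \oo --> tau0 (tmap uvar T').
  have [m] := ubnP #|vtx T'|; elim: m T' => // m IH T' lt.
  have [t0i t0E] := t0P.
  have -> : (fun n => inj_trace (mu n) T') = (fun n => Cexpect (mu n) (mx_trace T') -
      \sum_(P : vpart (vtx T') | (#|{: part_block P}| < #|vtx T'|)%N)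
        inj_trace (mu n) (tquot P)).
    apply/funext => n; rewrite expected_trace ?sum_quotients_split ?addrK //.
    exact: inj_trace_iso.
  have -> : tau0 (tmap uvar T') = tau (tmap uvar T') -
      \sum_(P : vpart (vtx T') | (#|{: part_block P}| < #|vtx T'|)%N)
        tau0 (tmap uvar (tquot P)).
    rewrite t0E sum_quotients_split // -addrA -[LHS]addr0; congr (_ + _).
    apply/esym/eqP; rewrite subr_eq0; apply/eqP; apply: eq_bigr => P _.
    by apply: t0i; exists id, id; split=> //; exists id.
  apply: cvgB; first exact: cv.
  by apply: cvg_bigsum => P ltP; apply: IH; exact: leq_trans ltP lt.
have uniq0 : (forall n, inj_trace (mu n) T = 0) -> False.
  move=> h; move/eqP: t0N; apply.
  have := cv T; under eq_fun do rewrite h.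
  move=> c0; apply/esym; apply: (cvg_unique _ (cvg_cst 0) c0).
  exact: norm_hausdorff.
have row v : #|[set e : edg T | ~~ lab e && (tgt e == v)]%SET| =
             #|[set e : edg T | lab e && (src e == v)]%SET|.
  by apply/eqP; apply: contrapT => /negP ne; apply: uniq0 => n; exact: inj_trace_row ne.
have col v : #|[set e : edg T | ~~ lab e && (src e == v)]%SET| =
             #|[set e : edg T | lab e && (tgt e == v)]%SET|.
  by apply/eqP; apply: contrapT => /negP ne; apply: uniq0 => n; exact: inj_trace_col ne.
split=> //; rewrite leqNgt; apply/negP => big.
pose k := #|[set e : edg T | lab e]%SET|.
have cE : #|edg T| = (k.*2)%N.
  have part (p : pred (edg T)) (f : edg T -> vtx T) :
      #|[set e | p e]%SET| = (\sum_v #|[set e | p e && (f e == v)]%SET|)%N.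
    rewrite -sum1_card (partition_big f predT) //=; apply: eq_bigr => v _.
    by rewrite -sum1_card; apply: eq_bigl => e; rewrite !inE.
  rewrite -cardsT -(cardsID [set e | lab e]%SET) finset.setTI -addnn; congr addn.
  have -> : ([set: edg T] :\: [set e | lab e] = [set e | ~~ lab e])%SET.
    by apply/setP => e; rewrite !inE andbT.
  rewrite /k (part _ (fun e => tgt e)) (part lab (fun e => src e)).
  by apply: eq_bigr => v _; exact: row.
have Vk : (#|vtx T| <= k)%N by rewrite cE in big; lia.
pose B := 2 * (k.*2)%:R * moment_cst R k.
have le n := inj_trace_le (haar n) cE Vk.
set l := tau0 _ in t0N cv.
have l0 : 0 < `|tau0 (tmap uvar T)| by rewrite normr_gt0.
have [r rE] : exists r : R, `|tau0 (tmap uvar T)| = r%:C%C.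
  by exists (complex.Re `|tau0 (tmap uvar T)|); rewrite RRe_real // normr_real.
have r0 : 0 < r by rewrite -(@ltcR R) -rE.
have := cv T; move/cvgrPdist_lt => /(_ (`|tau0 (tmap uvar T)| / 2)).
rewrite divr_gt0 // => /(_ isT)[N0 _ hN].
pose n := maxn N0 (Num.bound (2 * B / r)).
have := hN n (leq_maxl _ _); rewrite /= => dist.
have big1 : `|tau0 (tmap uvar T)| / 2 <= `|inj_trace (mu n) T|.
  have := ler_distD (inj_trace (mu n) T) (tau0 (tmap uvar T)) 0.
  rewrite !subr0 => h; rewrite -(lerD2l (`|tau0 (tmap uvar T)| / 2)) -splitr.
  by apply: le_trans h _; rewrite lerD2r; exact: ltW.
suff lt : B%:C%C < `|inj_trace (mu n) T| * n.+1%:R.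
  by have := le_lt_trans (le n) lt; rewrite ltxx.
apply: (@lt_le_trans _ _ (`|tau0 (tmap uvar T)| / 2 * n.+1%:R)); last first.
  by apply: ler_wpM2r big1; rewrite ler0n.
rewrite rE (_ : r%:C%C / 2 * n.+1%:R = (r / 2 * n.+1%:R)%:C%C :> Cplx R); last first.
  by rewrite !rmorphM fmorphV !rmorph_nat.
rewrite ltcR -/B -ltr_pdivrMl; last by rewrite divr_gt0.
have -> : (r / 2)^-1 * B = 2 * B / r by rewrite invfM invrK; ring.
apply: lt_le_trans (archi_boundP _) _.
  rewrite divr_ge0 ?(ltW r0) // mulr_ge0 // /B mulr_ge0 // ?mulr_ge0 //.
  elim: (k) => [|k' IH] //=; rewrite mulr_ge0 // addr_ge0 // mulr_ge0 // exprn_ge0 //.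
by rewrite ler_nat; apply: leq_trans (leq_maxr N0 _) _; exact: leqnSn.
Qed.

End HaarLimit.

(** * Unitarily invariant families *)

Section ComponentFacts.
Variables (X : Type) (I : eqType) (col : X -> I) (T : tgraph X).

Lemma card_sub_edges (S : {set edg T}) (p : pred (edg T)) :
  (forall e, p e -> e \in S) ->
  #|[set d : edg (msub S) | p (val d)]%SET| = #|[set e | p e]%SET|.
Proof.
move=> pS; rewrite -(card_imset _ val_inj); apply: eq_card => e; rewrite [RHS]inE.
apply/imsetP/idP => [[d]|pe]; first by rewrite inE => pd ->.
by exists (exist _ e (pS e pe)); rewrite ?inE.
Qed.

(** A component contains all the edges of its color at its vertices: edges of
    a given color at v can be counted inside one component. *)
Lemma local_count (v : vtx T) (c : I) (p q : pred (edg T)) :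
  (forall e, p e || q e -> col (lab e) = c /\ touch e v) ->
  (forall S : component col T, (exists2 e, e \in val S & col (lab e) = c) ->
     forall v' : vtx (msub (val S)), val v' = v ->
     #|[set d : edg (msub (val S)) | p (val d)]%SET| =
     #|[set d : edg (msub (val S)) | q (val d)]%SET|) ->
  #|[set e | p e]%SET| = #|[set e | q e]%SET|.
Proof.
move=> pq h; have [[e0 pqe]|none] := pselect (exists e, p e || q e); last first.
  have z (r : pred (edg T)) : (forall e, r e -> p e || q e) -> #|[set e | r e]%SET| = 0%N.
    move=> rpq; apply/eqP; rewrite cards_eq0; apply/eqP/setP => e; rewrite !inE.
    by apply/negP => re; apply: none; exists e; exact: rpq.
  by rewrite !z // => e ->; rewrite ?orbT.
have [ce te] := pq _ pqe.
pose S : component col T := exist _ (cls col e0) (components_cls col e0).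
have vS : v \in sub_vtx (val S) by apply/sub_vtxP; exists e0 => //; exact: mem_cls.
have inS e : p e || q e -> e \in val S.
  move=> /pq[cd td]; apply: (component_star (components_cls col e0) (mem_cls col e0) _ te td).
  by rewrite ce cd.
rewrite -(card_sub_edges (S := val S)) => [|e pe]; last by apply: inS; rewrite pe.
rewrite -[RHS](card_sub_edges (S := val S)) => [|e qe]; last by apply: inS; rewrite qe orbT.
apply: h (exist _ v vS) _ => //.
by exists e0; [exact: mem_cls|].
Qed.

(** Another edge of color c has to leave the target of e, and it can only be e
    itself. *)
Lemma single_edge_loop (c : I) (S : component col T) e :
  (forall v, #|[set e : edg T | (col (lab e) == c) && (tgt e == v)]%SET| =
             #|[set e : edg T | (col (lab e) == c) && (src e == v)]%SET|) ->
  e \in val S -> col (lab e) = c -> (#|val S| <= 1)%N -> src e = tgt e.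
Proof.
move=> bal eS ce S1.
have : (0 < #|[set d : edg T | (col (lab d) == c) && (src d == tgt e)]%SET|)%N.
  by rewrite -bal; apply/card_gt0P; exists e; rewrite inE ce !eqxx.
case/card_gt0P => d; rewrite inE => /andP[/eqP cd /eqP sd].
have dS : d \in val S.
  apply: (component_star (valP S) eS _ (touch_tgt e)); first by rewrite ce cd.
  by rewrite /touch sd eqxx.
by have /card_le1_eqP/(_ _ _ dS eS) de := S1; rewrite [in LHS]de.
Qed.

Lemma tau0_single_loop (R : realType) (A : traffic_space R) (tau0 : tgraph A -> Cplx R)
    (ev : X -> A) (S : component col T) e : injective_version tau0 ->
  e \in val S -> (#|val S| <= 1)%N -> src e = tgt e ->
  tau0 (tmap ev (component_graph S)) = traffic_trace (ev (lab e)).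
Proof.
move=> t0P eS S1 st.
have eq_e d : d \in val S -> d = e by move=> dS; have /card_le1_eqP := S1; exact.
have oS : one_vertex (component_graph S).
  have vE (x : vtx (component_graph S)) : val x = src e.
    by have /sub_vtxP[d /eq_e ->] := valP x; case/orP => /eqP ->.
  by move=> x y; apply: val_inj; rewrite !vE.
rewrite tau0_one_vertex // /traffic_trace; apply: tau_iso.
apply: (@one_vertex_tiso _ (tmap ev (component_graph S)) (loop_graph (ev (lab e))) (fun=> tt)) => //.
- by move=> [] [].
- by exists (fun=> exist _ e eS) => [[d dS]|[]] //; apply: val_inj; rewrite /= (eq_e d dS).
- by move=> [d dS]; rewrite /= (eq_e d dS).
Qed.

End ComponentFacts.

Section Enlargement.
Variables (R : realType) (A A' : traffic_space R) (f : A -> A').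
Hypothesis fE : enlargement f.

Lemma enl_lin (c : Cplx R) x y : f (c *: x + y) = c *: f x + f y.
Proof. by case: fE. Qed.

Lemma enl0 : f 0 = 0.
Proof.
by have := enl_lin (- 1) 0 0; rewrite scaler0 addr0 scaleN1r addNr.
Qed.

Lemma enl_gmul x y : f (gmul x y) = gmul (f x) (f y).
Proof.
case: fE => _ _ fg _; rewrite /gmul fg; apply: gact_iso.
by exists id, id; split=> //; split=> //; try (by exists id); case.
Qed.

Lemma enl_gone : f (gone A) = gone A'.
Proof.
case: fE => _ _ fg _; rewrite /gone fg; apply: gact_iso.
by exists id, id; split=> //; split=> //; try (by exists id); case.
Qed.

Lemma enl_trace x : traffic_trace (f x) = traffic_trace x.
Proof.
case: fE => _ _ _ ft; rewrite /traffic_trace -ft; apply: tau_iso.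
by exists id, id; split=> //; exists id.
Qed.

End Enlargement.

Section Invariant.
Variables (R : realType) (A A' : traffic_space R) (K : Type) (a : K -> A).
Variables (f : A -> A') (u us : A').
Hypothesis fE : enlargement f.
Hypotheses (uus : gmul u us = gone A') (usu : gmul us u = gone A').
Hypothesis inv : forall T : tgraph K, tau (tmap (f \o a) T) =
  tau (tmap (fun j => gmul (gmul u (f (a j))) us) T).

(** As us is the inverse of u, this is a morphism of algebras: invariance
    extends from the family to the algebra that it generates. *)
Definition conj_u (x : A) : A' := gmul (gmul u (f x)) us.

Lemma conj_u_lin (c : Cplx R) x y : conj_u (c *: x + y) = c *: conj_u x + conj_u y.
Proof. by rewrite /conj_u (enl_lin fE) gmul_linr gmul_linl. Qed.

Lemma conj_uM x y : conj_u (gmul x y) = gmul (conj_u x) (conj_u y).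
Proof.
rewrite /conj_u (enl_gmul fE) !gmulA; congr (gmul (gmul _ _) _).
by rewrite -[in RHS](gmulA _ us u) usu gmulg1.
Qed.

Lemma conj_u1 : conj_u (gone A) = gone A'.
Proof. by rewrite /conj_u (enl_gone fE) gmulg1. Qed.

Lemma conj_u_gprod n (b : 'I_n -> A) : conj_u (gprod b) = gprod (conj_u \o b).
Proof. by rewrite /gprod (big_morph conj_u conj_uM conj_u1). Qed.

Definition words1 : set A :=
  [set x | exists n (w : 'I_n -> K), x = gact (path_op (a \o w))].

Lemma gen_words1 : smallest (@is_subalgebra R A) (range a) `<=` lin_span words1.
Proof.
apply: smallest_sub; last first.
  move=> _ [j _ <-]; apply: sub_lin_span; exists 1%N, (fun=> j).
  by rewrite gact_path1.
split; last first.
  apply: sub_lin_span; exists 0%N, (fun i : 'I_0 => match notF (ltn_ord i) with end).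
  by rewrite gact_path0.
apply: nusubalgebra_span => x y [m [v ->]] [n [w ->]].
exists (m + n)%N, (catf v w); rewrite gmul_path; congr (gact (path_op _)).
by apply/funext => i; rewrite /catf /=; case: fintype.splitP.
Qed.

(** A product of elements of the family is an operation on a path; flattening
    reduces to labels in the family, on both sides. *)
Lemma tau_conj_words (T : tgraph A) : (forall e : edg T, words1 (lab e)) ->
  tau T = tau (tmap conj_u T).
Proof.
move=> hT.
have ch (e : edg T) : exists p : {n : nat & 'I_n -> K},
    lab e = gact (path_op (a \o tagged p)).
  by have [n [w ew]] := hT e; exists (existT (fun n => 'I_n -> K) n w).
have [p pE] := choice ch.
pose T1 := @trelab _ (gop K) T (fun e => path_op (tagged (p e))).
have id_path (B : galgebra R) n (h : K -> B) (w : 'I_n -> K) :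
    gact (gmap h (path_op w)) = gact (path_op (h \o w)).
  by apply: gact_iso; exists id, id; split=> //; split=> //; exists id.
case: (fE) => _ _ _ ftau.
transitivity (tau (tmap gact (tmap (gmap a) T1))).
  apply: tau_iso; exists id, id; split=> //; try by exists id.
  by move=> e; rewrite [RHS]pE; exact: id_path.
rewrite tau_flatten_map -ftau -[LHS]/(tau (tmap (f \o a) (tflatten T1))) inv.
rewrite -[LHS]/(tau (tmap (conj_u \o a) (tflatten T1))) -tau_flatten_map.
apply: tau_iso; exists id, id; split=> //; try by exists id.
move=> e; rewrite /= [in LHS]pE id_path -!gprod_path conj_u_gprod.
by [].
Qed.

Lemma tau_conj (T : tgraph A) :
  (forall e : edg T, smallest (@is_subalgebra R A) (range a) (lab e)) ->
  tau T = tau (tmap conj_u T).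
Proof.
move=> hT.
have idT : tau T = tau (trelab (@lab _ T)).
  by apply: tau_iso; exists id, id; split=> //; exists id.
have idT' : tau (tmap conj_u T) = tau (tmap conj_u (trelab (@lab _ T))).
  by apply: tau_iso; exists id, id; split=> //; exists id.
rewrite idT idT'.
apply: (@multilinear_ext R A (edg T) (fun l => tau (@trelab A A T l))
  (fun l => tau (tmap conj_u (@trelab A A T l))) words1) (@lab _ T) _ => //.
- exact: tau_multilinear.
- move=> l e c x y.
  have E (z : A) : tau (tmap conj_u (@trelab A A T [eta l with e |-> z])) =
      tau (@trelab A A' T [eta (conj_u \o l) with e |-> conj_u z]).
    apply: tau_iso; exists id, id; split=> //; try by exists id.
    by move=> d /=; case: eqP.
  rewrite !E conj_u_lin.
  exact: (@tau_linear _ _ (@trelab A A' T (conj_u \o l)) e c).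
- by move=> l hl; exact: (@tau_conj_words (trelab l)).
- by move=> e; exact: gen_words1.
Qed.

End Invariant.

(** Graphs labeled by u, by its adjoint us and by a second family f. The color
    of a label is true for u and us, and all colored components have a nonzero
    tau0: the restrictions of the Haar case hold in each component, and its
    balance conditions globally. *)
Section HaarComponents.
Variables (R : realType) (A : traffic_space R) (u us : A) (lim : haar_limit u us).
Variables (tau0 : tgraph A -> Cplx R) (t0P : injective_version tau0).
Variables (Z : Type) (f : Z -> A).

Definition conj_ev (x : bool + Z) : A :=
  match x with inl b => uvar u us b | inr y => f y end.

Local Notation col := (@tag bool (fun=> (bool + Z)%type)).

Definition is_var (b : bool) (x : {_ : bool & (bool + Z)%type}) : bool :=
  match tagged x with inl b' => b' == b | inr _ => false end.

Variable T : tgraph {_ : bool & (bool + Z)%type}.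
Hypothesis colT : forall e : edg T, col (lab e) = is_var false (lab e) || is_var true (lab e).
Hypothesis nz : forall C : component col T,
  tau0 (tmap (fun x => conj_ev (tagged x)) (component_graph C)) != 0.

Lemma haar_component (C : component col T) d : d \in val C -> col (lab d) ->
  [/\ forall v : vtx (component_graph C),
      #|[set e : edg (component_graph C) | is_var false (lab e) && (tgt e == v)]%SET| =
      #|[set e : edg (component_graph C) | is_var true (lab e) && (src e == v)]%SET|,
      forall v : vtx (component_graph C),
      #|[set e : edg (component_graph C) | is_var false (lab e) && (src e == v)]%SET| =
      #|[set e : edg (component_graph C) | is_var true (lab e) && (tgt e == v)]%SET| &
      (#|val C| + 2 <= 2 * #|sub_vtx (val C)|)%N].
Proof.
move=> dC cd; rewrite -card_component_vtx -card_component_edg.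
have colC (e : edg (component_graph C)) : is_var false (lab e) || is_var true (lab e).
  by rewrite -colT (component_col (valP C) (valP e) dC).
have fE (e : edg (component_graph C)) : is_var false (lab e) = ~~ is_var true (lab e).
  by have := colC e; rewrite /is_var; case: (tagged (lab e)) => [[]|].
pose Tb := @trelab _ bool (component_graph C) (fun e => is_var true (lab e)).
have nzb : tau0 (tmap (uvar u us) Tb) != 0.
  have := nz C; congr (_ != _); case: t0P => ti _; apply: ti.
  exists id, id; split=> //; try by exists id.
  by move=> e /=; have := colC e; rewrite /is_var /=; case: (tagged _) => [[]|].
have [r c le] := haar_tau0_support lim t0P nzb.
split=> // v; [have := r v|have := c v]; congr (_ = _); apply: eq_card => e;
  by rewrite !inE fE.
Qed.

Lemma haar_row (v : vtx T) :
  #|[set d : edg T | is_var false (lab d) && (tgt d == v)]%SET| =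
  #|[set d : edg T | is_var true (lab d) && (src d == v)]%SET|.
Proof.
apply: (@local_count _ _ col T v true (fun d => is_var false (lab d) && (tgt d == v))
  (fun d => is_var true (lab d) && (src d == v))).
  by move=> d; rewrite colT; case/orP => /andP[-> /eqP <-]; rewrite ?orbT.
move=> C [d dC cd] v' vv; have [r _ _] := haar_component dC cd.
by have := r v'; congr (_ = _); apply: eq_card => e; rewrite !inE -vv -val_eqE.
Qed.

Lemma haar_column (v : vtx T) :
  #|[set d : edg T | is_var false (lab d) && (src d == v)]%SET| =
  #|[set d : edg T | is_var true (lab d) && (tgt d == v)]%SET|.
Proof.
apply: (@local_count _ _ col T v true (fun d => is_var false (lab d) && (src d == v))
  (fun d => is_var true (lab d) && (tgt d == v))).
  by move=> d; rewrite colT; case/orP => /andP[-> /eqP <-]; rewrite ?orbT.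
move=> C [d dC cd] v' vv; have [_ c _] := haar_component dC cd.
by have := c v'; congr (_ = _); apply: eq_card => e; rewrite !inE -vv -val_eqE.
Qed.

End HaarComponents.

Section InvariantSupport.
Variables (R : realType) (A A' : traffic_space R) (K : Type) (a : K -> A).
Variables (f : A -> A') (u us : A').
Hypothesis fE : enlargement f.
Hypotheses (uus : gmul u us = gone A') (usu : gmul us u = gone A').
Hypothesis inv : forall T : tgraph K, tau (tmap (f \o a) T) =
  tau (tmap (fun j => gmul (gmul u (f (a j))) us) T).

Local Notation D := (smallest (@is_subalgebra R A) (range a)).

Local Notation ev := (fun x : {_ : bool & (bool + A)%type} => conj_ev u us f (tagged x)).

Definition conj_lab (S : mgraph A) (e : edg S) (j : 'I_3) : {_ : bool & (bool + A)%type} :=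
  match val j with
  | 0%N => existT _ true (inl false)
  | 1%N => existT _ false (inr (lab e))
  | _ => existT _ true (inl true) end.

(** Every edge labeled by x is replaced by a path u x us. *)
Definition conj_graph (S : tgraph A) := sub3_graph (@conj_lab S).

Lemma tau_conj_graph (S : tgraph A) : (forall e : edg S, D (lab e)) ->
  tau S = tau (tmap ev (conj_graph S)).
Proof.
move=> hS; rewrite (tau_conj fE uus usu inv) //.
have [g [k [gb kb ks kt kl]]] := flatten_sub3 (@conj_lab S).
transitivity (tau (tmap ev (tflatten (sub3_ops (@conj_lab S))))); last first.
  by apply: tau_iso; exists g, k; split=> // e; exact: (congr1 ev (kl e)).
rewrite -tau_flatten_map; apply: tau_iso; exists id, id; split=> //; try by exists id.
move=> e /=.
have -> : gact (gmap ev (path_op (@conj_lab S e))) =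
    gact (path_op (ev \o @conj_lab S e)).
  by apply: gact_iso; exists id, id; split=> //; split=> //; exists id.
rewrite -gprod_path /gprod !big_ord_recl big_ord0 gmulg1.
by rewrite gmulA /conj_u.
Qed.

Variable tau0' : tgraph A' -> Cplx R.
Hypothesis t0P' : injective_version tau0'.

Definition conj_tau0 (G : tgraph {_ : bool & (bool + A)%type}) : Cplx R :=
  tau0' (tmap ev G).

Lemma conj_tau0_iso : iso_invariant conj_tau0.
Proof.
move=> T T' [g [k [gb kb ks kt kl]]]; case: t0P' => ti _; apply: ti.
by exists g, k; split=> // e; exact: (congr1 ev (kl e)).
Qed.

Definition join_map (V E M : finType) (iota : {ffun V -> M}) (chi : {ffun E -> M}) :
    {ffun V + E -> M} :=
  [ffun x => match x with inl v => iota v | inr e => chi e end].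

Lemma sum_join_map (V E M : finType) (g : {ffun V + E -> M} -> Cplx R) :
  \sum_phi g phi = \sum_(iota : {ffun V -> M}) \sum_(chi : {ffun E -> M}) g (join_map iota chi).
Proof.
rewrite pair_big /= (reindex (fun p : {ffun V -> M} * {ffun E -> M} => join_map p.1 p.2)) //.
exists (fun phi : {ffun V + E -> M} => ([ffun v => phi (inl v)], [ffun e => phi (inr e)])).
  move=> [i c] _ /=; congr pair; apply/ffunP => x; by rewrite !ffunE.
by move=> phi _; apply/ffunP => -[x|x]; rewrite !ffunE.
Qed.

Definition conj_weight (M : finType) (S : tgraph A) (iota : {ffun vtx S -> M})
    (chi : {ffun edg S * bool -> M}) : Cplx R :=
  let phi : vtx (conj_graph S) -> M := join_map iota chi in
  (#|M| ^_ #|codom phi|)%:R^-1 * conj_tau0 (timg phi).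

(** The part of the sum over the quotients of the conjugated graph which does
    not identify vertices of S, written with maps to M that are injective on
    the vertices of S and arbitrary on the inner vertices of the paths. *)
Definition conj_inj (M : finType) (S : tgraph A) : Cplx R :=
  \sum_(iota : {ffun vtx S -> M} | injectiveb iota)
    \sum_(chi : {ffun edg S * bool -> M}) conj_weight iota chi.

Lemma conj_weight_quotient (M : finType) (S S' : tgraph A) (q : vtx S -> vtx S')
    (k : edg S -> edg S') (iota : {ffun vtx S' -> M})
    (chi : {ffun edg S' * bool -> M}) : @is_quotient A S S' q k ->
  conj_weight [ffun x => iota (q x)] [ffun p => chi (k p.1, p.2)] = conj_weight iota chi.
Proof.
move=> [qs [k' kK kK'] ks kt kl].
rewrite /conj_weight; set phi : vtx (conj_graph S) -> M := join_map _ _.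
set phi' : vtx (conj_graph S') -> M := join_map _ _.
have cc : codom phi =i codom phi'.
  move=> y; apply/codomP/codomP => -[x ->].
    case: x => [x|[e b]]; [exists (inl (q x))|exists (inr (k e, b))];
    by rewrite /phi /phi' !ffunE.
  case: x => [x|[e b]]; first by have [z <-] := qs x; exists (inl z); rewrite /phi /phi' !ffunE.
  by exists (inr (k' e, b)); rewrite /phi /phi' !ffunE /= kK'.
rewrite (eq_card cc); congr (_ * _); apply: conj_tau0_iso.
refine (@timg_iso _ (conj_graph S) (conj_graph S') _ phi phi' (fun d : edg (conj_graph S) => (k d.1, d.2)) _ _ _ _ _) => //.
- by exists (fun d => (k' d.1, d.2)) => -[e j] /=; rewrite ?kK ?kK'.
- by move=> [e [[|[|[|//]]] lj]]; rewrite /phi /phi' /= /sub3_src /= !ffunE ?ks.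
- by move=> [e [[|[|[|//]]] lj]]; rewrite /phi /phi' /= /sub3_tgt /= !ffunE ?kt.
- by move=> [e j]; rewrite /= /conj_lab /= kl.
Qed.

Lemma conj_inj_iso (M : finType) : iso_invariant (@conj_inj M).
Proof.
move=> S S' [g [k [[g' gK gK'] kb ks kt kl]]].
have [k' kK kK'] := kb.
rewrite /conj_inj (reindex (fun iota : {ffun vtx S' -> M} => [ffun x => iota (g x)])); last first.
  exists (fun iota : {ffun vtx S -> M} => [ffun x => iota (g' x)]) => iota _;
  by apply/ffunP => x; rewrite !ffunE ?gK ?gK'.
apply: eq_big => [iota|iota _].
  apply/injectiveP/injectiveP => ii x y e.
    by rewrite -(gK' x) -(gK' y); congr g; apply: ii; rewrite !ffunE !gK'.
  by apply: (can_inj gK); apply: ii; move: e; rewrite !ffunE.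
rewrite (reindex (fun chi : {ffun edg S' * bool -> M} => [ffun p => chi (k p.1, p.2)])); last first.
  exists (fun chi : {ffun edg S * bool -> M} => [ffun p => chi (k' p.1, p.2)]) => chi _;
  by apply/ffunP => -[x b]; rewrite !ffunE /= ?kK ?kK'.
apply: eq_bigr => chi _; apply: conj_weight_quotient => //; split=> //.
by move=> y; exists (g' y).
Qed.

(** Sorting the maps by the kernel of their restriction to the vertices of S. *)
Lemma sum_conj_inj (M : finType) (S : tgraph A) : (#|vtx (conj_graph S)| <= #|M|)%N ->
  \sum_(P : vpart (vtx S)) conj_inj M (tquot P) =
  \sum_(P : vpart (vtx (conj_graph S))) conj_tau0 (tquot P).
Proof.
move=> le; rewrite (sum_quotients_maps conj_tau0_iso le).
rewrite (@sum_join_map (vtx S) (edg S * bool)%type M) sum_maps; apply: eq_bigr => P _.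
apply: eq_bigr => iota _; apply: eq_bigr => chi _.
rewrite -/(conj_weight _ _) -(conj_weight_quotient _ _ (tquot_quotient P)).
congr conj_weight; apply/ffunP => x; rewrite !ffunE //.
by case: x.
Qed.

(** Both sides have the same sums over the quotients of S, namely tau S. The
    set M has to be the same for all graphs of the induction, and large enough
    for S. *)
Lemma tau0_conj (tau0 : tgraph A -> Cplx R) (S : tgraph A) : injective_version tau0 ->
  (forall e : edg S, D (lab e)) -> tau0 S = conj_inj (vtx (conj_graph S)) S.
Proof.
move=> [t0i t0E]; set M := vtx _ => hS.
pose DD (T : tgraph A) := (forall e : edg T, D (lab e)) /\ (#|vtx (conj_graph T)| <= #|M|)%N.
apply: (@injective_version_unique _ _ DD) => //.
- move=> T [hT le] P; split=> //; apply: leq_trans le.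
  by rewrite !card_sum leq_add2r; exact: card_part_block.
- exact: conj_inj_iso.
- move=> T [hT le]; rewrite -t0E tau_conj_graph // sum_conj_inj //.
  case: t0P' => ti tE; rewrite tE; apply: eq_bigr => P _.
  by apply: ti; exists id, id; split=> //; exists id.
Qed.

End InvariantSupport.

Section SupportOfInvariantFamilies.
Variables (R : realType) (A : traffic_space R) (K : Type) (a : K -> A).

(** If tau0 S does not vanish, some quotient T of the conjugated graph
    contributes, in which the vertices of S remain distinct. Independence of u
    and a makes its components a tree. The row balance of the edges u and us
    at a vertex of S is the balance of S there. By the column balance, the
    middle edges of the paths are balanced; a component with one such edge
    would be a loop, and contribute a vanishing trace. So the components of
    the family have at least two edges, those of u satisfy |E| + 2 <= 2 |V|,
    and many vertices of T are incident to edges u and us only; these come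
    from vertices of S. *)
Lemma invariant_support (tau0 : tgraph A -> Cplx R) (S : tgraph A) :
  unitarily_invariant a -> injective_version tau0 ->
  (forall e : edg S, smallest (@is_subalgebra R A) (range a) (lab e)) ->
  (forall e : edg S, traffic_trace (lab e) = 0) -> tau0 S != 0 ->
  (forall v, #|[set e : edg S | tgt e == v]%SET| = #|[set e : edg S | src e == v]%SET|) /\
  (#|edg S| + 2 <= 2 * #|vtx S|)%N.
Proof.
move=> [A' [f [u [us [fE [uus usu] lim [tau0' t0P' fact] inv]]]]] t0P hD h0.
rewrite (tau0_conj fE uus usu inv t0P' t0P hD).
set M := vtx _ => nz.
have [iota [ii [chi]]] : exists iota : {ffun vtx S -> M}, injective iota /\
    exists chi : {ffun edg S * bool -> M}, conj_weight f u us tau0' iota chi != 0.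
  apply: contrapT => no; move/eqP: nz; apply; rewrite /conj_inj big1 // => iota /injectiveP ii.
  rewrite big1 // => chi _; apply: contrapT => /eqP nzw; apply: no.
  by exists iota; split=> //; exists chi.
rewrite /conj_weight; set phi : vtx (conj_graph S) -> M := join_map _ _.
set T := timg phi; rewrite mulf_eq0 negb_or => /andP[_]; rewrite /conj_tau0 => nzT {nz}.
have [E0|E0] := posnP #|edg S|.
  have V0 : (0 < #|vtx S|)%N by have /andP[] := tg_conn S.
  split; last by rewrite E0; lia.
  move=> v; rewrite !(eq_card0 (A := mem [set e : edg S | _]%SET)) // => e;
  by have := fintype0 e E0.
pose B (b : bool) := smallest (@is_gsubalgebra R A')
  (if b then [set u; us] else range (f \o a)).
have B0 i : B i 0 by case: (gsubalgebra_smallest (if i then [set u; us] else range (f \o a))) => -[].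
have fB y : smallest (@is_subalgebra R A) (range a) y -> B false (f y).
  move: y; apply: smallest_sub; last first.
    by move=> _ [j _ <-]; apply: sub_gen_smallest; exists j.
  have [[[b0 bZ] bM] b1] := gsubalgebra_subalgebra (gsubalgebra_smallest (range (f \o a))).
  split; first split; first split.
  - by rewrite /= (enl0 fE).
  - by move=> c x y hx hy; rewrite /= (enl_lin fE); exact: bZ.
  - by move=> x y hx hy; rewrite /= (enl_gmul fE); exact: bM.
  - by rewrite /= (enl_gone fE).
have uB b : B true (uvar u us b) by apply: sub_gen_smallest; case: b; [right|left].
have hB (e : edg T) : B (tag (lab e)) (conj_ev u us f (tagged (lab e))).
  by case: e => e [[|[|[|//]]] lj]; [exact: uB|exact: fB|exact: uB].
move: nzT; rewrite (@indep_form _ _ _ _ _ B0 _ (conj_ev u us f) T fact hB).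
case: asboolP => [tree|_]; last by rewrite eqxx.
move/prodf_neq0 => nzC; have {}nzC C := nzC C isT.
(* The positions of u, x and us in the path that replaces an edge labeled by
   x. *)
pose o0 : 'I_3 := @Ordinal 3 0 isT; pose o1 : 'I_3 := @Ordinal 3 1 isT.
pose o2 : 'I_3 := @Ordinal 3 2 isT.
pose col (x : {_ : bool & (bool + A)%type}) := tag x.
have colE (d : edg T) : col (lab d) = (d.2 != o1) by case: d => e [[|[|[|//]]] lj].
have var0 (d : edg T) : is_var false (lab d) = (d.2 == o0).
  by case: d => e [[|[|[|//]]] lj].
have var2 (d : edg T) : is_var true (lab d) = (d.2 == o2).
  by case: d => e [[|[|[|//]]] lj].
have colT (d : edg T) : tag (lab d) = is_var false (lab d) || is_var true (lab d).
  by case: d => e [[|[|[|//]]] lj].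
have slice (j : 'I_3) (p q : pred (edg T)) : (forall d, p d = (d.2 == j)) ->
    #|[set d : edg T | p d && q d]%SET| = #|[set e : edg S | q (e, j)]%SET|.
  move=> pE; rewrite -[RHS](card_imset (f := fun e : edg S => (e, j))); last by move=> x y [].
  apply: eq_card => -[e i]; rewrite inE pE /=; apply/andP/imsetP => [[/eqP -> qe]|[e' + [-> ->]]].
    by exists e; rewrite ?inE.
  by rewrite inE eqxx.
have phil x : phi (inl x) = iota x by rewrite /phi ffunE.
split.
  move=> v; have := haar_row lim t0P' colT nzC (to_img phi (inl v)).
  rewrite (slice o0 _ _ var0) (slice o2 _ _ var2).
  have E (x : vtx S) : (to_img phi (inl x) == to_img phi (inl v)) = (x == v).
    by rewrite -val_eqE /= !phil (inj_eq ii).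
  by congr (_ = _); apply: eq_card => e; rewrite !inE; exact: E.
have nocol (d : edg T) : (col (lab d) == false) = (d.2 == o1).
  by rewrite colE eqbF_neg negbK.
have bal (v : vtx T) :
    #|[set d : edg T | (col (lab d) == false) && (tgt d == v)]%SET| =
    #|[set d : edg T | (col (lab d) == false) && (src d == v)]%SET|.
  rewrite !(slice o1 _ _ nocol).
  have := haar_column lim t0P' colT nzC v.
  by rewrite (slice o0 _ _ var0) (slice o2 _ _ var2).
have two (C : component col T) d : d \in val C -> col (lab d) = false -> (2 <= #|val C|)%N.
  move=> dC cd; rewrite leqNgt; apply/negP => C1.
  have st := single_edge_loop bal dC cd C1.
  move/negP: (nzC C); apply; apply/eqP.
  rewrite (tau0_single_loop _ t0P' dC C1 st).
  move: cd; rewrite colE; case: (d) => e [[|[|[|//]]] lj] //= _.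
  by rewrite (enl_trace fE); exact: h0.
have ET : (0 < #|edg T|)%N by rewrite card_prod card_ord muln_gt0 E0.
have hyp : forall C, C \in components col T -> forall e, e \in C ->
    if col (lab e) == false then (2 <= #|C|)%N else (#|C| + 2 <= 2 * #|sub_vtx C|)%N.
  move=> C CP e eC; case: eqP => [ce|/eqP ce].
    exact: (two (exist _ C CP) e).
  have ct : col (lab e) by move: ce; case: (col _).
  by have [] := haar_component lim t0P' colT nzC (C := exist _ C CP) eC ct.
have := @gcc_tree_many_vtx _ _ col T false ET tree hyp.
have nf : #|[set e : edg T | col (lab e) == false]%SET| = #|edg S|.
  rewrite -cardsT -[RHS](slice o1 _ predT nocol).
  by apply: eq_card => d; rewrite !inE andbT.
have := cardsC [set e : edg T | col (lab e) == false]%SET.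
have -> : (~: [set e : edg T | col (lab e) == false])%SET =
  [set e : edg T | col (lab e) != false]%SET by apply/setP => e; rewrite !inE.
rewrite nf [#|edg T|]card_prod card_ord.
set W := [set v : vtx T | _]%SET; set n := #|[set e | _]%SET|.
have leW : (#|W| <= #|vtx S|)%N.
  apply: (@leq_trans #|[set to_img phi (inl x) | x in vtx S]%SET|); last exact: leq_imset_card.
  apply/subset_leq_card/fintype.subsetP => w; rewrite inE => /forallP hw.
  have [[x|[e b]] xw] := to_img_surj w; first by apply/imsetP; exists x.
  have := hw (e, o1); rewrite colE eqxx implybF => /negP[].
  by rewrite /touch -xw; case: b {xw}; rewrite eqxx ?orbT.
lia.
Qed.

End SupportOfInvariantFamilies.

Section CycleQuotient.
Variables (X : Type) (I : finType) (col : X -> I) (n : nat) (b : 'I_n.+1 -> X).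
Hypothesis alt : forall j k : 'I_n.+1, k = j.+1 :> nat -> col (b j) != col (b k).
Variable P : vpart 'I_n.+1.
Local Notation T := (@tquot X (cycle_graph b) P).

Lemma ordS_succ (j : 'I_n.+1) : ordS j != ord0 -> ordS j = j.+1 :> nat.
Proof.
have := ltn_ord j; rewrite ltnS leq_eqVlt => /orP[/eqP jn|jn]; last by rewrite /= modn_small.
by rewrite -val_eqE /= jn modnn.
Qed.

(** Along a cycle as many edges enter a block as leave it, counting all
    colors: if all colors but one are balanced, so is the last one. *)
Lemma cycle_balance (l0 : I) :
  (forall c, c != l0 -> forall v : vtx T,
     #|[set e : edg T | (col (lab e) == c) && (tgt e == v)]%SET| =
     #|[set e : edg T | (col (lab e) == c) && (src e == v)]%SET|) ->
  forall c (v : vtx T), #|[set e : edg T | (col (lab e) == c) && (tgt e == v)]%SET| =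
     #|[set e : edg T | (col (lab e) == c) && (src e == v)]%SET|.
Proof.
move=> bal c v; have [->|] := eqVneq c l0; last by move=> /bal ->.
have tot (g : edg T -> vtx T) : #|[set e | g e == v]%SET| =
    (\sum_c #|[set e : edg T | (col (lab e) == c) && (g e == v)]%SET|)%N.
  rewrite -sum1_card (partition_big (fun e : edg T => col (lab e)) predT) //=.
  by apply: eq_bigr => d _; rewrite -sum1_card; apply: eq_bigl => e; rewrite !inE andbC.
have : #|[set e : edg T | tgt e == v]%SET| = #|[set e : edg T | src e == v]%SET|.
  rewrite -[RHS](card_imset _ (@ordS_inj n.+1)); apply: eq_card => j; rewrite inE.
  apply/idP/imsetP => [jv|[i + ->]]; last by rewrite inE.
  by exists (ord_pred j); rewrite ?inE /= ord_predK.
rewrite !tot (bigD1 l0) //= [RHS](bigD1 l0) //= [X in (_ + X)%N](eq_bigr _ (fun d dl => bal d dl v)).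
exact: addIn.
Qed.

Hypothesis bal : forall c (v : vtx T),
  #|[set e : edg T | (col (lab e) == c) && (tgt e == v)]%SET| =
  #|[set e : edg T | (col (lab e) == c) && (src e == v)]%SET|.

(** If j is alone in its block, the edge j enters it and the edge j - 1 leaves
    it; by balance they have the same color, against alternation. Nothing is
    assumed on the colors of the last and first edges, whence the exception
    for the block of 0. *)
Lemma cycle_block_card (v : vtx T) :
  (2 <= #|[set j : 'I_n.+1 | vblock P j == v]%SET| + (vblock P ord0 == v))%N.
Proof.
have [j jv] := vblock_surj v.
case: eqP => [v0|nv0].
  by rewrite addn1 ltnS; apply/card_gt0P; exists j; rewrite inE jv.
rewrite addn0 ltnNge; apply/negP => /card_le1_eqP one.
have uniq k : vblock P k = v -> k = j.
  by move=> kv; apply: one; rewrite inE ?kv ?jv.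
have : (0 < #|[set e : edg T | (col (lab e) == col (b j)) && (src e == v)]%SET|)%N.
  by rewrite -bal; apply/card_gt0P; exists j; rewrite inE eqxx /= jv.
case/card_gt0P => k; rewrite inE => /andP[/eqP ck /eqP /uniq kj].
have j0 : j != ord0 by apply/eqP => j0; apply: nv0; rewrite -jv j0.
have kS : j = k.+1 :> nat by move: j0; rewrite -kj; exact: ordS_succ.
by move/negP: (alt kS); apply; apply/eqP; exact: ck.
Qed.

(** The indices in W, those of the edges of color l0 and their successors are
    disjoint, except that 0 may be both of color l0 and a successor. The
    blocks in W have at least two elements, except that of 0, so that the
    indices in W number at least 2 |W| - 1. The two exceptions exclude each
    other. *)
Lemma cycle_count (l0 : I) :
  (2 * #|[set v : vtx T | [forall e : edg T, touch e v ==> (col (lab e) != l0)]]%SET| +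
   2 * #|[set e : edg T | col (lab e) == l0]%SET| <= n.+2)%N.
Proof.
set W := [set v | _]%SET; set A := [set e : edg T | _]%SET.
pose B := [set ordS j | j in A]%SET.
pose N := [set j : 'I_n.+1 | vblock P j \in W]%SET.
have NE j : (j \in N) = (vblock P j \in W) by rewrite inE.
have cB : #|B| = #|A| by rewrite card_imset //; exact: ordS_inj.
have notW (e : edg T) v : v \in W -> touch e v -> e \notin A.
  by rewrite !inE => /forallP/(_ e)/implyP.
have NA j : j \in N -> j \notin A.
  by rewrite inE => jW; apply: (notW j _ jW); exact: (@touch_tgt _ T).
(* The source of the edge i is the block of its successor. *)
have NB j : j \in N -> j \notin B.
  rewrite inE => jW; apply/imsetP => -[i iA ji].
  have := notW i _ jW; rewrite iA => /(_ _)/negP; apply; last by [].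
  by rewrite ji; exact: (@touch_src _ T).
have AB j : j \in A -> j \in B -> j = ord0.
  move=> jA /imsetP[i iA ji]; apply/eqP; apply/negPn/negP => j0.
  have iS : j = i.+1 :> nat by rewrite ji; apply: ordS_succ; rewrite -ji.
  move: iA jA; rewrite !inE => /eqP ci /eqP cj.
  by move/negP: (alt iS); apply; apply/eqP; exact: etrans ci (esym cj).
have cW : (2 * #|W| <= #|N| + (ord0 \in N))%N.
  have -> : #|N| = (\sum_(v in W) #|[set j : 'I_n.+1 | vblock P j == v]%SET|)%N.
    rewrite -sum1_card (partition_big (vblock P) (mem W)) /=; last by move=> j; rewrite NE.
    apply: eq_bigr => v vW; rewrite -sum1_card; apply: eq_bigl => j.
    rewrite NE [RHS]inE; by case: eqP => [->|]; rewrite ?andbF ?vW.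
  have -> : nat_of_bool (ord0 \in N) = (\sum_(v in W) (vblock P ord0 == v))%N.
    rewrite NE; have [vW|nW] := boolP (_ \in W).
      rewrite (bigD1 _ vW) /= eqxx big1 // => v /andP[_]; rewrite eq_sym.
      by case: eqP.
    rewrite big1 // => v vW; case: eqP => // e.
    by move: nW; rewrite e vW.
  rewrite -big_split /= mulnC -sum_nat_const; apply: leq_sum => v _.
  exact: cycle_block_card.
have cU : (#|N| + #|(A :|: B)%SET| <= n.+1)%N.
  rewrite -[X in (_ <= X)%N]card_ord -(cardsC (A :|: B)%SET) addnC leq_add2l.
  apply/subset_leq_card/fintype.subsetP => j jN.
  by rewrite finset.in_setC finset.in_setU negb_or NA ?NB.
have cI : (#|(A :&: B)%SET| + (ord0 \in N) <= 1)%N.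
  have [zN|zN] := boolP (ord0 \in N); last first.
    rewrite addn0 -(cards1 (ord0 : 'I_n.+1)); apply/subset_leq_card/fintype.subsetP => j.
    by rewrite finset.in_setI => /andP[jA jB]; rewrite (AB j jA jB); exact: finset.set11.
  rewrite (_ : (A :&: B)%SET = finset.set0) ?cards0 //.
  apply/setP => j; rewrite finset.in_setI finset.in_set0; apply/negP => /andP[jA jB].
  by have := NA _ zN; rewrite -(AB j) // jA.
have := cardsUI A B; rewrite cB => cAB; lia.
Qed.

End CycleQuotient.

(** The trace is tau of a cycle, and every quotient has a vanishing tau0: if
    one did not, the tree condition would give more vertices away from the
    color l0 than alternation allows. *)
Lemma free_indep_families (R : realType) (A : traffic_space R) (L : nat)
    (J : 'I_L -> Type) (a : forall l, J l -> A) (l0 : 'I_L) :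
  indep_families a -> (forall l, l != l0 -> unitarily_invariant (@a l)) ->
  free_indep (@traffic_trace R A) a.
Proof.
move=> [tau0 t0P fact] ua [//|n] l b _ alt hb b0.
rewrite trace_gprod.
pose B l := smallest (@is_gsubalgebra R A) (range (@a l)).
have B0 i : B i 0 by case: (gsubalgebra_smallest (range (@a i))) => -[].
have sB i : gen_subalgebra a i `<=` B i.
  apply: smallest_sub; last exact: sub_gen_smallest.
  by exact/gsubalgebra_subalgebra/gsubalgebra_smallest.
pose tv (x : {_ : 'I_L & A}) : A := tagged x.
pose bb j := existT (fun _ : 'I_L => A) (l j) (b j).
pose T0 := cycle_graph bb.
have [t0i t0E] := t0P.
transitivity (tau (tmap tv T0)).
  by apply: tau_iso; exists id, id; split=> //; exists id.
rewrite t0E big1 // => P _.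
have -> : tau0 (tquot P) = tau0 (tmap tv (@tquot _ T0 P)).
  by apply: t0i; exists id, id; split=> //; exists id.
set T := @tquot _ T0 P.
rewrite (@indep_form _ _ _ _ _ B0 _ id T fact); last by move=> e; exact: (sB _ _ (hb e)).
case: asboolP => // tree; apply/eqP/negPn/negP => /prodf_neq0 nz.
pose col (x : {_ : 'I_L & A}) := tag x.
have inv (C : component col T) d : d \in val C -> col (lab d) != l0 ->
    (forall v, #|[set e : edg (component_graph C) | tgt e == v]%SET| =
               #|[set e : edg (component_graph C) | src e == v]%SET|) /\
    (#|val C| + 2 <= 2 * #|sub_vtx (val C)|)%N.
  move=> dC cd; rewrite -card_component_vtx -card_component_edg.
  apply: (@invariant_support _ _ _ (@a (l d)) tau0 (tmap tv (component_graph C)) (ua _ cd) t0P).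
  - move=> e; have le : l (val e) = l d by exact: (component_col (valP C) (valP e) dC).
    by move: (hb (val e)); rewrite le.
  - by move=> e; exact: b0.
  - exact: nz.
have bal : forall c (v : vtx T), #|[set e : edg T | (col (lab e) == c) && (tgt e == v)]%SET| =
     #|[set e : edg T | (col (lab e) == c) && (src e == v)]%SET|.
  apply: (@cycle_balance _ _ col _ bb P l0) => c cl0 v.
  apply: (@local_count _ _ col T v c (fun e => (col (lab e) == c) && (tgt e == v))
    (fun e => (col (lab e) == c) && (src e == v))).
    by move=> e; case/orP => /andP[/eqP -> /eqP <-]; split.
  move=> C [d dC cd] v' vv; have [|r _] := inv C d dC; first by rewrite cd.
  have colC (e : edg (msub (val C))) : col (lab (val e)) = c.
    by rewrite -cd; exact: (component_col (valP C) (valP e) dC).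
  have := r v'; congr (_ = _); apply: eq_card => e; rewrite !inE;
  by rewrite colC eqxx -vv -val_eqE.
have hyp : forall C, C \in components col T -> forall e, e \in C ->
    if col (lab e) == l0 then (2 <= #|C|)%N else (#|C| + 2 <= 2 * #|sub_vtx C|)%N.
  move=> C CP e eC; case: eqP => [ce|/eqP ce]; last by have [] := inv (exist _ C CP) e eC ce.
  rewrite leqNgt; apply/negP => C1; pose C' : component col T := exist _ C CP.
  have st := @single_edge_loop _ _ col T l0 C' e (bal l0) eC ce C1.
  move/negP: (nz C' isT); apply; apply/eqP.
  by rewrite (@tau0_single_loop _ _ col T _ _ tau0 tv C' e t0P eC C1 st) b0.
have E0 : (0 < #|edg T|)%N by rewrite card_ord.
have := gcc_tree_many_vtx E0 tree hyp.
have := @cycle_count _ _ col _ bb alt P bal l0.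
rewrite -/T /=.
set W := #|[set v | _]%SET|; set m := #|[set e | _ == l0]%SET|.
have := cardsC [set e : edg T | col (lab e) == l0]%SET.
have -> : (~: [set e : edg T | col (lab e) == l0])%SET =
  [set e : edg T | col (lab e) != l0]%SET by apply/setP => e; rewrite !inE.
rewrite [#|edg T|]card_ord -/m; set k := #|[set e | _]%SET|; lia.
Qed.

Theorem theorem5p5 (R : realType) (A : traffic_space R) (L : nat)
  (J : 'I_L -> Type) (a : forall l : 'I_L, J l -> A) :
  (indep_families a ->
    [/\ (exists l0 : 'I_L,
           forall l : 'I_L, l != l0 -> unitarily_invariant (a l)) ->
          free_indep (@traffic_trace R A) a,
        (forall l : 'I_L, boolean_type (a l)) ->
          boolean_indep (@traffic_antitrace R A) a
      & (forall (l : 'I_L) (j : J l), is_diagonal (a l j)) ->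
          tensor_indep (@traffic_trace R A) a /\ tensor_indep (@traffic_antitrace R A) a]) /\
  ((forall (l : 'I_L) (j : J l), is_diagonal (a l j)) ->
    (tensor_indep (@traffic_trace R A) a -> indep_families a) /\
    (tensor_indep (@traffic_antitrace R A) a -> indep_families a)).
Proof.
split=> [ind|ad].
  split=> [[l0 ua]|ab|ad].
  - exact: free_indep_families ua.
  - exact: boolean_indep_families.
  - exact: diag_tensor.
split=> [|/(tensor_antitrace_trace ad)]; exact: tensor_diag.
Qed.
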